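(* For every integer $d\ge 1$ there is a constant $\gamma_d>0$ with the following property. Let $\mathcal F_1,\dots,\mathcal F_{2d}$ be finite non-empty families of convex sets in $\mathbb R^d$ such that $$\operatorname{vol}_d\Big(\bigcap_{i=1}^{2d}F_i\Big)\ge 1\qquad\text{whenever } F_i\in\mathcal F_i \text{ for every } i\in\{1,\dots,2d\}.$$ Then, for some $i\in\{1,\dots,2d\}$, $$\operatorname{vol}_d\Big(\bigcap_{F\in\mathcal F_i}F\Big)\ge\gamma_d .$$ Moreover, one may take $\gamma_1=1$, and there is an absolute constant $c>0$ such that one may take $\gamma_d=d^{-c d^2}$ for every $d\ge 2$. The number $2d$ of families is optimal: for every $d\ge1$ and every integer $1\le k<2d$, there is no constant $\gamma>0$ such that the corresponding statement with $k$ families $\mathcal F_1,\dots,\mathcal F_k$ in place of $2d$ families (and $\gamma$ in place of $\gamma_d$) holds.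
   Context: $\operatorname{vol}_d$ denotes $d$-dimensional volume (Lebesgue measure, possibly $+\infty$). *)

(* Defs.v *)
From mathcomp Require Import all_boot all_order all_algebra.
From mathcomp Require Import all_classical all_reals all_analysis.

Set Implicit Arguments.
Unset Strict Implicit.
Unset Printing Implicit Defensive.

Import Order.TTheory GRing.Theory Num.Theory.

Local Open Scope classical_set_scope.
Local Open Scope ring_scope.

(* ]a_0, b_0] x ... x ]a_(d-1), b_(d-1)] *)
Definition box (R : realType) (d : nat) (a b : 'rV[R]_d) : set 'rV[R]_d :=
  [set x | forall i : 'I_d, a 0 i < x 0 i <= b 0 i].

Definition box_vol (R : realType) (d : nat) (a b : 'rV[R]_d) : R :=
  \prod_(i < d) (b 0 i - a 0 i).

(* [box_vol] is the volume of [box] only when a <= b coordinatewise, hence the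
   first condition; a = b gives the empty box (for d >= 1), so that finite
   covers are included. *)
Definition box_cover (R : realType) (d : nat) (A : set 'rV[R]_d)
    (a b : nat -> 'rV[R]_d) : Prop :=
  (forall n (i : 'I_d), a n 0 i <= b n 0 i) /\
  A `<=` \bigcup_n box (a n) (b n).

(* d-dimensional Lebesgue outer measure. It coincides with Lebesgue measure on
   Lebesgue-measurable sets, in particular on all convex sets (which need not
   be Borel for d >= 2). *)
Definition vol (R : realType) (d : nat) (A : set 'rV[R]_d) : \bar R :=
  ereal_inf [set v : \bar R | exists a b : nat -> 'rV[R]_d,
    box_cover A a b /\
    v = (\sum_(0 <= n <oo) (box_vol (a n) (b n))%:E)%E].

(* Since only intersections matter, a family is rendered as a set of sets. *)
Definition finite_convex_family (R : realType) (d : nat)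
    (F : set (set 'rV[R]_d)) : Prop :=
  [/\ finite_set F, F !=set0 &
      forall A : set 'rV[R]_d, F A -> @convex_set R 'rV[R]_d A].

Definition colorful_volume_helly (R : realType) (d k : nat) (gamma : R) : Prop :=
  forall F : 'I_k -> set (set 'rV[R]_d),
    (forall i, finite_convex_family (F i)) ->
    (forall G : 'I_k -> set 'rV[R]_d, (forall i, F i (G i)) ->
      (1%:E <= vol (\bigcap_i G i))%E) ->
    exists i, (gamma%:E <= vol (\bigcap_(A in F i) A))%E.

(* Main.v *)
(* A set of volume at least 1 contains a simplex of determinant at least d^(-O(d)), and a
   convex set containing a simplex has volume at least d^(-O(d^2)) times its determinant, so
   volumes are replaced by determinants of inscribed simplices. If every colour fails, then by
   compactness each colour i has a finite list of half-spaces, each containing (in a large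
   cube) a member of the family, whose intersection contains no large simplex. Pushing the
   half-spaces outwards makes the largest simplex of the intersection K_i of comparable size.
   Consider the vectors u occurring in affine partitions s_0 + ... + s_d = 1 of unity into
   nonnegative multiples of the functions defining K_i, and place each as (u, 0) or (0, u) in
   R^(2d). A transversal of the 2d colours with nearly maximal determinant splits the colours
   into two blocks of d, and exchanging several rows at a time bounds cycles of coordinates;
   the resulting potentials p_i satisfy |coordinate k of u| <= O(d^3) p_k / p_i for u of
   colour i. By Farkas, a colour of maximal potential contains a simplex with edges along the
   dual basis, which bounds max p from above. On the other hand, counting simplicial cones over
   the rows of either block is independent of a generic vector v, and comparing the cones
   containing v in the first block with those containing -v in the second produces a rainbow
   positive relation of small slack, so the rainbow intersection has only small simplices.
   Sets of volume zero and unbounded sets are covered by the same projection argument that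
   bounds volume by determinants. For the optimality of 2d, take all families equal to the 2d
   facet half-spaces of a small cube; on the line, compare the extreme endpoints of the two
   intersections. *)

(* The colours may live at very different scales. Near-maximality of a determinant controls only
   products of entries along cycles, and the potentials turn these into bounds for single entries.
   Doubling the space lets every colour compete for both blocks, so that normalising by the first
   block alone controls all colours at once: colour i then contributes d + 1 vectors of bounded
   entries and sum zero, whose constants sum to p_i. A rainbow relation is useful only if its slack
   is small while its determinant and its coefficients are bounded below. Averaging over all rainbow
   cones, weighted by determinants, achieves this: once v and -v are taken together, the weight
   attached to a vector of a given colour is the same for all vectors of that colour, so its
   constants enter only through their sum p_i. The exponent of order d^2 arises because the
   determinant of the second block is only known to be at least d^(-O(d)); this enters a width, and
   the width is raised to the power d. *)
From HB Require Import structures.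
Require Import Defs.
From mathcomp Require Import all_boot all_order all_algebra.
From mathcomp Require Import perm ring lra zify finmap.
From mathcomp Require Import all_classical all_reals all_analysis measurable_realfun.

Set Implicit Arguments.
Unset Strict Implicit.
Unset Printing Implicit Defensive.

Import Order.TTheory GRing.Theory Num.Theory.
Local Open Scope ring_scope.

(** * Determinants and row replacement *)

Section RowReplacement.
Variables (F : fieldType) (d : nat).
Implicit Types (A : 'M[F]_d) (v w : 'rV[F]_d) (i j k : 'I_d).

Definition repl A i v : 'M[F]_d :=
  \matrix_(k, j) if k == i then v 0 j else A k j.

Lemma row_repl A i v k : row k (repl A i v) = if k == i then v else row k A.
Proof. by apply/rowP => j; rewrite !mxE; case: eqP => _; rewrite ?mxE. Qed.

Lemma repl_row A i : repl A i (row i A) = A.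
Proof. by apply/matrixP => k j; rewrite !mxE; case: eqP => // ->. Qed.

Lemma replC A i j v w : i != j -> repl (repl A i v) j w = repl (repl A j w) i v.
Proof.
move=> ij; apply/matrixP => k l; rewrite !mxE.
by case: eqP => [->|//]; rewrite eq_sym (negPf ij).
Qed.

Lemma repl_repl A i v w : repl (repl A i v) i w = repl A i w.
Proof. by apply/matrixP => k l; rewrite !mxE; case: eqP. Qed.

Lemma det_repl_lin A i a v b w :
  \det (repl A i (a *: v + b *: w)) = a * \det (repl A i v) + b * \det (repl A i w).
Proof.
apply: (determinant_multilinear (i0 := i)).
- by rewrite !row_repl eqxx.
- by apply/matrixP => k l; rewrite !mxE eq_sym (negPf (neq_lift _ _)).
- by apply/matrixP => k l; rewrite !mxE eq_sym (negPf (neq_lift _ _)).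
Qed.

Lemma det_replD A i v w :
  \det (repl A i (v + w)) = \det (repl A i v) + \det (repl A i w).
Proof. by have := det_repl_lin A i 1 v 1 w; rewrite !scale1r !mul1r. Qed.

Lemma det_replZ A i a v : \det (repl A i (a *: v)) = a * \det (repl A i v).
Proof. by have := det_repl_lin A i a v 0 0; rewrite scale0r addr0 mul0r addr0. Qed.

Lemma det_repl0 A i : \det (repl A i 0) = 0.
Proof. by have := det_replZ A i 0 0; rewrite scale0r mul0r. Qed.

Lemma det_replN A i v : \det (repl A i (- v)) = - \det (repl A i v).
Proof. by rewrite -scaleN1r det_replZ mulN1r. Qed.

Lemma det_repl_sum (I : Type) (r : seq I) (P : pred I) (w : I -> 'rV_d) A i :
  \det (repl A i (\sum_(k <- r | P k) w k)) = \sum_(k <- r | P k) \det (repl A i (w k)).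
Proof.
by apply: (big_morph (fun v => \det (repl A i v))); [exact: det_replD|exact: det_repl0].
Qed.

Lemma det_repl_row A i k : i != k -> \det (repl A i (row k A)) = 0.
Proof.
move=> ik; apply: (determinant_alternate ik) => j.
by rewrite !mxE eqxx eq_sym (negPf ik).
Qed.

Lemma det_repl_swap A i j v w : i != j ->
  \det (repl (repl A i v) j w) = - \det (repl (repl A i w) j v).
Proof.
move=> ij; apply/eqP; rewrite -addr_eq0; apply/eqP.
have alt u : \det (repl (repl A i u) j u) = 0.
  apply: (determinant_alternate ij) => l.
  by rewrite !mxE !eqxx (negPf ij).
have := alt (v + w); rewrite det_replD.
rewrite (replC _ _ _ ij) det_replD -!(replC _ _ _ ij) alt add0r.
by rewrite (replC _ _ w ij) det_replD -!(replC _ _ _ ij) alt addr0 addrC.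
Qed.

Lemma det_repl_cramer A i (a : 'I_d -> F) :
  \det (repl A i (\sum_k a k *: row k A)) = a i * \det A.
Proof.
rewrite det_repl_sum (bigD1 i) //= det_replZ repl_row big1 ?addr0 // => k ki.
by rewrite det_replZ det_repl_row ?mulr0 // eq_sym.
Qed.

Lemma row_coords A v : A \in unitmx ->
  v = \sum_k (v *m invmx A) 0 k *: row k A.
Proof.
by move=> uA; rewrite -mulmx_sum_row mulmxKV.
Qed.

(** Three-term Pluecker relation: when w is expanded in the rows of A, only its coordinates i and j
    survive, and Cramer's rule identifies them. *)
Lemma det_repl_plucker A i j v w : i != j -> \det A != 0 ->
  \det A * \det (repl (repl A j v) i w) =
  \det (repl A j v) * \det (repl A i w) - \det (repl A j w) * \det (repl A i v).
Proof.
move=> ij dA; have uA : A \in unitmx by rewrite unitmxE unitfE.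
rewrite (row_coords w uA); pose a : 'I_d -> F := fun k => (w *m invmx A) 0 k.
rewrite -[X in repl _ i X]/(\sum_k a k *: row k A) !det_repl_cramer det_repl_sum.
rewrite (bigD1 i) //= (bigD1 j) 1?eq_sym //= big1 ?addr0 => [|k /andP[ki kj]]; last first.
  rewrite det_replZ; apply/eqP; rewrite mulf_eq0; apply/orP; right; apply/eqP.
  have -> : row k A = row k (repl A j v) by rewrite row_repl (negPf kj).
  by rewrite det_repl_row // eq_sym.
rewrite !det_replZ.
have -> : repl (repl A j v) i (row i A) = repl A j v.
  have {1}-> : row i A = row i (repl A j v) by rewrite row_repl (negPf ij).
  by rewrite repl_row.
rewrite [X in _ + _ * X]det_repl_swap 1?eq_sym // repl_row -/(a i) -/(a j); ring.
Qed.

End RowReplacement.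

(** * Entering and leaving an orthant along a segment *)

Section Toggle.
Variables (R : realFieldType) (d : nat).

Lemma sum_indic_unique (I : finType) (b : pred I) (i : I) :
  b i -> (forall k, b k -> k = i) -> \sum_k (b k)%:R = 1 :> R.
Proof.
move=> bi ub; rewrite (bigD1 i) //= bi big1 ?addr0 // => k.
by case: (boolP (b k)) => // /ub ->; rewrite eqxx.
Qed.

Lemma sum_indic0 (I : finType) (b : pred I) :
  (forall k, ~~ b k) -> \sum_k (b k)%:R = 0 :> R.
Proof. by move=> b0; rewrite big1 // => k _; rewrite (negPf (b0 k)). Qed.

(* The indicator of an intersection of half-lines jumps up at the last entering
   time and down at the first leaving time, provided the former comes first. *)
Lemma enter_leave_count (P N : pred 'I_d) (t : 'I_d -> R) :
  (forall i j, P i -> P j -> t i = t j -> i = j) ->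
  (forall i j, N i -> N j -> t i = t j -> i = j) ->
  (forall i j, P i -> N j -> t i != t j) ->
  \sum_i (P i && [forall j, (j != i) ==>
       ((P j ==> (t j < t i)) && (N j ==> (t i < t j)))])%:R
  - \sum_i (N i && [forall j, (j != i) ==>
       ((N j ==> (t i < t j)) && (P j ==> (t j < t i)))])%:R
  = [forall i, ~~ N i]%:R - [forall i, ~~ P i]%:R :> R.
Proof.
move=> tP tN tPN.
have [PN|[k0 Pk0]] : (forall i, ~~ (P i && N i)) \/ exists k, P k && N k.
  by case: (pickP (fun i => P i && N i)) => [k ?|nPN]; [right; exists k|left=> i; rewrite nPN].
  2: by case/andP: Pk0 => Pk Nk; have := tPN _ _ Pk Nk; rewrite eqxx.
pose E i := P i && [forall j, (j != i) ==>
       ((P j ==> (t j < t i)) && (N j ==> (t i < t j)))].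
pose X i := N i && [forall j, (j != i) ==>
       ((N j ==> (t i < t j)) && (P j ==> (t j < t i)))].
change (\sum_i (E i)%:R - \sum_i (X i)%:R
  = [forall i, ~~ N i]%:R - [forall i, ~~ P i]%:R :> R).
have EN i j : E i -> N j -> t i < t j.
  case/andP=> Pi /forallP/(_ j) + Nj; rewrite Nj /=.
  case: eqVneq => [ji|_ /andP[]//]; have := PN i; by rewrite Pi -ji Nj.
have EP i j : E i -> P j -> t j <= t i.
  case/andP=> Pi /forallP/(_ j) + Pj; rewrite Pj /=.
  by case: eqVneq => [-> //|_ /andP[/ltW]].
have XP i j : X i -> P j -> t j < t i.
  case/andP=> Ni /forallP/(_ j) + Pj; rewrite Pj /=.
  case: eqVneq => [ji|_ /andP[]//]; have := PN i; by rewrite Ni -ji Pj.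
have XN i j : X i -> N j -> t i <= t j.
  case/andP=> Ni /forallP/(_ j) + Nj; rewrite Nj /=.
  by case: eqVneq => [-> //|_ /andP[/ltW]].
have EE p : P p -> (forall j, P j -> t j <= t p) -> (forall j, N j -> t p < t j) ->
    \sum_i (E i)%:R = 1 :> R.
  move=> Pp mp Np; apply: (@sum_indic_unique _ _ p).
    rewrite /E Pp; apply/forallP => j; apply/implyP => jp; apply/andP; split; apply/implyP => Hj.
      by rewrite lt_neqAle mp // andbT; apply: contra_neq jp; exact: tP.
    exact: Np.
  by move=> k Ek; apply: tP => //; [case/andP: Ek|apply/le_anti; rewrite mp ?EP //; case/andP: Ek].
have XX n : N n -> (forall j, N j -> t n <= t j) -> (forall j, P j -> t j < t n) ->
    \sum_i (X i)%:R = 1 :> R.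
  move=> Nn mn Pn; apply: (@sum_indic_unique _ _ n).
    rewrite /X Nn; apply/forallP => j; apply/implyP => jn; apply/andP; split; apply/implyP => Hj.
      by rewrite lt_neqAle mn // andbT; apply: contra_neq jn => e; exact/esym/tN.
    exact: Pn.
  by move=> k Xk; apply: tN => //; [case/andP: Xk|apply/le_anti; rewrite mn ?XN //; case/andP: Xk].
have allF (Q : pred 'I_d) i : Q i -> [forall i, ~~ Q i] = false.
  by move=> Qi; apply/negP => /forallP /(_ i); rewrite Qi.
have allT (Q : pred 'I_d) : Q =1 xpred0 -> [forall i, ~~ Q i] = true.
  by move=> Q0; apply/forallP => i; rewrite Q0.
case: (pickP P) => [p0 Pp0|P0]; case: (pickP N) => [n0 Nn0|N0].
- pose p := [arg max_(i > p0 | P i) t i]%O; pose n := [arg min_(i < n0 | N i) t i]%O.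
  have [Pp mp] : P p /\ forall j, P j -> t j <= t p.
    by rewrite /p; case: arg_maxP => // i Pi mi; split.
  have [Nn mn] : N n /\ forall j, N j -> t n <= t j.
    by rewrite /n; case: arg_minP => // i Pi mi; split.
  rewrite (allF _ _ Pp) (allF _ _ Nn) subrr; have [pn|np] := ltP (t p) (t n).
    rewrite (EE p) ?(XX n) ?subrr // => j Hj; first exact: le_lt_trans (mp _ Hj) pn.
    exact: lt_le_trans pn (mn _ Hj).
  rewrite !sum_indic0 ?subrr // => k; apply/negP => Hk; move: np.
    by rewrite leNgt; case/negP; exact: lt_le_trans (XP _ _ Hk Pp) (XN _ _ Hk Nn).
  by rewrite leNgt; case/negP; exact: le_lt_trans (EP _ _ Hk Pp) (EN _ _ Hk Nn).
- pose p := [arg max_(i > p0 | P i) t i]%O.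
  have [Pp mp] : P p /\ forall j, P j -> t j <= t p.
    by rewrite /p; case: arg_maxP => // i Pi mi; split.
  rewrite (allF _ _ Pp) (allT _ N0) (EE p) // ?sum_indic0 // => k; last by rewrite N0.
  by rewrite /X N0.
- pose n := [arg min_(i < n0 | N i) t i]%O.
  have [Nn mn] : N n /\ forall j, N j -> t n <= t j.
    by rewrite /n; case: arg_minP => // i Pi mi; split.
  rewrite (allF _ _ Nn) (allT _ P0) (XX n) // ?sum_indic0 // => k; last by rewrite P0.
  by rewrite /E P0.
- by rewrite (allT _ N0) (allT _ P0) !sum_indic0 ?subrr // => k; rewrite /X /E ?N0 ?P0.
Qed.
End Toggle.

Section Toggle2.
Variables (R : realFieldType) (d : nat).

(** Coordinate i of the segment from a to b vanishes at time [t i]. Coordinates turning positive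
    enter their half-line, those turning negative leave it, and the 2 by 2 minors compare the
    crossing times. A coordinate negative at both ends makes both sides zero; one positive at both
    ends imposes nothing. *)
Lemma segment_orthant (a b : 'I_d -> R) :
  (forall i, a i != 0) -> (forall i, b i != 0) ->
  (forall i j, i != j -> a i * b j != a j * b i) ->
  \sum_i ((a i < 0 < b i) && [forall j, (j != i) ==> (0 < a j * b i - b j * a i)])%:R
  - \sum_i ((b i < 0 < a i) && [forall j, (j != i) ==> (0 < b j * a i - a j * b i)])%:R
  = [forall i, 0 < b i]%:R - [forall i, 0 < a i]%:R :> R.
Proof.
move=> a0 b0 ab.
have [/existsP[k /andP[ak bk]]|/existsPn nn] := boolP [exists k, (a k < 0) && (b k < 0)].
  have -> : [forall i, 0 < b i] = false.
    by apply/negP => /forallP /(_ k); rewrite ltNge ltW.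
  have -> : [forall i, 0 < a i] = false.
    by apply/negP => /forallP /(_ k); rewrite ltNge ltW.
  rewrite !sum_indic0 ?subrr // => i; apply/negP => /andP[/andP[h1 h2] /forallP/(_ k)].
    have -> /= : k != i by apply: contraTneq h2 => <-; rewrite -leNgt ltW.
    by nra.
  have -> /= : k != i by apply: contraTneq h2 => <-; rewrite -leNgt ltW.
  by nra.
pose P i := a i < 0 < b i; pose N i := b i < 0 < a i; pose t i := a i / (a i - b i).
have dP i : P i -> 0 < b i - a i by case/andP=> *; lra.
have dN i : N i -> 0 < a i - b i by case/andP=> *; lra.
have tE i : t i = - a i / (b i - a i) by rewrite /t -opprB invrN mulrN mulNr.
have tlt i j : (P i || N i) -> (P j || N j) ->
    (t i < t j) = (0 < (a i * b j - a j * b i) * ((a i - b i) * (a j - b j))).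
  move=> Hi Hj; have z k : P k || N k -> a k - b k != 0.
    by case/orP => [/dP|/dN]; apply: contraTneq => ?; rewrite -leNgt; lra.
  rewrite -subr_gt0.
  have -> : t j - t i = (a i * b j - a j * b i) * ((a i - b i) * (a j - b j)) /
      ((a i - b i) * (a j - b j)) ^+ 2.
    by rewrite /t; field; rewrite !z.
  by rewrite pmulr_lgt0 // invr_gt0 exprn_even_gt0 //= mulf_neq0 ?z.
have tne i j : (P i || N i) -> (P j || N j) -> t i = t j -> i = j.
  move=> Hi Hj tij; apply/eqP; apply: contraT => ij.
  have := tlt i j Hi Hj; have := tlt j i Hj Hi; rewrite tij ltxx => /esym/negbT.
  rewrite -leNgt => h1 /esym/negbT; rewrite -leNgt => h2.
  have z k : P k || N k -> a k - b k != 0.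
    by case/orP => [/dP|/dN]; apply: contraTneq => ?; rewrite -leNgt; lra.
  have : (a i * b j - a j * b i) * ((a i - b i) * (a j - b j)) = 0 by nra.
  move/eqP; rewrite !mulf_eq0 (negPf (z _ Hi)) (negPf (z _ Hj)) !orbF subr_eq0.
  by rewrite (negPf (ab _ _ ij)).
have := @enter_leave_count R d P N t
  (fun i j Pi Pj => tne i j (introT orP (or_introl Pi)) (introT orP (or_introl Pj)))
  (fun i j Pi Pj => tne i j (introT orP (or_intror Pi)) (introT orP (or_intror Pj))).
have sg i : [|| P i, N i | (0 < a i) && (0 < b i)].
  have := nn i; rewrite /P /N; have := a0 i; have := b0 i.
  by case: (ltgtP (a i) 0); case: (ltgtP (b i) 0).
have -> : [forall i, 0 < b i] = [forall i, ~~ N i].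
  apply/forallP/forallP => H i; have := H i; rewrite /N; first by move=> ?; rewrite negb_and -leNgt ltW.
  by have := sg i; rewrite /P /N => /or3P[/andP[]|->|/andP[]].
have -> : [forall i, 0 < a i] = [forall i, ~~ P i].
  apply/forallP/forallP => H i; have := H i; rewrite /P; first by move=> ?; rewrite negb_and -leNgt ltW.
  by have := sg i; rewrite /P /N => /or3P[->|/andP[]|/andP[]].
move=> <-; last first.
  move=> i j Pi Nj; apply/eqP => /(tne _ _ (introT orP (or_introl Pi)) (introT orP (or_intror Nj))) e.
  by move: Pi Nj; rewrite -e /P /N => /andP[/lt_gtF -> _] /andP[].
congr (_ - _); apply: eq_bigr => i _; congr (nat_of_bool _)%:R.
  rewrite -/(P i); case Pi : (P i) => //=; apply: eq_forallb => j; case: eqVneq => //= ji.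
  have dPi := dP _ Pi; have /andP[ai bi] := Pi.
  case/or3P: (sg j) => H.
  - have dj := dP _ H.
    have -> : N j = false by apply/negP => /andP[? ?]; case/andP: H => ? ?; lra.
    rewrite H /= ?andbT tlt ?H ?Pi ?orbT //.
    rewrite pmulr_lgt0; last by rewrite nmulr_rgt0; lra.
    by apply/idP/idP => ?; lra.
  - have dj := dN _ H.
    have -> : P j = false by apply/negP => /andP[? ?]; case/andP: H => ? ?; lra.
    rewrite H /= ?andbT tlt ?H ?Pi ?orbT //.
    rewrite nmulr_lgt0; last by rewrite nmulr_rlt0 //; lra.
    by apply/idP/idP => ?; lra.
  - case/andP: H => aj bj.
    have -> : P j = false by apply/negP => /andP[? ?]; lra.
    have -> : N j = false by apply/negP => /andP[? ?]; lra.
    by rewrite /=; nra.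
rewrite -/(N i); case Ni : (N i) => //=; apply: eq_forallb => j; case: eqVneq => //= ji.
have dNi := dN _ Ni; have /andP[bi ai] := Ni.
case/or3P: (sg j) => H.
- have dj := dP _ H.
  have -> : N j = false by apply/negP => /andP[? ?]; case/andP: H => ? ?; lra.
  rewrite H /= ?andbT tlt ?H ?Ni ?orbT //.
  rewrite nmulr_lgt0; last by rewrite nmulr_rlt0 //; lra.
  by apply/idP/idP => ?; lra.
- have dj := dN _ H.
  have -> : P j = false by apply/negP => /andP[? ?]; case/andP: H => ? ?; lra.
  rewrite H /= ?andbT tlt ?H ?Ni ?orbT //.
  rewrite pmulr_lgt0; last by rewrite pmulr_rgt0.
  by apply/idP/idP => ?; lra.
- case/andP: H => aj bj.
  have -> : P j = false by apply/negP => /andP[? ?]; lra.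
  have -> : N j = false by apply/negP => /andP[? ?]; lra.
  by rewrite /=; nra.
Qed.

End Toggle2.

(** * Counting simplicial cones *)

Section ConeCount.
Variables (R : realFieldType) (d m : nat).
Implicit Types (u : 'I_d -> 'I_m.+1 -> 'rV[R]_d) (l : {ffun 'I_d -> 'I_m.+1}).
Implicit Types (i j : 'I_d) (v w : 'rV[R]_d).

Definition upd l i x : {ffun 'I_d -> 'I_m.+1} := [ffun k => if k == i then x else l k].

(** Exchanging x with the value of l at i is an involution of the pairs (l, x). *)
Lemma sum_upd (f : {ffun 'I_d -> 'I_m.+1} -> R) i :
  \sum_l \sum_x f (upd l i x) = m.+1%:R * \sum_l f l.
Proof.
rewrite pair_big /=.
pose h (p : {ffun 'I_d -> 'I_m.+1} * 'I_m.+1) := (upd p.1 i p.2, p.1 i).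
have hK : involutive h.
  move=> [l x]; rewrite /h /=; congr (_, _); last by rewrite ffunE eqxx.
  by apply/ffunP => k; rewrite !ffunE; case: eqP => [->|].
rewrite (reindex_inj (inv_inj hK)) /=.
rewrite (eq_bigr (fun p => f p.1)); last first.
  by move=> p _; have /(congr1 fst) /= e := hK p; rewrite -[in RHS]e.
rewrite -(pair_big xpredT xpredT (fun l (x : 'I_m.+1) => f l)) /= mulr_sumr.
by apply: eq_bigr => l _; rewrite sumr_const card_ord mulr_natl.
Qed.

Definition rain u l : 'M[R]_d := \matrix_(i, j) u i (l i) 0 j.
Definition rdet u l i v := \det (repl (rain u l) i v).
(** By Cramer's rule [rdet u l i v / \det (rain u l)] is the i-th coordinate of v in the rows of
    [rain u l]. The product has the same sign, so this is membership in the open simplicial cone. *)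
Definition incone u v l := [forall i, 0 < rdet u l i v * \det (rain u l)].
Definition cone_count u v := \sum_l `|\det (rain u l)| * (incone u v l)%:R.

Lemma row_rain u l i : row i (rain u l) = u i (l i).
Proof. by apply/rowP => j; rewrite !mxE. Qed.

Lemma rain_upd u l i x : rain u (upd l i x) = repl (rain u l) i (u i x).
Proof. by apply/matrixP => k j; rewrite !mxE ffunE; case: eqP => // ->. Qed.

Lemma rdet_upd u l i x v : rdet u (upd l i x) i v = rdet u l i v.
Proof. by rewrite /rdet rain_upd repl_repl. Qed.

Lemma det_rain_upd u l i x : \det (rain u (upd l i x)) = rdet u l i (u i x).
Proof. by rewrite rain_upd. Qed.

(** Grouped by the choices outside colour i, the sum consists of determinants whose row i is
    [\sum_x u i x], which is zero. *)
Lemma sum_det_rain0 u i (c : {ffun 'I_d -> 'I_m.+1} -> R) :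
  \sum_x u i x = 0 -> (forall l x, c (upd l i x) = c l) ->
  \sum_l \det (rain u l) * c l = 0.
Proof.
move=> u0 cE; apply/eqP; rewrite -(mulrI_eq0 _ (mulfI (_ : m.+1%:R != 0 :> R))) ?pnatr_eq0 //.
rewrite -(sum_upd _ i) big1 // => l _.
under eq_bigr => x _ do rewrite det_rain_upd cE.
by rewrite -mulr_suml -det_repl_sum u0 det_repl0 mul0r.
Qed.

Definition balanced u := forall i, \sum_x u i x = 0.
Definition nondegenerate u := forall l, \det (rain u l) != 0.
Definition generic u v := forall l i, rdet u l i v != 0.

(* Moving v along a segment, the cones toggle only when v crosses a wall spanned by
   all colours but one, and the toggled determinants sum to zero. *)
Lemma cone_count_segment u v w :
  balanced u -> nondegenerate u -> generic u v -> generic u w ->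
  (forall l i j, i != j -> \det (repl (repl (rain u l) j v) i w) != 0) ->
  cone_count u v = cone_count u w.
Proof.
move=> bu nu gv gw gvw; apply/esym/eqP; rewrite -subr_eq0 /cone_count -sumrB.
pose n l i j := \det (repl (repl (rain u l) j v) i w).
(* The signed toggle of the cone of l at its wall opposite to colour i. It does not depend on [l i],
   which is what [sum_det_rain0] asks for. *)
pose c i l : R :=
  ((rdet u l i v < 0 < rdet u l i w) && [forall j, (j != i) ==> (0 < n l i j)])%:R
  - ((rdet u l i w < 0 < rdet u l i v) && [forall j, (j != i) ==> (n l i j < 0)])%:R.
rewrite (eq_bigr (fun l => \sum_i \det (rain u l) * c i l)); last first.
  move=> l _; rewrite -mulrBr; set dt := \det (rain u l).
  have dt0 : dt != 0 := nu l.
  pose a i := rdet u l i v / dt; pose b i := rdet u l i w / dt.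
  have nE i j : j != i -> a j * b i - b j * a i = n l i j / dt.
    move=> ji; have := det_repl_plucker v w (_ : i != j) dt0; rewrite eq_sym => /(_ ji).
    rewrite -/(n l i j) -!/(rdet u l _ _) => h; rewrite /a /b.
    apply: (mulfI dt0); rewrite [RHS]mulrCA divff // mulr1; apply: (mulfI dt0).
    by rewrite h -/dt; field.
  have icE z : incone u z l = [forall i, 0 < rdet u l i z / dt].
    apply: eq_forallb => i; have d2 : 0 < dt ^+ 2 by rewrite exprn_even_gt0.
    rewrite -[in RHS](pmulr_lgt0 _ d2); congr (_ < _); rewrite -/dt expr2; field; exact: dt0.
  have := @segment_orthant R d a b _ _ _.
  rewrite -!icE => <-; last 3 first.
  - by move=> i; rewrite mulf_neq0 ?invr_eq0 //; exact: gv.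
  - by move=> i; rewrite mulf_neq0 ?invr_eq0 //; exact: gw.
  - move=> i j ij; rewrite -subr_eq0 [X in _ - X]mulrC [_ * b j]mulrC.
    have -> : b j * a i - b i * a j = - (a j * b i - b j * a i) by ring.
    rewrite oppr_eq0 nE; last by rewrite eq_sym.
    by rewrite mulf_neq0 ?invr_eq0 //; exact: gvw.
  rewrite mulrBr !mulr_sumr -sumrB; apply: eq_bigr => i _; rewrite -mulrBr /c.
  have nE' j : j != i -> b j * a i - a j * b i = - (n l i j / dt).
    by move=> ji; rewrite -nE //; ring.
  (* A negative determinant exchanges entering and leaving; the sign lost in passing from [|dt|] to
     dt compensates for it. *)
  have [dp|dn|dz] := ltrgt0P dt; last by rewrite dz eqxx in dt0.
    congr (_ * (_%:R - _%:R)); congr (nat_of_bool (_ && _)).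
    - by rewrite /a /b pmulr_llt0 ?pmulr_lgt0 ?invr_gt0.
    - by apply: eq_forallb => j; case: eqVneq => //= /nE ->; rewrite pmulr_lgt0 ?invr_gt0.
    - by rewrite /a /b pmulr_llt0 ?pmulr_lgt0 ?invr_gt0.
    - by apply: eq_forallb => j; case: eqVneq => //= /nE' ->; rewrite oppr_gt0 pmulr_llt0 ?invr_gt0.
  rewrite -[RHS]mulrNN opprB; congr (_ * (_%:R - _%:R)); congr (nat_of_bool (_ && _)).
  - by rewrite /a /b nmulr_llt0 ?nmulr_lgt0 ?invr_lt0 // andbC.
  - by apply: eq_forallb => j; case: eqVneq => //= /nE ->; rewrite nmulr_lgt0 ?invr_lt0.
  - by rewrite /a /b nmulr_llt0 ?nmulr_lgt0 ?invr_lt0 // andbC.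
  - by apply: eq_forallb => j; case: eqVneq => //= /nE' ->; rewrite oppr_gt0 nmulr_llt0 ?invr_lt0.
rewrite exchange_big /= big1 // => i _; apply: (@sum_det_rain0 u i) => // l x.
rewrite /c !rdet_upd; have nu' j : j != i -> n (upd l i x) i j = n l i j.
  by move=> ji; rewrite /n rain_upd (replC _ _ _ (_ : i != j)) 1?eq_sym // repl_repl.
by congr ((_ && _)%:R - (_ && _)%:R); apply: eq_forallb => j; case: eqVneq => //= /nu' ->.
Qed.

End ConeCount.

(** * Grid points far from finitely many hyperplanes *)

Section Avoid.
Variables (R : realFieldType) (d : nat).

Lemma natr_dist_ge1 (a b : nat) : a != b -> 1 <= `|a%:R - b%:R : R|.
Proof.
wlog ab : a b / (a < b)%N => [H|_].
  by case: ltngtP => // h _; [|rewrite distrC]; apply: H => //; rewrite ltn_eqF.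
by rewrite distrC ger0_norm ?subr_ge0 ?ler_nat ?(ltnW ab) // lerBrDl natr1 ler_nat.
Qed.

(** For one linear form, fix all coordinates except the one with the largest coefficient. Two values
    of that coordinate move the form by at least this coefficient, so at most one of the Q values is
    bad; fewer than Q forms cannot spoil the whole grid. *)
Lemma grid_avoid (K : finType) (c : K -> 'I_d -> R) (Q : nat) : (#|K| < Q)%N ->
  exists a : 'I_d -> nat, (forall i, 0 < a i <= Q)%N /\
    forall k j, `|c k j| / 2 <= `|\sum_i c k i * (a i)%:R|.
Proof.
move=> KQ; case: (posnP d) => [d0|d_gt0].
  by exists (fun _ => 1%N); split=> [|k [j jd]]; [rewrite (leq_ltn_trans _ KQ)|exfalso; move: jd; rewrite d0].
pose i0 : 'I_d := Ordinal d_gt0.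
pose top k := [arg max_(j > i0) `|c k j|]%O.
have topP k j : `|c k j| <= `|c k (top k)|.
  by rewrite /top; case: arg_maxP => // i _ /(_ j); exact.
pose val (a : {ffun 'I_d -> 'I_Q}) k := \sum_i c k i * (a i).+1%:R.
pose bad k := [set a : {ffun 'I_d -> 'I_Q} | `|val a k| < `|c k (top k)| / 2].
have badQ k : (#|bad k| * Q <= Q ^ d)%N.
  pose f (p : {ffun 'I_d -> 'I_Q} * 'I_Q) : {ffun 'I_d -> 'I_Q} :=
    [ffun i => if i == top k then p.2 else p.1 i].
  have <- : #|finset.setX (bad k) [set: 'I_Q]| = (#|bad k| * Q)%N.
    by rewrite cardsX cardsT card_ord.
  have <- : #|{ffun 'I_d -> 'I_Q}| = (Q ^ d)%N by rewrite card_ffun !card_ord.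
  rewrite -(@card_in_imset _ _ f) ?max_card // => -[a x] [b y].
  rewrite !inE !andbT /= => Ha Hb /ffunP fab.
  have xy : x = y by have := fab (top k); rewrite !ffunE eqxx.
  have ab i : i != top k -> a i = b i by move=> it; have := fab i; rewrite !ffunE (negPf it).
  congr (_, _) => //; apply/ffunP => i; have [->|] := eqVneq i (top k); last exact: ab.
  apply/val_inj/eqP; apply: contraTT Ha => ne; rewrite -leNgt.
  have E : val a k - val b k = c k (top k) * ((a (top k))%:R - (b (top k))%:R).
    rewrite /val -sumrB (bigD1 (top k)) //= big1 => [|i' it]; last by rewrite ab // subrr.
    by rewrite addr0 -mulrBr -!natr1; congr (_ * _); ring.
  have : `|c k (top k)| <= `|val a k - val b k|.
    rewrite E normrM ler_peMr //.
    exact: natr_dist_ge1.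
  by have := ler_normB (val a k) (val b k); move: Hb; lra.
have Q0 : (0 < Q)%N by exact: leq_ltn_trans KQ.
have /existsP[a /forallP Ha] : [exists a : {ffun 'I_d -> 'I_Q}, forall k, a \notin bad k].
  apply: contraT => /existsPn H.
  have : (#|{ffun 'I_d -> 'I_Q}| <= \sum_k #|bad k|)%N.
    rewrite -sum1_card; under [X in (_ <= X)%N]eq_bigr => k _ do rewrite -sum1_card big_mkcond.
    rewrite exchange_big /=; apply: leq_sum => a _.
    have /forallPn[k /negPn ak] := H a.
    by rewrite (bigD1 k) //= ak leq_addr.
  rewrite card_ffun !card_ord -(leq_pmul2r Q0) => h.
  have h2 : ((\sum_k #|bad k|) * Q <= #|K| * Q ^ d)%N.
    by rewrite big_distrl /= -sum_nat_const; apply: leq_sum => k _; exact: badQ.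
  have := leq_trans h h2; rewrite mulnC leq_pmul2r ?expn_gt0 ?Q0 // leqNgt.
  by rewrite KQ.
exists (fun i => (a i).+1); split=> [i|k j]; first by rewrite ltn_ord.
have := Ha k; rewrite inE -leNgt; apply: le_trans.
by rewrite ler_pM2r ?invr_gt0 ?ltr0n.
Qed.
End Avoid.

(** * Independence of the cone count from the vector *)

Section ConeCount2.
Variables (R : realFieldType) (d m : nat).
Implicit Types (u : 'I_d -> 'I_m.+1 -> 'rV[R]_d) (l : {ffun 'I_d -> 'I_m.+1}).
Implicit Types (i j : 'I_d) (v w : 'rV[R]_d) (A : 'M[R]_d).

Definition natv (a : 'I_d -> nat) : 'rV[R]_d := \row_i (a i)%:R.

Lemma det_repl_natv A i a :
  \det (repl A i (natv a)) = \sum_k \det (repl A i (delta_mx 0 k)) * (a k)%:R.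
Proof.
rewrite [natv a]row_sum_delta det_repl_sum; apply: eq_bigr => k _.
by rewrite det_replZ mxE mulrC.
Qed.

Lemma det_repl_neq0 A i v : \det (repl A i v) != 0 ->
  exists k, \det (repl A i (delta_mx 0 k)) != 0.
Proof.
move=> H; apply/existsP; apply: contraT => /existsPn z; case/negP: H.
rewrite [v]row_sum_delta det_repl_sum big1 // => k _.
by have /negPn/eqP := z k; rewrite det_replZ => ->; rewrite mulr0.
Qed.

(** The comparison with the cofactors, stronger than nonvanishing, later bounds the coefficients of
    a relation from below. *)
Lemma det_avoid (K : finType) (A : K -> 'M[R]_d) (i : K -> 'I_d) (v : K -> 'rV[R]_d) (Q : nat) :
  (#|K| < Q)%N -> (forall k, \det (repl (A k) (i k) (v k)) != 0) ->
  exists a : 'I_d -> nat, [/\ (forall i, 0 < a i <= Q)%N,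
    forall k, \det (repl (A k) (i k) (natv a)) != 0 &
    forall k j, `|\det (repl (A k) (i k) (delta_mx 0 j))| / 2
      <= `|\det (repl (A k) (i k) (natv a))| ].
Proof.
move=> KQ H; have [a [aQ ah]] :=
  grid_avoid (fun k j => \det (repl (A k) (i k) (delta_mx 0 j))) KQ.
exists a; split => // [k|k j]; last by rewrite det_repl_natv.
have [j hj] := det_repl_neq0 (H k); rewrite det_repl_natv -normr_gt0.
by apply: lt_le_trans (ah k j); rewrite divr_gt0 ?normr_gt0 ?ltr0n.
Qed.

(** The segment from v to w may cross two walls at once. Both are therefore joined to a third vector
    in general position with respect to each of them. *)
Lemma cone_count_const u v w : balanced u -> nondegenerate u -> generic u v -> generic u w ->
  cone_count u v = cone_count u w.
Proof.
move=> bu nu gv gw.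
pose K : finType := (({ffun 'I_d -> 'I_m.+1} * 'I_d) + ({ffun 'I_d -> 'I_m.+1} * 'I_d * 'I_d * bool))%type.
pose z (b : bool) := if b then v else w.
pose A (k : K) := match k with inl (l, _) => rain u l
  | inr (l, i, j, b) => if i != j then repl (rain u l) j (z b) else rain u l end.
pose I (k : K) := match k with inl (_, i) => i | inr (_, i, _, _) => i end.
have [|a [_ ha _]] := @det_avoid K A I (fun k => row (I k) (A k)) #|K|.+1 (ltnSn _).
  case=> [[l i]|[[[l i] j] b]] /=; rewrite repl_row; first exact: nu.
  by case: (i != j); [case: b; [exact: gv|exact: gw]|exact: nu].
have ga : generic u (natv a) by move=> l i; exact: (ha (inl (l, i))).
rewrite (cone_count_segment bu nu gv ga).
  apply/esym; apply: (cone_count_segment bu nu gw ga) => l i j ij.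
  by have := ha (inr (l, i, j, false)); rewrite /= ij.
by move=> l i j ij; have := ha (inr (l, i, j, true)); rewrite /= ij.
Qed.

(** The count may be evaluated at a generic vector with positive coordinates in the rows of l, where
    the cone of l contributes its determinant. *)
Lemma cone_count_ge u v l : balanced u -> nondegenerate u -> generic u v ->
  `|\det (rain u l)| <= cone_count u v.
Proof.
move=> bu nu gv.
have key k i : exists w, \det (repl (rain u k) i (w *m rain u l)) != 0.
  exists (row i (rain u k) *m invmx (rain u l)).
  by rewrite mulmxKV ?unitmxE ?unitfE ?repl_row //; exact: nu.
have [a [ap ha]] : exists a : 'I_d -> nat, (forall i, 0 < a i)%N /\
    generic u (natv a *m rain u l).
  pose c (p : {ffun 'I_d -> 'I_m.+1} * 'I_d) j := \det (repl (rain u p.1) p.2 (row j (rain u l))).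
  have [a [aQ ah]] := grid_avoid c (ltnSn _).
  exists a; split=> [i|k i]; first by case/andP: (aQ i).
  have E w : \det (repl (rain u k) i (w *m rain u l)) = \sum_j c (k, i) j * w 0 j.
    by rewrite mulmx_sum_row det_repl_sum; apply: eq_bigr => j _; rewrite det_replZ mulrC.
  have [w hw] := key k i.
  have /existsP[j cj] : [exists j, c (k, i) j != 0].
    apply: contraT => /existsPn zc; case/negP: hw; rewrite E big1 // => j _.
    by have /negPn/eqP -> := zc j; rewrite mul0r.
  rewrite /rdet E -normr_gt0.
  rewrite (eq_bigr (fun j => c (k, i) j * (a j)%:R)) => [|j' _]; last by rewrite mxE.
  by apply: lt_le_trans (ah (k, i) j); rewrite divr_gt0 ?normr_gt0 ?ltr0n.
rewrite (cone_count_const bu nu gv ha) /cone_count (bigD1 l) //=.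
have -> : incone u (natv a *m rain u l) l.
  apply/forallP => i; rewrite /rdet mulmx_sum_row.
  rewrite (det_repl_cramer _ _ (fun k => natv a 0 k)) -mulrA pmulr_rgt0.
    by rewrite -expr2 exprn_even_gt0 //; exact: nu.
  by rewrite mxE ltr0n.
by rewrite mulr1 lerDl; apply: sumr_ge0 => k _; rewrite mulr_ge0.
Qed.

(** Expanding the product of row sums gives one term for each function, and permutations are among
    the functions. *)
Lemma det_le_l1 A : `|\det A| <= \prod_i \sum_j `|A i j|.
Proof.
rewrite bigA_distr_bigA /=; apply: le_trans (ler_norm_sum _ _ _) _.
pose f (s : 'S_d) := [ffun i => s i].
have fI : injective f by move=> s t /ffunP e; apply/permP => i; have := e i; rewrite !ffunE.
rewrite (eq_bigr (fun s : 'S_d => \prod_i `|A i (f s i)|)); last first.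
  move=> s _; rewrite normrM normrX normrN1 expr1n mul1r normr_prod.
  by apply: eq_bigr => i _; rewrite ffunE.
rewrite -(big_imset (fun g : {ffun 'I_d -> 'I_d} => \prod_i `|A i (g i)|) (in2W fI)) /=.
rewrite [leRHS](bigID (mem (f @: 'S_d))) /= lerDl.
by apply: sumr_ge0 => g _; apply: prodr_ge0.
Qed.

End ConeCount2.

(** * The average slack of a cone *)

Section Slack.
Variables (R : realFieldType) (d m : nat).
Hypothesis m_gt0 : (0 < m)%N.
Implicit Types (u : 'I_d -> 'I_m.+1 -> 'rV[R]_d) (l : {ffun 'I_d -> 'I_m.+1}).
Implicit Types (i j : 'I_d) (v w : 'rV[R]_d) (A : 'M[R]_d).

(** Weights of sum zero in which either sign has total mass m. The multiples of v by them form a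
    balanced colour that represents v and -v equally. *)
Definition hweight (x : 'I_m.+1) : R := if x == ord0 then - m%:R else 1.

Lemma hweight_neq0 x : hweight x != 0.
Proof. by rewrite /hweight; case: (x == ord0); rewrite ?oppr_eq0 ?pnatr_eq0 -?lt0n ?oner_eq0. Qed.

Lemma sum_hweight : \sum_x hweight x = 0.
Proof.
rewrite big_ord_recl (eq_bigr (fun=> 1)) //.
by rewrite sumr_const card_ord addNr.
Qed.

Lemma sum_hweight_sign (c : R) : c != 0 ->
  \sum_x `|hweight x| * (hweight x * c < 0)%R%:R = m%:R.
Proof.
move=> c0; rewrite big_ord_recl (eq_bigr (fun=> (c < 0)%R%:R)); last first.
  by move=> x _; rewrite normr1 !mul1r.
rewrite /hweight eqxx sumr_const card_ord normrN normr_nat mulNr oppr_lt0 pmulr_rgt0 ?ltr0n //.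
by case: (ltgtP c 0) c0 => //= _ _; rewrite ?mulr0 ?mulr1 ?mul0rn ?add0r ?addr0.
Qed.

Definition spoke u i v : 'I_d -> 'I_m.+1 -> 'rV[R]_d :=
  fun j x => if j == i then hweight x *: v else u j x.

Lemma rain_spoke u i v l x y :
  rain (spoke u i v) (upd l i y) = repl (rain u (upd l i x)) i (hweight y *: v).
Proof.
by apply/matrixP => k j; rewrite !mxE /spoke !ffunE; case: (k == i); rewrite ?mxE.
Qed.

Lemma incone_opp u v l : incone u (- v) l = [forall i, rdet u l i v * \det (rain u l) < 0].
Proof. by apply: eq_forallb => i; rewrite /rdet det_replN mulNr oppr_gt0. Qed.

Lemma rdet_spoke u i v l x y j :
  rdet (spoke u i v) (upd l i y) j (- u i x) =
  if j == i then - \det (rain u (upd l i x)) else hweight y * rdet u (upd l i x) j v.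
Proof.
rewrite /rdet (rain_spoke u i v l x y) det_replN; set U := rain u _.
have Ui : u i x = row i U by rewrite /U row_rain ffunE eqxx.
case: eqVneq => [->|ji]; first by rewrite repl_repl Ui repl_row.
rewrite det_repl_swap 1?eq_sym // opprK Ui repl_row.
by rewrite det_replZ.
Qed.

(** One positive relation read in two ways: v or -v is a positive combination of the rows of
    [upd l i x] exactly when [- u i x] is a positive combination of the other rows and of a multiple
    of v with the right sign. *)
Lemma incone_spoke u i v l x y : nondegenerate u -> generic u v ->
  incone (spoke u i v) (- u i x) (upd l i y) =
  (hweight y * (\det (rain u (upd l i x)) * rdet u l i v) < 0) &&
  (incone u v (upd l i x) || incone u (- v) (upd l i x)).
Proof.
move=> nu gv; set L := upd l i x.
have D0 : rdet u l i v != 0 := gv l i.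
have d0 : \det (rain u L) != 0 := nu L.
have dE : \det (rain (spoke u i v) (upd l i y)) = hweight y * rdet u l i v.
  by rewrite (rain_spoke u i v l x y) det_replZ -/(rdet u (upd l i x) i v) rdet_upd.
have h2 : 0 < hweight y ^+ 2 by rewrite exprn_even_gt0 //= hweight_neq0.
have D2 : 0 < rdet u l i v ^+ 2 by rewrite exprn_even_gt0.
have L2 : 0 < \det (rain u L) ^+ 2 by rewrite exprn_even_gt0.
have rL : rdet u L i v = rdet u l i v by rewrite rdet_upd.
rewrite [incone u (- v) _]incone_opp; apply/forallP/andP => [H|[H1 H2] j]; last first.
  rewrite rdet_spoke dE; case: eqVneq => [_|ji]; first by move: H1; rewrite -/L; lra.
  rewrite -/L mulrACA -expr2 pmulr_rgt0 //.
  case/orP: H2 => /forallP H; have := H j; have := H i; rewrite rL => Hi Hj.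
    have : 0 < (rdet u L j v * \det (rain u L)) * (rdet u l i v * \det (rain u L)) by apply: mulr_gt0.
    by rewrite mulrACA -expr2 pmulr_lgt0.
  have : 0 < (rdet u L j v * \det (rain u L)) * (rdet u l i v * \det (rain u L)) by rewrite nmulr_rgt0.
  by rewrite mulrACA -expr2 pmulr_lgt0.
have Hj j : j != i -> 0 < rdet u L j v * rdet u l i v.
  move=> ji; have := H j; rewrite rdet_spoke dE (negPf ji) -/L mulrACA -expr2.
  by rewrite pmulr_rgt0.
split; first by have := H i; rewrite rdet_spoke dE eqxx -/L; lra.
have := mulf_neq0 D0 d0; case: ltgtP => // Ld _.
  apply/orP; right; apply/forallP => j; have [->|/Hj h] := eqVneq j i; first by rewrite rL.
  rewrite -(pmulr_rlt0 _ D2) expr2.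
  by have := h; have := Ld; set a := rdet _ _ _ _; set b := rdet _ _ _ _; set c := \det _ => *; nra.
apply/orP; left; apply/forallP => j; have [->|/Hj h] := eqVneq j i; first by rewrite rL.
rewrite -(pmulr_rgt0 _ D2) expr2.
have -> : rdet u l i v * rdet u l i v * (rdet u L j v * \det (rain u L)) =
   (rdet u L j v * rdet u l i v) * (rdet u l i v * \det (rain u L)) by ring.
exact: mulr_gt0.
Qed.

(** Each term is [|\det (rain u l)|] times the combination of the constants b with the coefficients
    of v in the cone of l; the determinant cancels the denominator in Cramer's rule. *)
Definition cone_slack u (b : 'I_d -> 'I_m.+1 -> R) v :=
  \sum_l (incone u v l)%:R * \sum_i `|rdet u l i v| * b i (l i).

(** [|rdet u l i v|] does not see [l i]. For fixed i and x, summing it over the other colours counts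
    the cones of [spoke u i v] at [- u i x], with multiplicity m. This count is the same for all x,
    so that b enters only through its sum over x. *)
Lemma cone_slack_sym u b v : nondegenerate u -> generic u v -> balanced u ->
  cone_slack u b v + cone_slack u b (- v) =
  \sum_i (\sum_x b i x) * (cone_count (spoke u i v) (- u i ord0) / m%:R).
Proof.
move=> nu gv bu.
pose s l : R := (incone u v l || incone u (- v) l)%:R.
have sE i l : (incone u v l)%:R + (incone u (- v) l)%:R = s l :> R.
  rewrite /s; case: (boolP (incone _ v _)) => [/forallP/(_ i) h|_]; last by rewrite add0r.
  rewrite /= incone_opp; case: (boolP [forall _, _]) => [/forallP/(_ i) h'|_]; rewrite ?addr0 //.
  by have := lt_trans h h'; rewrite ltxx.
have -> : cone_slack u b v + cone_slack u b (- v) =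
    \sum_i \sum_l s l * `|rdet u l i v| * b i (l i).
  rewrite exchange_big /= -big_split /=; apply: eq_bigr => l _.
  have -> : \sum_i `|rdet u l i (- v)| * b i (l i) = \sum_i `|rdet u l i v| * b i (l i).
    by apply: eq_bigr => i _; rewrite /rdet det_replN normrN.
  rewrite -mulrDl mulr_sumr; apply: eq_bigr => i _.
  by rewrite (sE i) mulrA.
apply: eq_bigr => i _.
have m0 : m.+1%:R != 0 :> R by rewrite pnatr_eq0.
have mm : m%:R != 0 :> R by rewrite pnatr_eq0 -lt0n.
have bs : balanced (spoke u i v).
  move=> j; rewrite /spoke; case: eqP => _; last exact: bu.
  by rewrite -scaler_suml sum_hweight scale0r.
have rs l y : rain (spoke u i v) l = rain (spoke u i v) (upd l i (l i)).
  by congr rain; apply/ffunP => j; rewrite ffunE; case: eqP => // ->.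
have updK l : upd l i (l i) = l.
  by apply/ffunP => j; rewrite ffunE; case: eqP => // ->.
have ns : nondegenerate (spoke u i v).
  move=> l; rewrite -[l]updK (rain_spoke u i v l ord0) det_replZ mulf_neq0 ?hweight_neq0 //.
  by rewrite -/(rdet u (upd l i ord0) i v) rdet_upd; exact: gv.
have gs x : generic (spoke u i v) (- u i x).
  move=> l j; rewrite -[l]updK rdet_spoke; case: (j == i); first by rewrite oppr_eq0; exact: nu.
  by rewrite mulf_neq0 ?hweight_neq0 //; exact: gv.
have fE x : \sum_l `|rdet u l i v| * s (upd l i x) =
    m.+1%:R * (cone_count (spoke u i v) (- u i ord0) / m%:R).
  rewrite -(cone_count_const bs ns (gs x) (gs ord0)) /cone_count mulrA -(sum_upd _ i) mulr_suml.
  apply: eq_bigr => l _; apply: (mulIf mm); rewrite mulfVK //.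
  transitivity (\sum_y (`|rdet u l i v| * s (upd l i x)) *
     (`|hweight y| * (hweight y * (\det (rain u (upd l i x)) * rdet u l i v) < 0)%R%:R)).
    by rewrite -mulr_sumr sum_hweight_sign // mulf_neq0 ?nu ?gv.
  apply: eq_bigr => y _; rewrite incone_spoke // (rain_spoke u i v l x y) det_replZ normrM.
  rewrite -/(rdet u (upd l i x) i v) rdet_upd -mulnb natrM /s; ring.
apply: (mulfI m0); rewrite -(sum_upd _ i) exchange_big /= mulr_suml mulr_sumr.
apply: eq_bigr => x _; rewrite mulrCA -(fE x) mulr_sumr; apply: eq_bigr => l _.
by rewrite rdet_upd ffunE eqxx; ring.
Qed.

Lemma cone_count_le u v w (E Q : R) i : 1 <= E -> 1 <= Q ->
  (forall j x k, `|u j x 0 k| <= E) -> (forall k, `|v 0 k| <= Q) ->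
  cone_count (spoke u i v) w <= (m.+1 * d * m)%:R ^+ d * (Q * E ^+ d).
Proof.
move=> E1 Q1 uE vQ.
have m1 : 1 <= m%:R :> R by rewrite (ler_nat _ 1).
apply: (@le_trans _ _ (\sum_(l : {ffun 'I_d -> 'I_m.+1}) (d * m)%:R ^+ d * (Q * E ^+ d))); last first.
  rewrite sumr_const card_ffun !card_ord -[leLHS]mulr_natl natrX mulrA -exprMn.
  by rewrite -mulnA [in leRHS]natrM lexx.
apply: ler_sum => l _.
apply: le_trans (_ : `|\det (rain (spoke u i v) l)| <= _).
  by rewrite ler_piMr //; case: incone.
apply: le_trans (det_le_l1 _) _.
have -> : (d * m)%:R ^+ d * (Q * E ^+ d) =
    \prod_(j < d) ((d * m)%:R * (if j == i then Q else 1) * E).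
  rewrite !big_split /= !prodr_const !card_ord -big_mkcond big_pred1_eq mulrA //.
apply: ler_prod => j _.
rewrite sumr_ge0 //= natrM -!mulrA -[X in _ <= X%:R * _]card_ord mulr_natl -sumr_const.
apply: ler_sum => k _; rewrite !mxE /spoke; case: eqP => _; last first.
  by rewrite mul1r; apply: le_trans (uE _ _ _) _; rewrite ler_peMl //; lra.
rewrite mxE normrM ler_pM //.
  rewrite /hweight; case: eqP => _; rewrite ?normrN ?normr_nat ?normr1 //.
by apply: le_trans (vQ k) _; rewrite ler_peMr //; lra.
Qed.

End Slack.

(** * Rainbow relations *)

Section RainbowRelation.
Variables (R : realFieldType) (d : nat).
Hypothesis d_gt0 : (0 < d)%N.
Implicit Types (u : 'I_d -> 'I_d.+1 -> 'rV[R]_d) (l : {ffun 'I_d -> 'I_d.+1}).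
Implicit Types (i j : 'I_d) (v w : 'rV[R]_d).

Definition coneco u v l i := `|rdet u l i v| / `|\det (rain u l)|.

Lemma incone_comb u v l : nondegenerate u -> incone u v l ->
  v = \sum_i coneco u v l i *: u i (l i).
Proof.
move=> nu /forallP H; have d0 : \det (rain u l) != 0 := nu l.
have U : rain u l \in unitmx by rewrite unitmxE unitfE.
rewrite [LHS](row_coords v U); apply: eq_bigr => i _; rewrite row_rain; congr (_ *: _).
rewrite /coneco -normfV -normrM.
have E : rdet u l i v = (v *m invmx (rain u l)) 0 i * \det (rain u l).
  rewrite /rdet {1}(row_coords v U).
  by rewrite (det_repl_cramer _ _ (fun k => (v *m invmx (rain u l)) 0 k)).
have := H i; rewrite E -mulrA -expr2 pmulr_lgt0 ?exprn_even_gt0 // => h.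
by rewrite mulfK // gtr0_norm.
Qed.

Lemma genericN u v : generic u v -> generic u (- v).
Proof. by move=> g l i; rewrite /rdet det_replN oppr_eq0; exact: g. Qed.

(** Expansion of row i over the standard basis. Divided by the determinant, this is a lower bound
    for the coefficient of colour i in the cone of l. *)
Lemma det_rain_le u v l i E : 0 <= E ->
  (forall j x k, `|u j x 0 k| <= E) ->
  (forall k, `|rdet u l i (delta_mx 0 k)| / 2 <= `|rdet u l i v|) ->
  `|\det (rain u l)| <= (2 * d%:R * E) * `|rdet u l i v|.
Proof.
move=> E0 uE H; rewrite -{1}(repl_row (rain u l) i) [row i _]row_sum_delta det_repl_sum.
apply: le_trans (ler_norm_sum _ _ _) _.
have -> : 2 * d%:R * E * `|rdet u l i v| = \sum_(k < d) E * (2 * `|rdet u l i v|).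
  by rewrite sumr_const card_ord -mulr_natl; ring.
apply: ler_sum => k _; rewrite det_replZ normrM ler_pM //; first by rewrite !mxE.
by have := H k; rewrite -/(rdet _ _ _ _); lra.
Qed.

(** One more than the number of walls (l, i) of two rainbow systems, as [grid_avoid] requires. *)
Definition gridsize := (2 * (d.+1 ^ d * d)).+1.
(** The bound of [cone_count_le] for d + 1 vectors per colour and v on the grid. *)
Definition slack_const (E : R) := (d.+1 * d * d)%:R ^+ d * (gridsize%:R * E ^+ d).

(** A cone containing v and one containing -v add up to a positive relation. If every such pair had
    large slack or a small first determinant, the total slack weighted by both determinants would
    exceed the value given by [cone_slack_sym]. A negative slack is kept as a separate outcome: it
    makes the rainbow intersection empty. *)
Lemma rainbow_relation (uT uB : 'I_d -> 'I_d.+1 -> 'rV[R]_d)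
    (bT bB : 'I_d -> 'I_d.+1 -> R) (E r th : R) lT0 lB0 :
  1 <= E -> 0 < r -> 0 < th ->
  balanced uT -> balanced uB -> nondegenerate uT -> nondegenerate uB ->
  (forall j x k, `|uT j x 0 k| <= E) -> (forall j x k, `|uB j x 0 k| <= E) ->
  (forall i, \sum_x bT i x <= r) -> (forall i, \sum_x bB i x <= r) ->
  1 / 2 <= `|\det (rain uT lT0)| -> th <= `|\det (rain uB lB0)| ->
  let tau := 2 * (2 + th^-1) * d%:R * r * slack_const E in
  exists (lT lB : {ffun 'I_d -> 'I_d.+1}) (aT aB : 'I_d -> R),
   [/\ (forall i, 0 <= aT i), (forall i, 0 <= aB i),
     \sum_i aT i *: uT i (lT i) + \sum_i aB i *: uB i (lB i) = 0 &
     let s := \sum_i aT i * bT i (lT i) + \sum_i aB i * bB i (lB i) in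
     s < 0 \/ [/\ s <= tau, (4 * d.+1%:R ^+ d)^-1 <= `|\det (rain uT lT)| &
       forall i, (2 * d%:R * E)^-1 <= aT i]].
Proof.
move=> E1 r0 th0 bT0 bB0 nT nB uTE uBE bTr bBr dT dB tau.
have d1 : 1 <= d%:R :> R by rewrite (ler_nat _ 1).
pose L := {ffun 'I_d -> 'I_d.+1}.
pose K : finType := ((L * 'I_d) + (L * 'I_d))%type.
pose A (k : K) := match k with inl (l, _) => rain uT l | inr (l, _) => rain uB l end.
pose I (k : K) := match k with inl (_, i) => i | inr (_, i) => i end.
have cK : (#|K| < gridsize)%N.
  by rewrite card_sum !card_prod card_ffun !card_ord /gridsize mul2n addnn.
have [|a [aQ aN aH]] := @det_avoid R d K A I (fun k => row (I k) (A k)) _ cK.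
  by case=> -[l i] /=; rewrite repl_row; [exact: nT|exact: nB].
pose v := natv R a.
have gT : generic uT v by move=> l i; exact: (aN (inl (l, i))).
have gB : generic uB v by move=> l i; exact: (aN (inr (l, i))).
have lowT l i : `|\det (rain uT l)| <= (2 * d%:R * E) * `|rdet uT l i v|.
  apply: det_rain_le => // [|k]; first lra.
  exact: (aH (inl (l, i)) k).
have vQ k : `|v 0 k| <= gridsize%:R.
  by rewrite mxE normr_nat ler_nat; case/andP: (aQ k).
have gs1 : 1 <= gridsize%:R :> R by rewrite (ler_nat _ 1).
pose z (b : bool) := if b then v else - v.
have zN b : z (~~ b) = - z b by case: b; rewrite //= opprK.
pose fT := cone_count uT v; pose fB := cone_count uB v.
have fTz b : cone_count uT (z b) = fT.
  by case: b => //; apply: cone_count_const => //; exact: genericN.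
have fBz b : cone_count uB (z b) = fB.
  by case: b => //; apply: cone_count_const => //; exact: genericN.
have fT2 : 1 / 2 <= fT by apply: le_trans dT _; exact: cone_count_ge.
have fBth : th <= fB by apply: le_trans dB _; exact: cone_count_ge.
have rdz u l i b : `|rdet u l i (z b)| = `|rdet u l i v|.
  by case: b => //; rewrite /rdet det_replN normrN.
pose sT b l := \sum_i coneco uT (z b) l i * bT i (l i).
pose sB b l := \sum_i coneco uB (z b) l i * bB i (l i).
pose inT b l : R := (incone uT (z b) l)%:R; pose inB b l : R := (incone uB (z b) l)%:R.
pose dtT l := `|\det (rain uT l)|; pose dtB l := `|\det (rain uB l)|.
pose tot := \sum_b \sum_lT \sum_lB (inT b lT * inB (~~ b) lB) * (dtT lT * dtB lB) *
    (sT b lT + sB (~~ b) lB).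
have slackT b : \sum_l inT b l * (dtT l * sT b l) = cone_slack uT bT (z b).
  apply: eq_bigr => l _; congr (_ * _); rewrite mulr_sumr; apply: eq_bigr => i _.
  by rewrite /coneco mulrA mulrCA divff ?mulr1 // normr_eq0; exact: nT.
have slackB b : \sum_l inB b l * (dtB l * sB b l) = cone_slack uB bB (z b).
  apply: eq_bigr => l _; congr (_ * _); rewrite mulr_sumr; apply: eq_bigr => i _.
  by rewrite /coneco mulrA mulrCA divff ?mulr1 // normr_eq0; exact: nB.
have cntT b : \sum_l inT b l * dtT l = fT by rewrite -(fTz b); apply: eq_bigr => l _; rewrite mulrC.
have cntB b : \sum_l inB b l * dtB l = fB by rewrite -(fBz b); apply: eq_bigr => l _; rewrite mulrC.
have totE : tot = fB * (cone_slack uT bT v + cone_slack uT bT (- v))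
                + fT * (cone_slack uB bB v + cone_slack uB bB (- v)).
  have E2 b : \sum_lT \sum_lB (inT b lT * inB (~~ b) lB) * (dtT lT * dtB lB) *
      (sT b lT + sB (~~ b) lB) = fB * cone_slack uT bT (z b) + fT * cone_slack uB bB (z (~~ b)).
    rewrite -slackT -slackB -(cntT b) -(cntB (~~ b)) mulrC !big_distrlr -big_split /=.
    apply: eq_bigr => l _; rewrite -big_split /=; apply: eq_bigr => l' _; ring.
  by rewrite /tot big_bool !E2 /=; ring.
have Hs u b v' i : 0 <= cone_count (spoke u i v') b.
  by apply: sumr_ge0 => l _; rewrite mulr_ge0.
have sc0 : 0 < slack_const E.
  rewrite /slack_const; apply: mulr_gt0; first by rewrite exprn_gt0 // ltr0n !muln_gt0 d_gt0.
    by apply: mulr_gt0; rewrite ?exprn_gt0 //; lra.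
have slack_le u b : (forall j x k, `|u j x 0 k| <= E) -> (forall i, \sum_x b i x <= r) ->
    balanced u -> nondegenerate u -> generic u v ->
    cone_slack u b v + cone_slack u b (- v) <= d%:R * r * slack_const E.
  move=> uE br bu nu gu; rewrite cone_slack_sym //.
  have -> : d%:R * r * slack_const E = \sum_(i < d) r * slack_const E.
    by rewrite sumr_const card_ord -[RHS]mulr_natl mulrA.
  apply: ler_sum => i _; set c := cone_count _ _ / _.
  have c0 : 0 <= c by rewrite divr_ge0.
  apply: le_trans (_ : r * c <= _); first by rewrite ler_wpM2r.
  rewrite ler_pM2l // ler_pdivrMr; last lra.
  apply: le_trans (cone_count_le d_gt0 _ i E1 gs1 uE vQ) _.
  by rewrite ler_peMr // ltW.
have tot_le : tot <= (fB + fT) * (d%:R * r * slack_const E).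
  by rewrite totE mulrDl lerD // ler_pM2l ?slack_le //; lra.
have [/existsP[b /existsP[lT /existsP[lB /and3P[iT iB H]]]]|Hn] := boolP [exists b : bool,
   exists lT : L, exists lB : L, [&& incone uT (z b) lT, incone uB (z (~~ b)) lB &
   (sT b lT + sB (~~ b) lB < 0) || ((sT b lT + sB (~~ b) lB <= tau) &&
     ((4 * d.+1%:R ^+ d)^-1 <= dtT lT))]].
  exists lT, lB, (coneco uT (z b) lT), (coneco uB (z (~~ b)) lB); split.
  - by move=> i; rewrite divr_ge0.
  - by move=> i; rewrite divr_ge0.
  - by rewrite -(incone_comb nT iT) -(incone_comb nB iB) zN subrr.
  - case/orP: H => [Ht|/andP[Ht Hd]]; [by left|right; split=> // i].
    rewrite /coneco rdz ler_pdivlMr ?normr_gt0; last exact: nT.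
    by rewrite ler_pdivrMl ?mulr_gt0 //; lra.
exfalso; have Hneg b lT lB : incone uT (z b) lT -> incone uB (z (~~ b)) lB ->
   0 <= sT b lT + sB (~~ b) lB /\
   ((4 * d.+1%:R ^+ d)^-1 <= dtT lT -> tau < sT b lT + sB (~~ b) lB).
  move=> iT iB; have := existsPn Hn b => /existsPn/(_ lT)/existsPn/(_ lB).
  rewrite iT iB /= negb_or negb_and -leNgt -ltNge => /andP[h1 h2]; split=> // h3.
  by case/orP: h2 => // /negP[].
set kap := (4 * d.+1%:R ^+ d)^-1 in Hneg.
have D0 : 0 < d.+1%:R ^+ d :> R by rewrite exprn_gt0.
have kapE : kap * d.+1%:R ^+ d = 1 / 4 by rewrite /kap; field; rewrite gt_eqF.
have kap0 : 0 < kap by rewrite invr_gt0 mulr_gt0.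
have th1 : 0 < th^-1 by rewrite invr_gt0.
have tau0 : 0 < tau.
  have d0 : 0 < d%:R :> R by lra.
  have t2 : 0 < 2 + th^-1 by lra.
  by rewrite /tau; do 4 apply: mulr_gt0 => //.
(* Subtracting kap from the first determinant disposes of the cones with small determinant. For each
   sign this costs at most kap times the number of all l, that is 1/4, and 2 * fT - 1/2 is still at
   least fT. *)
have : tau * (fB * fT) <= tot.
  apply: le_trans (_ : \sum_b \sum_lT \sum_lB
     tau * ((inT b lT * inB (~~ b) lB) * ((dtT lT - kap) * dtB lB)) <= _); last first.
    apply: ler_sum => b _; apply: ler_sum => lT _; apply: ler_sum => lB _.
    rewrite /inT /inB; case iT : (incone uT _ _); last by rewrite !mul0r mulr0.
    case iB : (incone uB _ _); last by rewrite mulr0 !mul0r mulr0.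
    have [h1 h2] := Hneg b lT lB iT iB; rewrite !mul1r.
    have dT0 : 0 <= dtT lT := normr_ge0 _; have dB0 : 0 <= dtB lB := normr_ge0 _.
    have [kd|kd] := leP kap (dtT lT).
      have h3 := ltW (h2 kd); rewrite mulrC ler_pM //; first by rewrite mulr_ge0 // subr_ge0.
        exact: ltW.
      by rewrite ler_wpM2r //; lra.
    apply: le_trans (_ : 0 <= _); last by rewrite !mulr_ge0.
    by rewrite pmulr_rle0 // mulr_le0_ge0 //; lra.
  have E3 b : \sum_lT \sum_lB tau * ((inT b lT * inB (~~ b) lB) * ((dtT lT - kap) * dtB lB))
     = tau * (fB * (fT - kap * \sum_lT inT b lT)).
    transitivity (tau * \sum_lT \sum_lB (inT b lT * dtT lT - kap * inT b lT) *
        (inB (~~ b) lB * dtB lB)).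
      rewrite mulr_sumr; apply: eq_bigr => l _.
      by rewrite mulr_sumr; apply: eq_bigr => l' _; ring.
    congr (_ * _); rewrite -(cntT b) -(cntB (~~ b)) mulr_sumr -sumrB [RHS]mulrC.
    by rewrite big_distrlr.
  rewrite big_bool !E3 /= -mulrDr ler_pM2l // -mulrDr ler_pM2l; last lra.
  have E4 b : \sum_lT inT b lT <= d.+1%:R ^+ d.
    apply: le_trans (_ : \sum_(l : L) 1 <= _).
      by apply: ler_sum => l _; rewrite /inT; case: incone.
    by rewrite sumr_const card_ffun !card_ord natrX.
  have E5 b : kap * (\sum_lT inT b lT) <= 1 / 4 by rewrite -kapE ler_pM2l.
  by have := E5 true; have := E5 false; lra.
move=> /le_trans /(_ tot_le); apply/negP; rewrite -ltNge.
have X0 : 0 < d%:R * r * slack_const E by do 2 apply: mulr_gt0 => //; lra.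
have -> : tau * (fB * fT) = (2 * (2 + th^-1) * fB * fT) * (d%:R * r * slack_const E).
  by rewrite /tau; ring.
rewrite ltr_pM2r //.
(* The factor 2 * (2 + 1 / th) in tau: its first part contributes 4 * fB * fT >= 2 * fB, its second
   part 2 * fB * fT / th >= 2 * fT, together more than fB + fT. *)
have : 1 <= th^-1 * fB by rewrite mulrC ler_pdivlMr // mul1r.
by nra.
Qed.

End RainbowRelation.

Section Dot.
Variables (R : realFieldType) (d : nat).
Implicit Types (x y z : 'rV[R]_d).

Definition dot x y : R := \sum_i x 0 i * y 0 i.

Lemma dotC x y : dot x y = dot y x.
Proof. by apply: eq_bigr => i _; rewrite mulrC. Qed.
Lemma dotDl x y z : dot (x + y) z = dot x z + dot y z.
Proof. by rewrite /dot -big_split; apply: eq_bigr => i _; rewrite mxE mulrDl. Qed.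
Lemma dotZl a x z : dot (a *: x) z = a * dot x z.
Proof. by rewrite /dot mulr_sumr; apply: eq_bigr => i _; rewrite mxE mulrA. Qed.
Lemma dotNl x z : dot (- x) z = - dot x z.
Proof. by rewrite -scaleN1r dotZl mulN1r. Qed.
Lemma dotBl x y z : dot (x - y) z = dot x z - dot y z.
Proof. by rewrite dotDl dotNl. Qed.
Lemma dot0l z : dot 0 z = 0.
Proof. by rewrite -(scale0r 0) dotZl mul0r. Qed.
Lemma dotDr x y z : dot x (y + z) = dot x y + dot x z.
Proof. by rewrite dotC dotDl !(dotC _ x). Qed.
Lemma dotBr x y z : dot x (y - z) = dot x y - dot x z.
Proof. by rewrite dotC dotBl !(dotC _ x). Qed.
Lemma dotZr a x z : dot x (a *: z) = a * dot x z.
Proof. by rewrite dotC dotZl dotC. Qed.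
Lemma dot_suml (I : Type) (r : seq I) (P : pred I) (F : I -> 'rV_d) z :
  dot (\sum_(i <- r | P i) F i) z = \sum_(i <- r | P i) dot (F i) z.
Proof. exact: (big_morph (fun x => dot x z) (fun x y => dotDl x y z) (dot0l z)). Qed.
Lemma dot_sumr (I : Type) (r : seq I) (P : pred I) (F : I -> 'rV_d) z :
  dot z (\sum_(i <- r | P i) F i) = \sum_(i <- r | P i) dot z (F i).
Proof. by rewrite dotC dot_suml; apply: eq_bigr => i _; rewrite dotC. Qed.
Lemma dot_delta x i : dot x (delta_mx 0 i) = x 0 i.
Proof.
rewrite /dot (bigD1 i) //= big1 => [|j ji]; first by rewrite mxE !eqxx mulr1 addr0.
by rewrite mxE (negPf ji) andbF mulr0.
Qed.

Lemma det_dot_le (A B : 'M[R]_d) h : (forall i k, `|dot (row i A) (row k B)| <= h) ->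
  `|\det A| * `|\det B| <= (d%:R * h) ^+ d.
Proof.
move=> H; rewrite -normrM -(det_tr B) -det_mulmx; apply: le_trans (det_le_l1 _) _.
rewrite -[X in _ <= _ ^+ X]card_ord -prodr_const; apply: ler_prod => i _.
rewrite sumr_ge0 //= mulr_natl -[X in _ <= _ *+ X]card_ord -sumr_const.
apply: ler_sum => k _; rewrite mxE; apply: le_trans (H i k).
by rewrite /dot le_eqVlt; apply/orP; left; apply/eqP; congr `|_|; apply: eq_bigr => j _; rewrite !mxE.
Qed.

Definition edges (Y : 'I_d.+1 -> 'rV[R]_d) : 'M[R]_d :=
  \matrix_(k < d) (Y (lift ord0 k) - Y ord0).

Lemma row_edges Y k : row k (edges Y) = Y (lift ord0 k) - Y ord0.
Proof. by rewrite rowK. Qed.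

End Dot.

(** * Simplices in a rainbow intersection *)

Section RainbowSimplex.
Variables (R : realFieldType) (d : nat).
Hypothesis d_gt0 : (0 < d)%N.

Definition rainbow_tau (E r th : R) := 2 * (2 + th^-1) * d%:R * r * slack_const d E.

(** At each vertex of Y the slacks are nonnegative and the relation makes their weighted sum equal
    to s. The weights of the first block are bounded below, so its slacks are small, and their
    differences are the entries of the product of [rain uT lT] with the transposed edge matrix. *)
Lemma rainbow_simplex_generic (uT uB : 'I_d -> 'I_d.+1 -> 'rV[R]_d)
    (bT bB : 'I_d -> 'I_d.+1 -> R) (E r th : R) lT0 lB0 :
  1 <= E -> 0 < r -> 0 < th ->
  balanced uT -> balanced uB -> nondegenerate uT -> nondegenerate uB ->
  (forall j x k, `|uT j x 0 k| <= E) -> (forall j x k, `|uB j x 0 k| <= E) ->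
  (forall i, \sum_x bT i x <= r) -> (forall i, \sum_x bB i x <= r) ->
  1 / 2 <= `|\det (rain uT lT0)| -> th <= `|\det (rain uB lB0)| ->
  exists lT lB : {ffun 'I_d -> 'I_d.+1}, forall Y : 'I_d.+1 -> 'rV[R]_d,
    (forall k i, dot (uT i (lT i)) (Y k) <= bT i (lT i)) ->
    (forall k i, dot (uB i (lB i)) (Y k) <= bB i (lB i)) ->
    (4 * d.+1%:R ^+ d)^-1 * `|\det (edges Y)| <=
      (d%:R * (2 * d%:R * E * rainbow_tau E r th)) ^+ d.
Proof.
move=> E1 r0 th0 bT0 bB0 nT nB uTE uBE bTr bBr dT dB.
have [lT [lB [aT [aB [aT0 aB0 rel H]]]]] :=
  rainbow_relation d_gt0 E1 r0 th0 bT0 bB0 nT nB uTE uBE bTr bBr dT dB.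
exists lT, lB => Y YT YB; set kap := (4 * _)^-1 in H *.
set s := _ + _ in H; set tau := 2 * _ * _ * _ * _ in H.
have d1 : 1 <= d%:R :> R by rewrite (ler_nat _ 1).
pose sT k i := bT i (lT i) - dot (uT i (lT i)) (Y k).
pose sB k i := bB i (lB i) - dot (uB i (lB i)) (Y k).
have sT0 k i : 0 <= sT k i by rewrite subr_ge0.
have sB0 k i : 0 <= sB k i by rewrite subr_ge0.
have sE k : \sum_i aT i * sT k i + \sum_i aB i * sB k i = s.
  have : dot (\sum_i aT i *: uT i (lT i) + \sum_i aB i *: uB i (lB i)) (Y k) = 0.
    by rewrite rel dot0l.
  rewrite dotDl !dot_suml.
  under eq_bigr do rewrite dotZl; under [X in _ + X = _ -> _]eq_bigr do rewrite dotZl.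
  move=> Z; rewrite /sT /sB; under eq_bigr do rewrite mulrBr.
  under [X in _ + X = _]eq_bigr do rewrite mulrBr.
  by rewrite !sumrB /s; lra.
have s0 : 0 <= s.
  by rewrite -(sE ord0) addr_ge0 // sumr_ge0 // => i _; rewrite mulr_ge0.
case: H => [|[Hs Hd Ha]]; first by rewrite ltNge s0.
have hT k i : sT k i <= 2 * d%:R * E * tau.
  have P0 : 0 < 2 * d%:R * E by rewrite !mulr_gt0 //; lra.
  rewrite -ler_pdivrMl // ; apply: le_trans Hs; rewrite -(sE k).
  apply: le_trans (_ : aT i * sT k i <= _); first by rewrite ler_wpM2r.
  rewrite (bigD1 i) //= -addrA lerDl addr_ge0 // sumr_ge0 // => j _; by rewrite mulr_ge0.
apply: le_trans (_ : `|\det (rain uT lT)| * `|\det (edges Y)| <= _).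
  by rewrite ler_wpM2r.
apply: det_dot_le => i k; rewrite row_rain row_edges dotBr.
have -> : dot (uT i (lT i)) (Y (lift ord0 k)) - dot (uT i (lT i)) (Y ord0) =
   sT ord0 i - sT (lift ord0 k) i by rewrite /sT; ring.
have := sT0 ord0 i; have := sT0 (lift ord0 k) i; have := hT ord0 i; have := hT (lift ord0 k) i.
by rewrite /rainbow_tau -/tau ler_norml; lra.
Qed.

Lemma poly_close (p : {poly R}) (e : R) : 0 < e ->
  exists2 x0 : R, 0 < x0 & forall x : R, 0 < x <= x0 -> `|p.[x] - p.[0]| <= e.
Proof.
move=> e0; elim/poly_ind: p => [|q c _].
  by exists 1 => // x _; rewrite !horner0 subrr normr0 ltW.
pose B := \sum_(i < size q) `|q`_i|.
have B0 : 0 <= B by apply: sumr_ge0.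
exists (Num.min 1 (e / (B + 1))).
  by rewrite lt_min ltr01 divr_gt0 //; lra.
move=> x /andP[x0]; rewrite le_min => /andP[x1 xe].
rewrite !hornerMXaddC mulr0 add0r addrK normrM (gtr0_norm x0).
have qB : `|q.[x]| <= B.
  rewrite horner_coef; apply: le_trans (ler_norm_sum _ _ _) _; apply: ler_sum => i _.
  by rewrite normrM ler_piMr // normrX exprn_ile1 // gtr0_norm.
apply: le_trans (_ : (B + 1) * x <= _); first by rewrite ler_wpM2r ?(ltW x0) //; lra.
by rewrite -ler_pdivlMl; [rewrite mulrC|lra].
Qed.

Lemma poly_nonroot (p : {poly R}) (e : R) : 0 < e -> p != 0 ->
  exists2 x : R, 0 < x <= e & p.[x] != 0.
Proof.
move=> e0 p0; pose s := [seq e / k.+1%:R | k <- iota 0 (size p)].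
have us : uniq s.
  rewrite map_inj_uniq ?iota_uniq // => a b /(mulfI (lt0r_neq0 e0)) /invr_inj /eqP.
  by rewrite eqr_nat => /eqP[].
have : ~~ all (root p) s.
  by apply/negP => /max_poly_roots => /(_ p0 us); rewrite size_map size_iota ltnn.
case/allPn => x /mapP[k _ ->] rx; exists (e / k.+1%:R) => //.
by rewrite divr_gt0 //= ler_piMr ?(ltW e0) // invf_le1 // ler1n.
Qed.

(** The weights have sum zero, which keeps the system balanced, and none of them vanishes, which
    makes every rainbow determinant a nonzero polynomial in e. *)
Definition perturb (u : 'I_d -> 'I_d.+1 -> 'rV[R]_d) (e : R) : 'I_d -> 'I_d.+1 -> 'rV[R]_d :=
  fun i x => u i x + (e * hweight R x) *: delta_mx 0 i.

(** With H the diagonal of weights, the perturbed matrix is H times e - M, so its determinant is a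
    multiple of the characteristic polynomial of M. *)
Lemma det_perturb u l : exists2 p : {poly R}, p != 0 &
  forall e, \det (rain (perturb u e) l) = p.[e].
Proof.
pose H := diag_mx (\row_i hweight R (l i)).
have dH : \det H != 0.
  by rewrite det_diag; apply/prodf_neq0 => i _; rewrite mxE hweight_neq0.
have uH : H \in unitmx by rewrite unitmxE unitfE.
pose M := - (invmx H *m rain u l).
exists ((\det H)%:P * char_poly M).
  by rewrite mulf_neq0 ?polyC_eq0 // monic_neq0 // char_poly_monic.
move=> e; rewrite hornerM hornerC /char_poly -[(\det _).[e]]/(horner_eval e _) -det_map_mx.
rewrite -det_mulmx; congr (\det _).
have -> : map_mx (horner_eval e) (char_poly_mx M) = e%:M - M.
  apply/matrixP => i j; rewrite !mxE /horner_eval !hornerE.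
  by case: eqP; rewrite !hornerE.
rewrite /M opprK mulmxDr mulKVmx // mul_mx_scalar.
apply/matrixP => i j; rewrite !mxE /perturb addrC; congr (_ + _).
by rewrite eqxx /= [j == i]eq_sym; case: eqP => [->|_]; rewrite ?mulr1 ?mulr1n ?mulr0n ?mulr0.
Qed.

(** Removes nondegeneracy by a perturbation. Its size depends on B, but the bound does not: doubling
    E and r and halving th absorbs it. *)
Lemma rainbow_simplex (uT uB : 'I_d -> 'I_d.+1 -> 'rV[R]_d)
    (bT bB : 'I_d -> 'I_d.+1 -> R) (E r th B : R) lT0 lB0 :
  1 <= E -> 0 < r -> 0 < th -> 0 < B ->
  balanced uT -> balanced uB ->
  (forall j x k, `|uT j x 0 k| <= E) -> (forall j x k, `|uB j x 0 k| <= E) ->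
  (forall i, \sum_x bT i x <= r) -> (forall i, \sum_x bB i x <= r) ->
  1 <= `|\det (rain uT lT0)| -> th <= `|\det (rain uB lB0)| ->
  exists lT lB : {ffun 'I_d -> 'I_d.+1}, forall Y : 'I_d.+1 -> 'rV[R]_d,
    (forall k i, `|Y k 0 i| <= B) ->
    (forall k i, dot (uT i (lT i)) (Y k) <= bT i (lT i)) ->
    (forall k i, dot (uB i (lB i)) (Y k) <= bB i (lB i)) ->
    (4 * d.+1%:R ^+ d)^-1 * `|\det (edges Y)| <=
      (d%:R * (2 * d%:R * (2 * E) * rainbow_tau (2 * E) (2 * r) (th / 2))) ^+ d.
Proof.
move=> E1 r0 th0 B0 bT0 bB0 uTE uBE bTr bBr dT dB.
have d1 : 1 <= d%:R :> R by rewrite (ler_nat _ 1).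
have hw (x : 'I_d.+1) : `|hweight R x| <= d%:R :> R.
  by rewrite /hweight; case: (x == ord0); rewrite ?normrN ?normr_nat ?normr1.
have [pT pT0 pTE] := fin_all_exists2 (fun l => det_perturb uT l).
have [pB pB0 pBE] := fin_all_exists2 (fun l => det_perturb uB l).
have p0 u l (p : {poly R}) : (forall e, \det (rain (perturb u e) l) = p.[e]) ->
    p.[0] = \det (rain u l).
  move=> <-; congr (\det _); apply/matrixP => i j.
  by rewrite !mxE !mul0r addr0.
have h12 : 0 < 1 / 2 :> R by lra.
have th2 : 0 < th / 2 by lra.
have [xT xT0 closeT] := poly_close (pT lT0) h12.
have [xB xB0 closeB] := poly_close (pB lB0) th2.
pose c := d.+1%:R * (d%:R * B).
have c0 : 0 < c by rewrite !mulr_gt0 //; lra.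
pose e0 := Num.min (Num.min xT xB) (Num.min (E / d%:R) (r / c)).
have e00 : 0 < e0 by rewrite !lt_min xT0 // xB0 // !divr_gt0 //; lra.
have P0 : (\prod_l pT l) * (\prod_l pB l) != 0.
  by rewrite mulf_neq0 //; apply/prodf_neq0.
have [e /andP[e_gt0]] := poly_nonroot e00 P0.
rewrite !le_min => /andP[/andP[eT eB] /andP[eE er]].
rewrite hornerM mulf_eq0 negb_or !horner_prod => /andP[/prodf_neq0 nzT /prodf_neq0 nzB].
have eh (x : 'I_d.+1) : `|e * hweight R x| <= E :> R.
  rewrite normrM gtr0_norm //; apply: le_trans (_ : e * d%:R <= _).
    by apply: ler_wpM2l; [exact: ltW|exact: hw].
  by rewrite -ler_pdivlMr //; lra.
have balP u : balanced u -> balanced (perturb u e).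
  move=> bu i; rewrite /perturb big_split /= bu add0r -scaler_suml -mulr_sumr.
  by rewrite sum_hweight mulr0 scale0r.
have leP (u : 'I_d -> 'I_d.+1 -> 'rV[R]_d) : (forall j x k, `|u j x 0 k| <= E) ->
    forall j x k, `|perturb u e j x 0 k| <= 2 * E.
  move=> uE j x k; rewrite /perturb !mxE; apply: le_trans (ler_normD _ _) _.
  have -> : 2 * E = E + E by ring.
  rewrite lerD ?uE // normrM; apply: le_trans (eh x).
  by rewrite ler_piMr // eqxx /=; case: (k == j); rewrite ?normr0 ?normr1.
have sumP (b : 'I_d -> 'I_d.+1 -> R) : (forall i : 'I_d, \sum_x b i x <= r) ->
    forall i, \sum_(x < d.+1) (b i x + e * d%:R * B) <= 2 * r.
  move=> br i; rewrite big_split /= sumr_const card_ord -[X in _ + X]mulr_natl.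
  have -> : d.+1%:R * (e * d%:R * B) = e * c by rewrite /c; ring.
  by move: er; rewrite ler_pdivlMr // => er; have := br i; lra.
have detT : 1 / 2 <= `|\det (rain (perturb uT e) lT0)|.
  have := closeT e; rewrite e_gt0 eT pTE (p0 _ _ _ (pTE _)) => /(_ isT) h.
  have := ler_normB (pT lT0).[e] ((pT lT0).[e] - \det (rain uT lT0)).
  by rewrite opprB addrC subrK; lra.
have detB : th / 2 <= `|\det (rain (perturb uB e) lB0)|.
  have := closeB e; rewrite e_gt0 eB pBE (p0 _ _ _ (pBE _)) => /(_ isT) h.
  have := ler_normB (pB lB0).[e] ((pB lB0).[e] - \det (rain uB lB0)).
  by rewrite opprB addrC subrK; lra.
have ndT : nondegenerate (perturb uT e) by move=> l; rewrite pTE; exact: nzT.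
have ndB : nondegenerate (perturb uB e) by move=> l; rewrite pBE; exact: nzB.
have E2 : 1 <= 2 * E by lra.
have r2 : 0 < 2 * r by lra.
have [lT [lB H]] := @rainbow_simplex_generic (perturb uT e) (perturb uB e)
  (fun i x => bT i x + e * d%:R * B) (fun i x => bB i x + e * d%:R * B) (2 * E) (2 * r) (th / 2)
  lT0 lB0 E2 r2 th2 (balP _ bT0) (balP _ bB0) ndT ndB (leP _ uTE) (leP _ uBE) (sumP _ bTr) (sumP _ bBr)
  detT detB.
exists lT, lB => Y YB YT' YB'.
have dotP (u : 'I_d -> 'I_d.+1 -> 'rV[R]_d) (b : 'I_d -> 'I_d.+1 -> R) (l : {ffun 'I_d -> 'I_d.+1}) : (forall k i, dot (u i (l i)) (Y k) <= b i (l i)) ->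
    forall k i, dot (perturb u e i (l i)) (Y k) <= b i (l i) + e * d%:R * B.
  move=> h k i; rewrite /perturb dotDl dotZl [dot (delta_mx _ _) _]dotC dot_delta lerD ?h //.
  rewrite -!mulrA ler_pM2l //; apply: le_trans (ler_norm _) _.
  by rewrite normrM ler_pM.
apply: H => k i; exact: dotP.
Qed.

End RainbowSimplex.

(** * Exchange cycles and potentials *)

Section Dominance.
Variables (R : realFieldType) (n : nat).

(** The rows of the inverse have l1 norm at most 2, and 1 outside S, so [det_le_l1] bounds the
    determinant of the inverse. *)
Lemma det_dominant (M : 'M[R]_n) (S : {set 'I_n}) :
  (forall i, M i i = 1) -> (forall i, \sum_(j | j != i) `|M i j| <= 1 / 2) ->
  (forall i, i \notin S -> row i M = delta_mx 0 i) ->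
  (1 / 2) ^+ #|S| <= `|\det M|.
Proof.
move=> M1 Mh MS.
have l1 (v w : 'rV[R]_n) : w = v *m M ->
    (\sum_j `|v 0 j|) <= 2 * \sum_j `|w 0 j|.
  move=> wE; have vE j : v 0 j = w 0 j - \sum_(k | k != j) v 0 k * M k j.
    by rewrite wE mxE (bigD1 j) //= M1 mulr1 addrK.
  have : \sum_j `|v 0 j| <= \sum_j `|w 0 j| + \sum_j \sum_(k | k != j) `|v 0 k| * `|M k j|.
    rewrite -big_split /=; apply: ler_sum => j _; rewrite {1}vE.
    apply: le_trans (ler_normB _ _) _; rewrite lerD2l; apply: le_trans (ler_norm_sum _ _ _) _.
    by apply: ler_sum => k _; rewrite normrM.
  rewrite (exchange_big_dep xpredT) //=.
  have : \sum_k \sum_(j | k != j) `|v 0 k| * `|M k j| <= \sum_k `|v 0 k| * (1 / 2).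
    apply: ler_sum => k _; rewrite -mulr_sumr ler_wpM2l //.
    by apply: le_trans (Mh k); under eq_bigl do rewrite eq_sym.
  by rewrite -mulr_suml; lra.
have dM : \det M != 0.
  apply/det0P => -[v v0 vM]; have := l1 v 0 (esym vM).
  rewrite [X in _ <= 2 * X]big1 => [|j _]; last by rewrite mxE normr0.
  rewrite mulr0 => h; case/negP: v0; apply/eqP/rowP => j; rewrite mxE.
  apply/eqP; rewrite -normr_le0; apply: le_trans h.
  by rewrite (bigD1 j) //= lerDl sumr_ge0.
have uM : M \in unitmx by rewrite unitmxE unitfE.
pose B := invmx M.
have sum1 i : \sum_j `|row i (1%:M : 'M[R]_n) 0 j| = 1.
  rewrite (bigD1 i) //= big1 => [|j ji]; last by rewrite !mxE eq_sym (negPf ji) normr0.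
  by rewrite !mxE eqxx normr1 addr0.
have rB i : \sum_j `|B i j| <= if i \in S then 2 else 1.
  case: ifPn => [iS|iS].
    have := l1 (row i B) (row i (B *m M)) (row_mul i B M).
    rewrite (eq_bigr (fun j => `|B i j|)) => [|j _]; last by rewrite mxE.
    by rewrite mulVmx // sum1 mulr1.
  have : row i (M *m B) = row i B by rewrite row_mul MS // -rowE.
  rewrite mulmxV // => /rowP rE.
  rewrite -(sum1 i) le_eqVlt; apply/orP; left; apply/eqP; apply: eq_bigr => j _.
  by have := rE j; rewrite !mxE => ->.
have : `|\det B| <= 2 ^+ #|S|.
  apply: le_trans (det_le_l1 B) _; apply: le_trans (_ : \prod_i (if i \in S then 2 else 1) <= _).
    by apply: ler_prod => i _; rewrite rB sumr_ge0.
  by rewrite -big_mkcond /= prodr_const.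
rewrite /B det_inv normfV => h.
rewrite expr_div_n expr1n div1r -[leRHS]invrK lef_pV2 ?posrE ?exprn_gt0 //.
by rewrite invr_gt0 normr_gt0.
Qed.

(** Permuting and rescaling columns, then normalising rows, reduces to [det_dominant]; the column
    weights H cancel in the determinant. *)
Lemma det_dominant_perm (Z : 'M[R]_n) (s : 'S_n) (H : 'I_n -> R) (S : {set 'I_n}) :
  (forall j, 0 < H j) -> (forall i, Z i (s i) != 0) ->
  (forall i, \sum_(j | j != s i) `|Z i j| * H j <= 1 / 2 * (`|Z i (s i)| * H (s i))) ->
  (forall i, i \notin S -> forall j, j != s i -> Z i j = 0) ->
  (1 / 2) ^+ #|S| * \prod_i `|Z i (s i)| <= `|\det Z|.
Proof.
move=> H0 Zs Zd ZS.
pose D := diag_mx (\row_i (Z i (s i) * H (s i))^-1).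
pose D' := diag_mx (\row_i H (s i)).
pose M := D *m col_perm s Z *m D'.
have c0 i : Z i (s i) * H (s i) != 0 by rewrite mulf_neq0 // gt_eqF.
have ME i j : M i j = (Z i (s i) * H (s i))^-1 * (Z i (s j) * H (s j)).
  by rewrite /M mul_mx_diag mxE mul_diag_mx !mxE mulrA.
have dM : `|\det M| = `|\det Z| / \prod_i `|Z i (s i)|.
  rewrite /M !det_mulmx !det_diag col_permE det_mulmx det_perm !normrM normrX normrN1 expr1n mulr1.
  rewrite mulrAC mulrC; congr (_ * _); rewrite -normrM -big_split /= normr_prod -prodfV.
  by apply: eq_bigr => i _; rewrite !mxE invfM mulfVK ?gt_eqF // normfV.
have P0 : 0 < \prod_i `|Z i (s i)| by apply: prodr_gt0 => i _; rewrite normr_gt0.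
rewrite -ler_pdivlMr // -dM; apply: det_dominant => [i|i|i iS].
- by rewrite ME mulVf.
- have -> : \sum_(j | j != i) `|M i j| =
     (`|Z i (s i)| * H (s i))^-1 * \sum_(j | j != s i) `|Z i j| * H j.
    rewrite [in RHS](reindex_inj (@perm_inj _ s)) mulr_sumr; apply: eq_big => [j|j _].
      by rewrite (inj_eq perm_inj).
    by rewrite ME normrM normfV !normrM !(gtr0_norm (H0 _)).
  rewrite ler_pdivrMl ?mulr_gt0 ?normr_gt0 //.
  by rewrite mulrC; exact: Zd.
- apply/rowP => j; rewrite !mxE /=; have := ME i j; rewrite !mxE => ->.
  have [->|ji] := eqVneq j i; first by rewrite mulVf.
  have -> : Z i (s j) = 0 by apply: ZS; rewrite ?(inj_eq perm_inj).
  by rewrite mul0r mulr0.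
Qed.

End Dominance.

(** * Numerical estimates for the chords of a cycle *)

Section Numeric.
Variable R : realFieldType.

Lemma bernoulli_ge (y : R) k : 0 <= y -> 1 + k%:R * y <= (1 + y) ^+ k.
Proof.
move=> y0; elim: k => [|k IH]; first by rewrite mul0r addr0 expr0.
have k0 : 0 <= k%:R * y by rewrite mulr_ge0.
rewrite exprSr; apply: le_trans (_ : (1 + k%:R * y) * (1 + y) <= _).
  by rewrite -natr1; nra.
by rewrite ler_wpM2r //; lra.
Qed.

(** Bernoulli's inequality for (1 + (m - k) / k)^k. *)
Lemma ratio_pow_le k m : (0 < k <= m)%N ->
  (k%:R / m%:R) ^+ k <= ((m - k).+1%:R)^-1 :> R.
Proof.
case/andP=> k0 km; have k0' : 0 < k%:R :> R by rewrite ltr0n.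
have m0 : 0 < m%:R :> R by rewrite ltr0n (leq_trans k0).
rewrite -[leLHS]invrK lef_pV2 ?posrE ?invr_gt0 ?exprn_gt0 ?divr_gt0 // -exprVn invf_div.
have -> : m%:R / k%:R = 1 + (m - k)%:R / k%:R :> R.
  by rewrite natrB //; field; rewrite gt_eqF.
apply: le_trans (bernoulli_ge _ _); last by rewrite divr_ge0.
by rewrite mulrCA divff ?mulr1 ?gt_eqF // addrC natr1.
Qed.

(** Telescoping: (x + 1)^-3 is at most 1 / (2 x) - 1 / (2 (x + 1)). The defect 1 / (2 m) is left for
    the columns off the cycle. *)
Lemma sum_inv_cube m : (0 < m)%N ->
  \sum_(1 <= x < m) (x.+1%:R ^- 3) <= 1 / 2 - (2 * m%:R)^-1 :> R.
Proof.
case: m => // m _; elim: m => [|m IH]; first by rewrite big_geq //; lra.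
rewrite big_nat_recr //=; apply: le_trans (lerD IH (lexx _)) _.
have a0 : 1 <= m.+1%:R :> R by rewrite (ler_nat _ 1).
have -> : m.+2%:R = m.+1%:R + 1 :> R by rewrite natr1.
set a := m.+1%:R : R in a0 *.
suff : (a + 1) ^- 3 <= (2 * a)^-1 - (2 * (a + 1))^-1.
  by rewrite -[1 / 2 - _ + _]addrA lerD2l addrC lerBlDl addrC.
have -> : (2 * a)^-1 - (2 * (a + 1))^-1 = (2 * a * (a + 1))^-1.
  by field; rewrite !gt_eqF //; lra.
rewrite lef_pV2 ?posrE ?exprn_gt0 ?mulr_gt0 //; try lra.
by rewrite !exprS expr0; nra.
Qed.

End Numeric.

Section Exchange.
Variables (R : realFieldType) (n : nat) (Xi : 'I_n -> 'rV[R]_n -> Prop).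
Hypothesis Xi_delta : forall i, Xi i (delta_mx 0 i).
Hypothesis Xi_det : forall Y : 'M[R]_n, (forall i, Xi i (row i Y)) -> `|\det Y| <= 2.

(** The cube makes the contributions of the chords summable to less than 1/2; the factor 2 pays for
    the loss in [det_dominant]. *)
Definition cycle_cap m : R := (2 * m%:R ^+ 3) ^+ m.

(* A shortest cycle violating the bound would, after rescaling the columns, be a
   dominant permutation of the matrix obtained by exchanging its colours. *)
Lemma cycle_bound (Y : 'M[R]_n) : (forall i, Xi i (row i Y)) ->
  forall m (t : nat -> 'I_n),
  (forall i j, (i <= m)%N -> (j <= m)%N -> t i = t j -> i = j) ->
  (\prod_(k < m) `|Y (t k) (t k.+1)|) * `|Y (t m) (t 0%N)| <= cycle_cap m.+1.
Proof.
move=> YX; elim/ltn_ind => m IH t tI.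
case: m => [|m'] in IH tI *.
  rewrite big_ord0 mul1r /cycle_cap expr1n mulr1 expr1.
  have -> : Y (t 0%N) (t 0%N) = \det (repl 1%:M (t 0%N) (row (t 0%N) Y)).
    have {1}-> : row (t 0%N) Y = \sum_k Y (t 0%N) k *: row k 1%:M.
      by rewrite [LHS]row_sum_delta; apply: eq_bigr => k _; rewrite mxE row1.
    by rewrite (det_repl_cramer _ _ (fun k => Y (t 0%N) k)) det1 mulr1.
  by apply: Xi_det => i; rewrite row_repl row1; case: eqP => [->|].
set m := m'.+2.
pose T j := t (j %% m)%N.
have Tm j : T (j + m)%N = T j by rewrite /T modnDr.
pose q j := `|Y (T j) (T j.+1)|.
have q_per j : q (j + m)%N = q j by rewrite /q -addSn !Tm.
pose P := \prod_(k < m) q k.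
have PE : (\prod_(k < m'.+1) `|Y (t k) (t k.+1)|) * `|Y (t m'.+1) (t 0%N)| = P.
  rewrite /P /m [RHS]big_ord_recr /= /q /T /m modnn !modn_small //; congr (_ * _).
  by apply: eq_bigr => k _; have kl := ltn_ord k; rewrite !modn_small //; lia.
rewrite PE leNgt; apply/negP => Pbig.
pose rho : R := 2 * m%:R ^+ 3.
have m2 : 2 <= m%:R :> R by rewrite (ler_nat _ 2).
have rho0 : 0 < rho by rewrite mulr_gt0 // exprn_gt0 //; lra.
have q0 j : 0 < q j.
  rewrite lt_neqAle normr_ge0 andbT eq_sym; apply: contraTneq Pbig => qj.
  have qj' : q (j %% m)%N = 0.
    by rewrite -qj {2}(divn_eq j m); elim: (j %/ m)%N => [//|k IHk]; rewrite mulSn -addnA addnC q_per.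
  rewrite -leNgt /P (bigD1 (Ordinal (ltn_pmod j (isT : 0 < m)%N))) //= qj' mul0r.
  by rewrite exprn_ge0 // ltW.
(* Column weights for which every cycle entry gains a factor rho ([Hstep]). The step that returns to
   the start of the cycle is where the assumed violation of the bound is used. *)
pose h j := rho ^+ j / \prod_(i < j) q i.
pose Hh j := h (j %% m)%N.
have Hh0 j : 0 < Hh j by rewrite /Hh divr_gt0 ?exprn_gt0 ?prodr_gt0.
have q_mod j : q j = q (j %% m)%N.
  by rewrite {1}(divn_eq j m); elim: (j %/ m)%N => [//|k IHk]; rewrite mulSn -addnA addnC q_per.
have Hstep j : Hh j * rho <= Hh j.+1 * q j.
  rewrite /Hh q_mod -addn1 -modnDml addn1; set r := (j %% m)%N.
  have rm : (r < m)%N by rewrite ltn_mod.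
  have [r1|r1] := eqVneq r.+1 m; last first.
    have r1m : (r.+1 < m)%N by lia.
    rewrite modn_small // /h exprS big_ord_recr /= invfM.
    have -> : rho * rho ^+ r * ((\prod_(i < r) q i)^-1 / q r) * q r =
        rho ^+ r / (\prod_(i < r) q i) * rho * ((q r)^-1 * q r) by ring.
    by rewrite mulVf ?mulr1 // gt_eqF.
  rewrite r1 modnn /h big_ord0 expr0 divr1 mul1r mulrAC -exprSr r1.
  rewrite ler_pdivrMr ?prodr_gt0 // mulrC.
  have -> : (\prod_(i < r) q i) * q r = P by rewrite /P -r1 big_ord_recr.
  exact: ltW.
have Hsteps j k : Hh j * rho ^+ k <= Hh (j + k)%N * \prod_(i < k) q (j + i)%N.
  elim: k => [|k IHk]; first by rewrite addn0 expr0 big_ord0.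
  rewrite exprSr mulrA big_ord_recr /= addnS.
  apply: le_trans (ler_wpM2r (ltW rho0) IHk) _; rewrite mulrAC [leRHS]mulrA [leRHS]mulrAC.
  by rewrite ler_wpM2r ?Hstep // prodr_ge0 // => i _; exact: ltW.
have TI i j : (i < m)%N -> (j < m)%N -> forall b, T (b + i)%N = T (b + j)%N -> i = j.
  move=> im jm b; rewrite /T => e.
  have hb x : ((b + x) %% m <= m'.+1)%N by rewrite -ltnS ltn_mod.
  have /eqP := tI _ _ (hb i) (hb j) e.
  by rewrite eqn_modDl !modn_small // => /eqP.
(* The entry from [T k] to [T (b + r)] closes a cycle of length c = m - r that skips r vertices (a
   diagonal entry if c = 1). Induction bounds its product by [cycle_cap c], and comparison with rho
   ^+ c leaves (r + 1)^-3. *)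
have chord k b r : b = k.+1 -> (0 < r < m)%N ->
    `|Y (T k) (T (b + r)%N)| * Hh (b + r)%N <= r.+1%:R ^- 3 * (q k * Hh b).
  move=> bE /andP[r0 rm]; pose c := (m - r)%N.
  have c0 : (0 < c)%N by rewrite subn_gt0.
  have := IH c.-1 _ (fun j => T (b + r + j)%N) _; rewrite prednK //= addn0.
  have -> : T (b + r + c.-1)%N = T k.
    by rewrite -(Tm k); congr T; rewrite bE /c; lia.
  have -> : \prod_(i < c.-1) `|Y (T (b + r + i)) (T (b + r + i.+1))| =
      \prod_(i < c.-1) q (b + r + i)%N by apply: eq_bigr => i _; rewrite /q -addnS.
  move=> IHc.
  have {IHc} IHc : (\prod_(i < c.-1) q (b + r + i)%N) * `|Y (T k) (T (b + r)%N)| <= cycle_cap c.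
    apply: IHc => [|i j ic jc e]; first by rewrite /c; lia.
    apply: (TI i j _ _ (b + r)%N e); rewrite /c in ic jc *; lia.
  have := Hsteps (b + r)%N c.
  have -> : Hh (b + r + c)%N = Hh b.
    by rewrite /Hh; congr (h _); rewrite -addnA subnKC ?modnDr // ltnW.
  have -> : \prod_(i < c) q (b + r + i)%N = (\prod_(i < c.-1) q (b + r + i)%N) * q k.
    transitivity (\prod_(i < c.-1.+1) q (b + r + i)%N); first by rewrite prednK.
    rewrite big_ord_recr /=; congr (_ * _).
    by rewrite -(q_per k); congr q; rewrite bE /c; lia.
  set A := `|_|; set Q := \prod_(_ < _) _ in IHc *.
  move=> Hs; have rc : 0 < rho ^+ c by rewrite exprn_gt0.
  have capE : cycle_cap c / rho ^+ c <= r.+1%:R ^- 3.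
    have -> : cycle_cap c / rho ^+ c = ((c%:R / m%:R) ^+ c) ^+ 3.
      rewrite /cycle_cap /rho -expr_div_n exprAC; congr (_ ^+ c).
      by field; rewrite gt_eqF //; lra.
    rewrite -exprVn lerXn2r ?nnegrE ?exprn_ge0 ?divr_ge0 ?invr_ge0 //.
    have -> : r.+1 = (m - c).+1 by rewrite /c subKn // ltnW.
    by apply: ratio_pow_le; rewrite c0 /c leq_subr.
  apply: le_trans (_ : cycle_cap c / rho ^+ c * (q k * Hh b) <= _); last first.
    by rewrite ler_wpM2r // mulr_ge0 //; apply: ltW.
  rewrite mulrAC ler_pdivlMr // -mulrA.
  apply: le_trans (_ : A * (Hh b * (Q * q k)) <= _); first by apply: ler_wpM2l => //; exact: normr_ge0.
  have -> : A * (Hh b * (Q * q k)) = (Q * A) * (q k * Hh b) by ring.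
  by rewrite ler_wpM2r // mulr_ge0 //; apply: ltW.
pose sq := [seq T k | k <- iota 0 m].
have usq : uniq sq.
  rewrite map_inj_in_uniq ?iota_uniq // => i j; rewrite !mem_iota !add0n => im jm.
  exact: (TI i j im jm 0%N).
have mem_sq j : T j \in sq.
  have -> : T j = T (j %% m)%N by rewrite /T modn_mod.
  by apply: map_f; rewrite mem_iota add0n ltn_mod.
have idxT j : index (T j) sq = (j %% m)%N.
  have -> : T j = T (j %% m)%N by rewrite /T modn_mod.
  have jm : (j %% m < m)%N by rewrite ltn_mod.
  rewrite -{1}[(j %% m)%N](@nth_iota 0 0 m) // -(nth_map _ (T 0%N)) ?size_iota //.
  by rewrite index_uniq // size_map size_iota.
have idxP i : i \in sq -> exists2 k, (k < m)%N & i = T k.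
  by case/mapP=> k; rewrite mem_iota add0n => km ->; exists k.
pose sf i := if i \in sq then T (index i sq).+1 else i.
have sfT k : (k < m)%N -> sf (T k) = T k.+1 by move=> km; rewrite /sf mem_sq idxT modn_small.
have sf_out i : i \notin sq -> sf i = i by rewrite /sf => /negPf ->.
have sf_inj : injective sf.
  move=> i j; case: (boolP (i \in sq)) => [/idxP[a am ->]|iN]; last first.
    rewrite (sf_out i) //; case: (boolP (j \in sq)) => [/idxP[b bm ->]|jN]; last by rewrite sf_out.
    by rewrite sfT // => iE; rewrite iE mem_sq in iN.
  rewrite sfT //; case: (boolP (j \in sq)) => [/idxP[b bm ->]|jN]; last first.
    by rewrite sf_out // => jE; rewrite -jE mem_sq in jN.
  by rewrite sfT // => /(TI a b am bm 1%N) ->.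
pose X := \sum_i \sum_j `|Y i j|.
have X0 : 0 <= X by apply: sumr_ge0 => i _; apply: sumr_ge0.
pose y k := (2 * m%:R)^-1 * (q k * Hh k.+1).
have y0 k : 0 < y k by apply: mulr_gt0; [rewrite invr_gt0; lra|exact: mulr_gt0].
(* Weight of the columns off the cycle, so small that their entries cost at most the share 1 / (2 m)
   that the chords leave. *)
pose eta := ((1 + X) * (1 + \sum_(k < m) (y k)^-1))^-1.
have S0 : 0 <= \sum_(k < m) (y k)^-1 by apply: sumr_ge0 => k _; rewrite invr_ge0 ltW.
have eta0 : 0 < eta by rewrite invr_gt0 mulr_gt0 //; lra.
have etaX k : (k < m)%N -> eta * X <= y k.
  move=> km; rewrite /eta mulrC ler_pdivrMr ?mulr_gt0 //; try lra.
  have : (y k)^-1 <= \sum_(k < m) (y k)^-1.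
    rewrite (bigD1 (Ordinal km)) //= lerDl sumr_ge0 // => j _; by rewrite invr_ge0 ltW.
  move: S0; set S := \sum_(_ < _) _ => S0; rewrite -[leLHS]mulr1 ler_pdivrMl // => yS.
  by have := y0 k; nra.
(* The colours on the cycle are exchanged and the others keep their basis row: still a transversal,
   so its determinant is at most 2. *)
pose Z : 'M[R]_n := \matrix_(i, j) if i \in sq then Y i j else (i == j)%:R.
pose s := perm sf_inj.
pose H i := if i \in sq then Hh (index i sq) else eta.
have HT j : H (T j) = Hh j by rewrite /H mem_sq idxT /Hh modn_mod.
have Hpos j : 0 < H j by rewrite /H; case: ifP.
have ZT k j : Z (T k) j = Y (T k) j by rewrite mxE mem_sq.
have Zout i j : i \notin sq -> Z i j = (i == j)%:R by rewrite mxE => /negPf ->.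
have sT k : (k < m)%N -> s (T k) = T k.+1 by move=> km; rewrite permE sfT.
have sout i : i \notin sq -> s i = i by move=> iN; rewrite permE sf_out.
have dZ : `|\det Z| <= 2.
  apply: Xi_det => i; case: (boolP (i \in sq)) => iS.
    have -> : row i Z = row i Y by apply/rowP => j; rewrite !mxE iS.
    exact: YX.
  suff -> : row i Z = delta_mx 0 i by [].
  by apply/rowP => j; rewrite !mxE (negPf iS) eqxx /= eq_sym.
have Zne i : Z i (s i) != 0.
  case: (boolP (i \in sq)) => [/idxP[k km ->]|iN].
    by rewrite ZT sT // -normr_gt0; exact: q0.
  by rewrite Zout // sout // eqxx oner_eq0.
have Zdom i : \sum_(j | j != s i) `|Z i j| * H j <= 1 / 2 * (`|Z i (s i)| * H (s i)).
  case: (boolP (i \in sq)) => [/idxP[k km ->]|iN]; last first.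
    rewrite big1 => [|j]; first by apply: mulr_ge0; [lra|apply: mulr_ge0 => //; exact: ltW].
    rewrite sout // => ji; by rewrite Zout // eq_sym (negPf ji) normr0 mul0r.
  rewrite ZT sT // HT; under eq_bigr => j _ do rewrite ZT.
  rewrite -/(q k) (bigID (mem sq)) /=.
  have out : \sum_(j | (j != T k.+1) && (j \notin sq)) `|Y (T k) j| * H j <= y k.
    apply: le_trans (etaX k km); rewrite mulrC.
    apply: le_trans (_ : \sum_j `|Y (T k) j| * eta <= _); last first.
      rewrite -mulr_suml ler_wpM2r ?(ltW eta0) // /X [leRHS](bigD1 (T k)) //= lerDl.
      by apply: sumr_ge0 => i' _; apply: sumr_ge0.
    rewrite [leRHS](bigID (fun j => (j != T k.+1) && (j \notin sq))) /=.
    rewrite [X in _ <= X + _](eq_bigr (fun j => `|Y (T k) j| * H j)); last first.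
      by move=> j /andP[_ /negPf jN]; rewrite /H jN.
    by rewrite lerDl sumr_ge0 // => j _; rewrite mulr_ge0 // ltW.
  have ins : \sum_(j | (j != T k.+1) && (j \in sq)) `|Y (T k) j| * H j <=
      (1 / 2 - (2 * m%:R)^-1) * (q k * Hh k.+1).
    apply: le_trans (_ : (\sum_(1 <= r < m) r.+1%:R ^- 3) * (q k * Hh k.+1) <= _); last first.
      by rewrite ler_wpM2r ?sum_inv_cube // mulr_ge0 // ltW.
    pose L := [seq T (k.+1 + r)%N | r <- index_iota 1 m].
    have uL : uniq L.
      rewrite map_inj_in_uniq ?iota_uniq // => r r'; rewrite !mem_index_iota => /andP[_ rm] /andP[_ rm'].
      exact: TI.
    rewrite (eq_bigl (mem L)) => [|j].
      rewrite -big_uniq //= big_map mulr_suml [leLHS]big_seq [leRHS]big_seq; apply: ler_sum => r.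
      by rewrite mem_index_iota => rm; rewrite HT; exact: chord.
    apply/andP/mapP => [[jT /idxP[j' jm jE]]|[r]]; last first.
      rewrite mem_index_iota => /andP[r1 rm] ->; rewrite mem_sq; split=> //.
      apply: contraL r1 => /eqP e; rewrite -leqNgt leqn0; apply/eqP.
      by apply: (TI r 0%N rm isT k.+1); rewrite addn0.
    pose r := ((j' + (m - k.+1 %% m)) %% m)%N.
    have rE : T (k.+1 + r)%N = j.
      rewrite jE /T; congr t; rewrite /r modnDmr -modnDml.
      have cm : (k.+1 %% m <= m)%N by rewrite ltnW // ltn_mod.
      by rewrite addnCA subnKC // modnDr.
    exists r => //; rewrite mem_index_iota ltn_mod andbT lt0n.
    by apply: contra_neq jT => r0; rewrite -rE r0 addn0.
  apply: le_trans (lerD ins out) _; rewrite /y -mulrDl subrK; lra.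
have Zzero i : i \notin [set i in sq] -> forall j, j != s i -> Z i j = 0.
  rewrite inE => iN j; rewrite sout // => ji.
  by rewrite Zout // eq_sym (negPf ji).
have := le_trans (@det_dominant_perm R n Z s H [set i in sq] Hpos Zne Zdom Zzero) dZ.
have -> : #|[set i in sq]| = m.
  by rewrite cardsE; move/card_uniqP: usq => ->; rewrite size_map size_iota.
have -> : \prod_i `|Z i (s i)| = P.
  rewrite (bigID (mem sq)) /= [X in _ * X]big1 => [|i iN]; last first.
    by rewrite Zout // sout // eqxx normr1.
  rewrite mulr1 -big_uniq //= big_map /P -[iota 0 m]/(index_iota 0 m) big_mkord.
  by apply: eq_bigr => k _; rewrite ZT sT.
apply/negP; rewrite -ltNge.
apply: lt_trans (_ : (1 / 2) ^+ m * cycle_cap m < _); last first.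
  by rewrite ltr_pM2l //; apply: exprn_gt0; lra.
rewrite /cycle_cap -exprMn.
have -> : 1 / 2 * (2 * m%:R ^+ 3) = m%:R ^+ 3 :> R by field.
have m3 : 8 <= m%:R ^+ 3 :> R.
  have -> : 8 = 2 ^+ 3 :> R by rewrite !exprS expr0; ring.
  by rewrite lerXn2r // nnegrE; lra.
apply: lt_le_trans (_ : m%:R ^+ 3 <= _); first lra.
by rewrite -[leLHS]expr1 ler_weXn2l //; lra.
Qed.

End Exchange.

(** * Potentials from bounded closed walks *)

Section Walks.
Variables (R : realFieldType).

Fixpoint walk_weight (V : Type) (b : V -> V -> R) (x : V) (s : seq V) : R :=
  if s is y :: s' then b x y * walk_weight b y s' else 1.

Lemma walk_weight_cat (V : Type) (b : V -> V -> R) x s1 y s2 :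
  walk_weight b x (s1 ++ y :: s2) = walk_weight b x (rcons s1 y) * walk_weight b y s2.
Proof. by elim: s1 x => [|z s1 IH] x /=; rewrite ?mulr1 // IH mulrA. Qed.

Lemma walk_weight_ge0 (V : Type) (b : V -> V -> R) x s :
  (forall x y, 0 <= b x y) -> 0 <= walk_weight b x s.
Proof. by move=> b0; elim: s x => //= y s IH x; rewrite mulr_ge0. Qed.

Lemma walk_weight_nth (V : Type) (b : V -> V -> R) x0 x s :
  walk_weight b x s = \prod_(k < size s) b (nth x0 (x :: s) k) (nth x0 (x :: s) k.+1).
Proof.
elim: s x => [|y s IH] x; first by rewrite big_ord0.
by rewrite big_ord_recl /= IH.
Qed.

Lemma not_uniq_split (V : eqType) (x : V) s : ~~ uniq (x :: s) ->
  (exists l2 l3, s = l2 ++ x :: l3) \/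
  (exists l1 y l2 l3, s = l1 ++ y :: l2 ++ y :: l3).
Proof.
elim: s x => [//|y s IH] x; rewrite cons_uniq negb_and negbK => /orP[|/IH].
  by case/splitPr => l2 l3; left; exists l2, l3.
case=> [[l2 [l3 ->]]|[l1 [z [l2 [l3 ->]]]]]; right.
  by exists [::], y, l2, l3.
by exists (y :: l1), z, l2, l3.
Qed.

(** A repeated vertex splits a closed walk into two shorter closed walks whose weights multiply. *)
Lemma closed_walk_le1 (V : eqType) (b : V -> V -> R) :
  (forall x y, 0 <= b x y) ->
  (forall x s, uniq (x :: s) -> walk_weight b x (rcons s x) <= 1) ->
  forall x s, walk_weight b x (rcons s x) <= 1.
Proof.
move=> b0 simple x s; have [k] := ubnP (size s); elim: k x s => // k IH x s sk.
have [|] := boolP (uniq (x :: s)); first exact: simple.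
case/not_uniq_split => [[l2 [l3 sE]]|[l1 [y [l2 [l3 sE]]]]]; move: sk; rewrite sE !size_cat /= => sk.
  rewrite rcons_cat rcons_cons walk_weight_cat.
  by apply: mulr_ile1; rewrite ?walk_weight_ge0 //; apply: IH; lia.
rewrite size_cat /= in sk.
rewrite rcons_cat rcons_cons rcons_cat rcons_cons !walk_weight_cat mulrCA -walk_weight_cat.
rewrite -rcons_cons -rcons_cat.
apply: mulr_ile1; rewrite ?walk_weight_ge0 //; apply: IH; rewrite ?size_cat /=; lia.
Qed.

Lemma shortcut_walk (b : nat -> nat -> R) N x s y :
  (x < N)%N -> (y < N)%N -> all (ltn^~ N) s ->
  exists2 s', all (ltn^~ N.+1) s' &
  walk_weight (fun i j => Num.max (b i j) (b i N * b N j)) x (rcons s y) =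
    walk_weight b x (rcons s' y).
Proof.
elim: s x => [|z s IH] x xN yN /=.
  move=> _; case: (leP (b x y)) => _; [exists [:: N]|exists [::]] => //=.
  - by rewrite ltnSn.
  - by rewrite !mulr1.
case/andP=> zN /(IH z zN yN)[s' s'N sE].
case: (leP (b x z)) => _; rewrite sE; [exists (N :: z :: s')|exists (z :: s')] => //=.
- by rewrite ltnSn ltnS (ltnW zN).
- by rewrite mulrA.
- by rewrite ltnS (ltnW zN).
Qed.

(** Vertex elimination: detours through the last vertex are built into the weights b', after which
    the lower bounds that incoming edges put on its potential are compatible with the upper bounds
    from outgoing edges. *)
Lemma potential_nat N (b : nat -> nat -> R) : (forall i j, 0 <= b i j) ->
  (forall x s, (x < N)%N -> all (ltn^~ N) s -> walk_weight b x (rcons s x) <= 1) ->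
  exists2 p : nat -> R, (forall i, 0 < p i) &
    forall i j, (i < N)%N -> (j < N)%N -> b i j * p i <= p j.
Proof.
elim: N b => [|N IH] b b0 closed; first by exists (fun=> 1).
pose b' i j := Num.max (b i j) (b i N * b N j).
have [i j|x s xN sN|p p0 pb] := IH b'.
- by rewrite le_max b0.
- have [s' s'N ->] := shortcut_walk b xN xN sN.
  by apply: closed => //; exact: ltnW.
pose S := \sum_(j < N) b N j / p j.
have S0 : 0 <= S by apply: sumr_ge0 => j _; rewrite divr_ge0 ?b0 // ltW.
(* Keeps the new potential positive even without incoming edges, while staying below every
   [p j / b N j]. *)
pose del := (1 + S)^-1.
have del0 : 0 < del by rewrite invr_gt0; lra.
pose pN := \big[Num.max/del]_(i < N) (b i N * p i).
have pN0 : 0 < pN by apply: lt_le_trans del0 _; exact: bigmax_ge_id.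
exists (fun i => if i == N then pN else p i) => [i|i j]; first by case: ifP.
move=> iN1 jN1; case: eqVneq => [->|iN].
  case: eqVneq => [->|jN].
    rewrite -[leRHS]mul1r ler_pM2r //.
    by have := closed N [::] (ltnSn N) isT; rewrite /= mulr1.
  have jltN : (j < N)%N by lia.
  have [->|c0] := eqVneq (b N j) 0; first by rewrite mul0r ltW.
  have {}c0 : 0 < b N j by rewrite lt_neqAle eq_sym c0 b0.
  rewrite -ler_pdivlMl //; apply: bigmax_le => [|k _].
    have pc : 0 < p j / b N j by rewrite divr_gt0.
    rewrite mulrC /del -[leRHS]invrK lef_pV2 ?posrE ?invr_gt0 //; last lra.
    rewrite invf_div; apply: le_trans (_ : S <= _); last lra.
    rewrite /S (bigD1 (Ordinal jltN)) //= lerDl sumr_ge0 // => k _.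
    by rewrite divr_ge0 ?b0 // ltW.
  rewrite ler_pdivlMl // mulrA; apply: le_trans (pb k j (ltn_ord k) jltN).
  by rewrite ler_wpM2r ?(ltW (p0 k)) // le_max [b N j * _]mulrC lexx orbT.
have iltN : (i < N)%N by lia.
case: eqVneq => [->|jN].
  exact: (le_bigmax _ (fun i : 'I_N => b i N * p i) (Ordinal iltN)).
have jltN : (j < N)%N by lia.
apply: le_trans (pb i j iltN jltN); rewrite ler_wpM2r ?(ltW (p0 i)) //.
by rewrite le_max lexx.
Qed.

End Walks.

Section Potential.
Variables (R : realFieldType) (n : nat) (Xi : 'I_n -> 'rV[R]_n -> Prop).
Hypothesis Xi_delta : forall i, Xi i (delta_mx 0 i).
Hypothesis Xi_det : forall Y : 'M[R]_n, (forall i, Xi i (row i Y)) -> `|\det Y| <= 2.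
Variable a : 'I_n -> 'I_n -> R.
Hypothesis a_ge0 : forall i j, 0 <= a i j.
Hypothesis a_Xi : forall i j, exists2 v, Xi i v & a i j <= 2 * `|v 0 j|.

(** Dividing by 4 n^3 compensates both the factor 2 m^3 per edge in [cycle_cap] and the factor 2
    lost in [a_Xi], so that all simple cycles have weight at most 1. *)
Lemma exchange_potential : exists2 p : 'I_n -> R, (forall i, 0 < p i) &
  forall i j, a i j * p i <= (4 * n%:R ^+ 3) * p j.
Proof.
have [[n0]|n0] := posnP n; first by exists (fun=> 1) => // i; have := ltn_ord i; rewrite {2}n0.
pose D : R := 4 * n%:R ^+ 3.
have n1 : 1 <= n%:R :> R by rewrite (ler_nat _ 1).
have D0 : 0 < D by rewrite mulr_gt0 // exprn_gt0 //; lra.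
pose b i j := a i j / D.
have b0 i j : 0 <= b i j by rewrite divr_ge0 // ltW.
have simple (x : 'I_n) s : uniq (x :: s) -> walk_weight b x (rcons s x) <= 1.
  move=> us; pose m := size s; pose t k := nth x (x :: s) k.
  have tI i j : (i <= m)%N -> (j <= m)%N -> t i = t j -> i = j.
    by move=> im jm /eqP; rewrite nth_uniq // => /eqP.
  have mn : (m.+1 <= n)%N.
    by rewrite -(card_ord n) -[m.+1]/(size (x :: s)) -(card_uniqP us) max_card.
  (* A simple cycle uses each colour at most once, so a single matrix realises all its edges up to
     the factor 2. *)
  pose nx i := nth x (rcons s x) (index i (x :: s)).
  have [v vX va] := fin_all_exists2 (fun i => a_Xi i (nx i)).
  pose Y : 'M[R]_n := \matrix_i v i.
  have YX i : Xi i (row i Y) by rewrite rowK.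
  have nxt k : (k < m)%N -> nx (t k) = t k.+1.
    move=> km; rewrite /nx index_uniq //= ?ltnS ?(ltnW km) //.
    by rewrite nth_rcons km.
  have nxm : nx (t m) = t 0%N.
    by rewrite /nx index_uniq //= nth_rcons ltnn eqxx.
  have := cycle_bound Xi_delta Xi_det YX tI.
  have -> : walk_weight b x (rcons s x) =
      (\prod_(k < m) b (t k) (t k.+1)) * b (t m) (t 0%N).
    rewrite (walk_weight_nth _ x) size_rcons big_ord_recr /=; congr (_ * _).
      apply: eq_bigr => k _; rewrite nth_rcons ltn_ord; congr (b _ _).
      by case: k => -[|k] //= km; rewrite nth_rcons (ltnW km).
    rewrite [X in b _ X]nth_rcons ltnn eqxx; congr (b _ _).
    by rewrite -rcons_cons nth_rcons /= ltnSn.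
  have ab k j : nx (t k) = j -> b (t k) j <= 2 / D * `|Y (t k) j|.
    move=> <-; rewrite mulrAC ler_wpM2r ?invr_ge0 ?(ltW D0) // mxE; exact: va.
  move=> cb; apply: le_trans (_ : (\prod_(k < m) (2 / D * `|Y (t k) (t k.+1)|)) *
     (2 / D * `|Y (t m) (t 0%N)|) <= _).
    apply: ler_pM; rewrite ?prodr_ge0 ?ab //.
    by apply: ler_prod => k _; rewrite b0 ab // nxt.
  rewrite big_split /= prodr_const card_ord mulrACA -exprSr.
  have d2 : 0 < 2 / D by rewrite divr_gt0.
  apply: le_trans (ler_wpM2l _ cb) _; first by rewrite exprn_ge0 // ltW.
  rewrite /cycle_cap -exprMn exprn_ile1 //.
    by rewrite !mulr_ge0 ?invr_ge0 ?(ltW D0) ?exprn_ge0.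
  rewrite mulrAC ler_pdivrMr // mul1r /D.
  have : m.+1%:R ^+ 3 <= n%:R ^+ 3 :> R by rewrite lerXn2r ?nnegrE // ler_nat.
  by lra.
have closed := closed_walk_le1 b0 simple.
pose f (x : nat) : 'I_n := insubd (Ordinal n0) x.
pose bn x y := b (f x) (f y).
have bnE x s : walk_weight bn x s = walk_weight b (f x) (map f s).
  by elim: s x => //= y s IH x; rewrite IH.
have [i j|x s _ _|p p0 pb] := @potential_nat R n bn.
- exact: b0.
- by rewrite bnE map_rcons; exact: closed.
exists (fun i => p i) => // i j.
have := pb i j (ltn_ord i) (ltn_ord j); rewrite /bn /f !valKd /b.
by rewrite mulrAC ler_pdivrMr // [p j * D]mulrC.
Qed.
End Potential.

(** * Farkas and Caratheodory *)

Section Farkas.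
Variables (R : realFieldType).

(** Induction on the generators: if the separating y fails for the last one, everything is projected
    along it onto the hyperplane orthogonal to y. *)
Lemma farkas k m (a : nat -> 'rV[R]_k) (b : 'rV[R]_k) :
  (exists2 c : nat -> R, (forall i, 0 <= c i) & b = \sum_(i < m) c i *: a i) \/
  (exists2 y, (forall i, (i < m)%N -> 0 <= dot (a i) y) & dot b y < 0).
Proof.
elim: m a b => [|m IH] a b.
  have [->|b0] := eqVneq b 0; first by left; exists (fun=> 0); rewrite ?big_ord0.
  right; exists (- b) => //; rewrite dotC dotNl oppr_lt0.
  have [i bi] : exists i, b 0 i != 0.
    apply/existsP; apply: contraNT b0 => /existsPn z; apply/eqP/rowP => i.
    by rewrite mxE; apply/eqP/negPn/z.
  rewrite /dot (bigD1 i) //= ltr_pwDl //; first by rewrite -expr2 exprn_even_gt0.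
  by apply: sumr_ge0 => j _; rewrite -expr2 sqr_ge0.
case: (IH a b) => [[c c0 ->]|[y ay by0]].
  left; exists (fun i => if (i < m)%N then c i else 0) => [i|]; first by case: ifP.
  by rewrite big_ord_recr /= ltnn scale0r addr0; apply: eq_bigr => i _; rewrite ltn_ord.
have [any|any] := leP 0 (dot (a m) y).
  by right; exists y => // i; rewrite ltnS leq_eqVlt => /predU1P[->//|/ay].
pose al := dot (a m) y.
pose mu i := - (dot (a i) y / al); pose nu := dot b y / al.
have nu0 : 0 <= nu by rewrite /nu nmulr_lge0 ?invr_lt0 // ltW.
have mu0 i : (i < m)%N -> 0 <= mu i.
  by move=> /ay h; rewrite /mu oppr_ge0 nmulr_lle0 ?invr_lt0.
have al0 : al != 0 by rewrite lt_eqF.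
case: (IH (fun i => a i + mu i *: a m) (b - nu *: a m)) => [[c c0 bE]|[z az bz]].
  left; exists (fun i => if (i < m)%N then c i else \sum_(i < m) c i * mu i + nu) => [i|].
    case: ifP => // _; rewrite addr_ge0 // sumr_ge0 // => j _.
    by rewrite mulr_ge0 // mu0.
  rewrite big_ord_recr /= ltnn scalerDl scaler_suml addrA -big_split /=.
  apply/eqP; rewrite -subr_eq; apply/eqP; rewrite bE; apply: eq_bigr => i _.
  by rewrite ltn_ord scalerDr scalerA.
right; exists (z - (dot (a m) z / al) *: y) => [i|].
  rewrite ltnS leq_eqVlt => /predU1P[->|im].
    by rewrite dotBr dotZr -/al divfK // subrr.
  have := az i im; rewrite dotDl dotZl dotBr dotZr /mu.
  move=> h; apply: le_trans h _; rewrite le_eqVlt; apply/orP; left; apply/eqP; ring.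
move: bz; rewrite dotBl dotZl dotBr dotZr /nu => h; apply: le_lt_trans h.
by rewrite le_eqVlt; apply/orP; left; apply/eqP; ring.
Qed.

Lemma caratheodory k m (a : 'I_m -> 'rV[R]_k) (c : 'I_m -> R) :
  (forall i, 0 <= c i) ->
  exists c' : 'I_m -> R, [/\ (forall i, 0 <= c' i),
    \sum_i c' i *: a i = \sum_i c i *: a i & (#|[set i | c' i != 0%R]| <= k)%N].
Proof.
have [N] := ubnP #|[set i | c i != 0]|; elim: N c => // N IH c cN c0.
have [|big] := leqP #|[set i | c i != 0]| k; first by exists c.
set S := [set i | c i != 0] in cN big.
pose A := \matrix_(j < #|S|) a (enum_val j).
have : kermx A != 0.
  by rewrite kermx_eq0 -row_leq_rank -ltnNge (leq_ltn_trans _ big) // rank_leq_col.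
case/rowV0Pn => v /sub_kermxP vA v0.
pose mu i := \sum_(j | enum_val j == i) v 0 j.
have muE j : mu (enum_val j) = v 0 j.
  rewrite /mu (bigD1 j) //= big1 ?addr0 // => j' /andP[/eqP/enum_val_inj ->].
  by rewrite eqxx.
have muS i : i \notin S -> mu i = 0.
  by move=> iS; rewrite /mu big1 // => j /eqP e; rewrite -e enum_valP in iS.
have muA : \sum_i mu i *: a i = 0.
  rewrite -[RHS]vA mulmx_sum_row.
  under eq_bigr => i _ do rewrite scaler_suml big_mkcond /=.
  rewrite exchange_big /=; apply: eq_bigr => j _; rewrite rowK.
  rewrite (bigD1 (enum_val j)) //= eqxx big1 ?addr0 // => i ij.
  by rewrite eq_sym (negPf ij).
clear vA.
wlog [j0 vj0] : v v0 mu muE muS muA / exists j, 0 < v 0 j.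
  move=> H; have [j vj] : exists j, v 0 j != 0.
    apply/existsP; apply: contraNT v0 => /existsPn z; apply/eqP/rowP => j.
    by rewrite mxE; apply/eqP/negPn/z.
  have [vp|vn|ve] := ltrgt0P (v 0 j); last by rewrite ve eqxx in vj.
    by apply: (H v _ mu) => //; exists j.
  apply: (H (- v) _ (fun i => - mu i)); rewrite ?oppr_eq0 //.
  - by move=> i; rewrite mxE muE.
  - by move=> i iS; rewrite muS ?oppr0.
  - by under eq_bigr => i _ do rewrite scaleNr; rewrite sumrN muA oppr0.
  - by exists j; rewrite mxE oppr_gt0.
have mj0 : 0 < mu (enum_val j0) by rewrite muE.
pose i1 := [arg min_(i < enum_val j0 | 0 < mu i) (c i / mu i)]%O.
have [mi1 min1] : 0 < mu i1 /\ forall i, 0 < mu i -> c i1 / mu i1 <= c i / mu i.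
  by rewrite /i1; case: arg_minP => // i mi mm; split.
pose t := c i1 / mu i1.
have t0 : 0 <= t by rewrite divr_ge0 ?c0 // ltW.
pose c' i := c i - t * mu i.
have c'0 i : 0 <= c' i.
  rewrite /c' subr_ge0; have [mp|mn] := ltP 0 (mu i).
    by rewrite -ler_pdivlMr // min1.
  by apply: le_trans (c0 i); rewrite mulr_ge0_le0.
have i1S : i1 \in S by apply: contraLR mi1 => /muS ->; rewrite ltxx.
have lt : ([set i | c' i != 0] \proper S)%SET.
  apply/properP; split; last first.
    by exists i1 => //; rewrite inE negbK /c' /t divfK ?subrr // gt_eqF.
  apply/fintype.subsetP => i; rewrite !inE; apply: contraNN => /eqP ci.
  by rewrite /c' ci muS ?mulr0 ?subr0 // inE ci eqxx.
have [|c'' [h1 h2 h3]] := IH c' _ c'0.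
  exact: leq_trans (proper_card lt) _.
exists c''; split => //; rewrite h2 /c'.
under eq_bigr => i _ do rewrite scalerBl -scalerA.
by rewrite sumrB -scaler_sumr muA scaler0 subr0.
Qed.

(** Farkas with the constants as an extra coordinate. Caratheodory in dimension d + 1 gives the
    support size that [unit_partition] allows. *)
Lemma affine_infeasible d m (u : 'I_m -> 'rV[R]_d) (b : 'I_m -> R) :
  (forall y, exists i, b i < dot (u i) y) ->
  exists c : 'I_m -> R, [/\ (forall i, 0 <= c i), (#|[set i | c i != 0%R]| <= d.+1)%N,
    \sum_i c i *: u i = 0 & \sum_i c i * b i = -1].
Proof.
move=> inf; have m0 : (0 < m)%N by have [[i im] _] := inf 0; exact: leq_ltn_trans im.
pose f (x : nat) : 'I_m := insubd (Ordinal m0) x.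
pose a (i : nat) : 'rV[R]_(d + 1) := row_mx (u (f i)) (b (f i))%:M.
have dotrow x s y t : dot (row_mx x (s%:M : 'rV[R]_1) : 'rV[R]_(d + 1)) (row_mx y (t%:M : 'rV[R]_1)) =
    dot x y + s * t :> R.
  rewrite /dot big_split_ord /= big_ord1; congr (_ + _); last by rewrite !row_mxEr !mxE eqxx !mulr1n.
  by apply: eq_bigr => i _; rewrite !row_mxEl.
have [[c c0 cE]|[z za zb]] := farkas m a (row_mx 0 (-1)%:M); last first.
  exfalso; move: za zb; rewrite -[z]hsubmxK [rsubmx z]mx11_scalar; set y := lsubmx z; set t := rsubmx z 0 0.
  rewrite dotrow dot0l add0r mulN1r oppr_lt0 => za t0.
  have [i] := inf (- t^-1 *: y); rewrite dotZr mulNr [_^-1 * _]mulrC -mulNr ltr_pdivlMr // => h.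
  have := za i (ltn_ord i); rewrite /a /f valKd dotrow; lra.
have [c' [c'0 c'E c'S]] := caratheodory (fun i : 'I_m => a i) (fun i : 'I_m => c0 i).
exists c'; split => //; first by rewrite -addn1.
- apply/rowP => j; have /rowP/(_ (lshift 1 j)) := c'E.
  rewrite -cE row_mxEl => <-; rewrite !summxE; apply: eq_bigr => i _.
  by rewrite /a /f valKd !mxE (unsplitK (inl j)).
- have /rowP/(_ (rshift d ord0)) := c'E.
  rewrite -cE row_mxEr mxE eqxx mulr1n => <-; rewrite !summxE; apply: eq_bigr => i _.
  by rewrite /a /f valKd !mxE (unsplitK (inr ord0)) !mxE eqxx mulr1n.
Qed.

End Farkas.

(** * Nearly maximal transversals *)

Section NearMax.
Variable R : realType.

Lemma sup_half (E : set R) (x0 : R) : (forall x, E x -> 0 <= x <= x0) -> (exists x, E x) ->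
  exists2 x, E x & sup E <= 2 * x /\ (0 < sup E -> 0 < x).
Proof.
move=> Eb E0; have hs : has_sup E by split=> //; exists x0 => x /Eb/andP[].
have [s0|s0] := ltP 0 (sup E); last first.
  have [x Ex] := E0; exists x => //; split=> [|//].
  by apply: le_trans s0 _; have /andP[] := Eb _ Ex; lra.
have s2 : 0 < sup E / 2 by lra.
have [x Ex xs] := sup_adherent s2 hs.
by exists x => //; split => [|_]; lra.
Qed.

(** The maximal determinant need not be attained, so X is only required to reach half the supremum.
    In the coordinates given by its rows, X becomes the identity and every transversal has
    determinant at most 2, as [exchange_potential] requires. *)
Lemma near_max_potential n (Xi : 'I_n -> 'rV[R]_n -> Prop) (C : R) :
  (forall i v, Xi i v -> forall j, `|v 0 j| <= C) ->
  (exists2 X : 'M[R]_n, (forall i, Xi i (row i X)) & \det X != 0) ->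
  exists X : 'M[R]_n, [/\ (forall i, Xi i (row i X)), \det X != 0 &
    exists2 p : 'I_n -> R, (forall i, 0 < p i) &
    forall i v, Xi i v -> forall j,
      `|(v *m invmx X) 0 j| * p i <= (4 * n%:R ^+ 3) * p j].
Proof.
move=> XC [X0 X0X dX0].
have dC (X : 'M[R]_n) : (forall i, Xi i (row i X)) -> 0 <= `|\det X| <= (n%:R * C) ^+ n.
  move=> HX; rewrite normr_ge0 /=; apply: le_trans (det_le_l1 X) _.
  rewrite -[X in _ <= _ ^+ X]card_ord -prodr_const; apply: ler_prod => i _.
  rewrite sumr_ge0 //= mulr_natl -[X in _ <= _ *+ X]card_ord -sumr_const.
  by apply: ler_sum => j _; have := XC _ _ (HX i) j; rewrite mxE.
pose E : set R := fun r => exists2 X : 'M[R]_n, (forall i, Xi i (row i X)) & r = `|\det X|.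
have [||r [X XX ->] [supX]] := @sup_half E ((n%:R * C) ^+ n).
- by move=> _ [X HX ->]; exact: dC.
- by exists `|\det X0|, X0.
have Esup (X' : 'M[R]_n) : (forall i, Xi i (row i X')) -> `|\det X'| <= sup E.
  move=> HX; apply: ub_le_sup; last by exists X'.
  by exists ((n%:R * C) ^+ n) => _ [Y HY ->]; have /andP[] := dC _ HY.
move=> /(_ (lt_le_trans _ (Esup _ X0X))); rewrite !normr_gt0 => /(_ dX0) dX.
exists X; split => //.
have uX : X \in unitmx by rewrite unitmxE unitfE.
pose Xi' i v := exists2 w, Xi i w & v = w *m invmx X.
have Xi'd i : Xi' i (delta_mx 0 i).
  by exists (row i X) => //; rewrite -row_mul mulmxV // row1.
have Xi'det (Y : 'M[R]_n) : (forall i, Xi' i (row i Y)) -> `|\det Y| <= 2.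
  move=> HY; have : forall i, Xi i (row i (Y *m X)).
    by move=> i; have [w Xw e] := HY i; rewrite row_mul e mulmxKV.
  move=> /Esup h; rewrite -(ler_pM2r (_ : 0 < `|\det X|)) ?normr_gt0 //.
  by rewrite -normrM -det_mulmx; apply: le_trans h supX.
pose C' := \sum_k \sum_j C * `|invmx X k j|.
have C'b i v j : Xi' i v -> `|v 0 j| <= C'.
  case=> w Xw ->; rewrite mxE; apply: le_trans (ler_norm_sum _ _ _) _.
  apply: ler_sum => k _; rewrite normrM.
  have C0 : 0 <= C by exact: le_trans (normr_ge0 _) (XC _ _ Xw j).
  apply: le_trans (_ : C * `|invmx X k j| <= _); first by apply: ler_wpM2r => //; exact: XC Xw _.
  by rewrite (bigD1 j) //= lerDl sumr_ge0 // => j' _; rewrite mulr_ge0.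
pose Ea i j : set R := fun r => exists2 v, Xi' i v & r = `|v 0 j|.
pose a i j := sup (Ea i j).
have Ea1 i j x : Ea i j x -> 0 <= x <= C'.
  by case=> v Xv ->; rewrite normr_ge0 /= (C'b i).
have aub i j v : Xi' i v -> `|v 0 j| <= a i j.
  move=> Xv; apply: ub_le_sup; last by exists v.
  by exists C' => x /Ea1/andP[].
have [|i j|p p0 pa] := @exchange_potential R n Xi' Xi'd Xi'det a.
- by move=> i j; exact: le_trans (normr_ge0 _) (aub i j _ (Xi'd i)).
- have [||x [v Xv ->] [h _]] := @sup_half (Ea i j) C'.
  + exact: Ea1.
  + by exists `|(delta_mx 0 i : 'rV[R]_n) 0 j|, (delta_mx 0 i).
  by exists v.
exists p => // i v Xv j; apply: le_trans (pa i j).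
by rewrite ler_wpM2r ?(ltW (p0 i)) //; apply: aub; exists v.
Qed.

(** A nonzero term of the Leibniz formula comes from a permutation that maps the rows of the first
    type exactly onto the first d columns. *)
Lemma det_two_types d (X : 'M[R]_(d + d)) (ty : pred 'I_(d + d)) (u : 'I_(d + d) -> 'rV[R]_d) :
  (forall i, row i X = if ty i then row_mx (u i) 0 else row_mx 0 (u i)) ->
  \det X != 0 -> #|ty| = d /\ #|predC ty| = d.
Proof.
move=> HX dX.
have XE i j : X i j = if ty i then row_mx (u i) 0 0 j else row_mx 0 (u i) 0 j.
  by have /rowP/(_ j) := HX i; rewrite mxE => ->; case: (ty i).
pose left := [pred j : 'I_(d + d) | (j < d)%N].
have cl : #|left| = d.
  rewrite -[RHS](card_ord d) -[RHS](fintype.card_image (@lshift_inj d d)); apply: eq_card => j.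
  apply/idP/codomP => [jd|[k ->]]; last by rewrite inE /= ltn_ord.
  by exists (Ordinal (jd : (j < d)%N)); apply: val_inj.
have key : #|ty| = d.
  move: dX; rewrite /determinant; case: (eqVneq #|ty| d) => // ne; case/negP.
  rewrite big1 // => s _; suff /existsP[i /eqP Hi] : [exists i, X i (s i) == 0].
    by rewrite (bigD1 i) //= Hi mul0r mulr0.
  apply: contraNT ne => /existsPn H.
  suff -> : #|ty| = #|left| by rewrite cl.
  rewrite -(fintype.card_image (@perm_inj _ s) ty); apply: eq_card => j.
  have E i : ty i = (s i < d)%N.
    by have := H i; rewrite XE; case: (ty i); rewrite mxE; case: splitP => k e; rewrite ?mxE ?eqxx //=.
  apply/fintype.imageP/idP => [[i ti ->]|jl]; first by rewrite inE /= -E.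
  by exists (s^-1 j)%g; rewrite ?permKV // unfold_in E permKV.
by split=> //; have := cardC ty; rewrite key card_ord => /addnI.
Qed.

End NearMax.

(** * Affine partitions of unity *)

Section LinearAlgebra.
Variable R : realFieldType.

(** The rows of X selected by e span the image of J, so a vector of this block has the same
    coordinates in X as in U. *)
Lemma block_coords d n (X : 'M[R]_n) (e : 'I_d -> 'I_n) (U : 'M[R]_d) (J : 'M[R]_(d, n)) :
  injective e -> X \in unitmx -> (forall k, row (e k) X = row k U *m J) ->
  U \in unitmx /\ forall (w : 'rV[R]_d) k, (w *m J *m invmx X) 0 (e k) = (w *m invmx U) 0 k.
Proof.
move=> eI uX HX; pose E : 'M[R]_(d, n) := \matrix_k delta_mx 0 (e k).
have EX : E *m X = U *m J by apply/row_matrixP => k; rewrite row_mul rowK -rowE HX row_mul.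
have EE : U *m J *m invmx X = E by rewrite -EX mulmxK.
have Ee (z : 'rV[R]_d) k : (z *m E) 0 (e k) = z 0 k.
  rewrite mxE (bigD1 k) //= !mxE !eqxx mulr1 big1 ?addr0 // => j jk.
  by rewrite !mxE (inj_eq eI) eq_sym (negPf jk) andbF mulr0.
have uU : U \in unitmx.
  rewrite unitmxE unitfE; apply/det0P => -[v v0 vU]; case/negP: v0; apply/eqP/rowP => k.
  by rewrite -Ee -EE !mulmxA vU !mul0mx !mxE.
by split=> // w k; rewrite -Ee -EE !mulmxA mulmxKV.
Qed.

Lemma scaled_coords d (p : 'I_d -> R) (U : 'M[R]_d) (w : 'rV[R]_d) k :
  (forall k, 0 < p k) -> U \in unitmx ->
  (w *m invmx (diag_mx (\row_k p k) *m U)) 0 k = (w *m invmx U) 0 k / p k.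
Proof.
move=> p0 uU; set G := _ *m U.
have uG : G \in unitmx.
  rewrite unitmx_mul uU andbT unitmxE det_diag unitfE; apply/prodf_neq0 => i _.
  by rewrite mxE gt_eqF.
pose y : 'rV[R]_d := \row_k ((w *m invmx U) 0 k / p k).
have wE : w = y *m G.
  rewrite /G mulmxA -{1}(mulmxKV uU w); congr (_ *m U); apply/rowP => j.
  by rewrite mul_mx_diag !mxE divfK // gt_eqF.
by rewrite {1}wE mulmxK // mxE.
Qed.

Lemma dot_mx d (x y : 'rV[R]_d) : dot x y = (x *m y^T) 0 0.
Proof. by rewrite mxE; apply: eq_bigr => i _; rewrite mxE. Qed.

Lemma dot_invmx d (G : 'M[R]_d) (x y : 'rV[R]_d) : G \in unitmx ->
  dot (x *m invmx G) (y *m G^T) = dot x y.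
Proof. by move=> uG; rewrite !dot_mx trmx_mul trmxK mulmxA mulmxKV. Qed.

Lemma edges_mul d (Y : 'I_d.+1 -> 'rV[R]_d) (M : 'M[R]_d) :
  edges (fun k => Y k *m M) = edges Y *m M.
Proof. by apply/row_matrixP => k; rewrite row_mul !row_edges mulmxBl. Qed.

(** The padding [None] contributes zero to every F, so the same g serves slopes, constants and
    pairings. *)
Lemma pad_support m d (A : {set 'I_m}) : (#|A| <= d)%N ->
  exists g : 'I_d -> option 'I_m, forall (V : nmodType) (F : 'I_m -> V),
    \sum_x oapp F 0 (g x) = \sum_(i in A) F i.
Proof.
move=> Ad; exists (fun x => omap (fun j : 'I_#|A| => enum_val j) (insub (val x))) => V F.
pose f (x : nat) := oapp F 0 (omap (fun j : 'I_#|A| => enum_val j) (insub x)).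
rewrite -[LHS]/(\sum_(x < d) f x) (bigID (fun x : 'I_d => (x < #|A|)%N)) /=.
rewrite [X in _ + X]big1 ?addr0 => [|x]; last by rewrite /f => /negPf h; rewrite insubF.
rewrite -(big_ord_widen _ f Ad) [RHS]big_enum_val; apply: eq_bigr => j _.
by rewrite /f valK.
Qed.

End LinearAlgebra.

Section UnitPartition.
Variables (R : realType) (d : nat).

(** A pair s encodes an affine function and also the half-space where it is nonnegative. *)
Definition aval (s : 'rV[R]_d * R) (y : 'rV[R]_d) : R := s.2 - dot s.1 y.

Definition conepart (S : seq ('rV[R]_d * R)) (q : 'rV[R]_d * R) :=
  exists c s, [/\ 0 <= c, s \in S & q = (c *: s.1, c * s.2)].

Definition unit_partition S (q : 'I_d.+1 -> 'rV[R]_d * R) :=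
  [/\ forall x, conepart S (q x), \sum_x (q x).1 = 0 & \sum_x (q x).2 = 1].

Lemma aval_cone c s y : aval (c *: s.1, c * s.2) y = c * aval s y.
Proof. by rewrite /aval dotZl mulrBr. Qed.

Lemma aval_partition S q y : unit_partition S q -> \sum_x aval (q x) y = 1.
Proof. by case=> _ q1 q2; rewrite /aval sumrB -dot_suml q1 dot0l subr0. Qed.

(** At each vertex of Y the members are nonnegative with sum 1, hence at most 1, and a slope is
    determined by its values on the edges. *)
Lemma partition_bounded S (Y : 'I_d.+1 -> 'rV[R]_d) : \det (edges Y) != 0 ->
  (forall s, s \in S -> forall k, 0 <= aval s (Y k)) ->
  exists C : R, forall q, unit_partition S q -> forall x j, `|(q x).1 0 j| <= C.
Proof.
move=> dY SY; have uY : (edges Y)^T \in unitmx by rewrite unitmx_tr unitmxE unitfE.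
exists (\sum_j \sum_k `|invmx (edges Y)^T k j|) => q qP x j.
have q0 x' k : 0 <= aval (q x') (Y k).
  by case: qP => /(_ x')[c [s [c0 sS ->]]] _ _; rewrite aval_cone mulr_ge0 // SY.
have q1 x' k : aval (q x') (Y k) <= 1.
  by rewrite -(aval_partition (Y k) qP) (bigD1 x') //= lerDl sumr_ge0.
rewrite -[(q x).1](mulmxK uY) mxE; apply: le_trans (ler_norm_sum _ _ _) _.
apply: le_trans (_ : \sum_k `|invmx (edges Y)^T k j| <= _); last first.
  by rewrite [leRHS](bigD1 j) //= lerDl sumr_ge0 // => j' _; apply: sumr_ge0.
apply: ler_sum => k _; rewrite normrM ler_piMl //.
have -> : ((q x).1 *m (edges Y)^T) 0 k = dot (q x).1 (Y (lift ord0 k) - Y ord0).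
  by rewrite mxE; apply: eq_bigr => i _; rewrite !mxE.
have := q0 x ord0; have := q0 x (lift ord0 k); have := q1 x ord0; have := q1 x (lift ord0 k).
by rewrite /aval dotBr ler_norml; lra.
Qed.

(* Farkas' lemma produces an affine combination certifying that no translate of the
   simplex fits; normalising its constant value to 1 gives a unit partition. *)
Lemma fit_simplex S (Y : 'I_d.+1 -> 'rV[R]_d) (w : 'I_d.+1 -> 'rV[R]_d) :
  \det (edges Y) != 0 -> (forall s, s \in S -> forall k, 0 <= aval s (Y k)) ->
  (exists s, s \in S) ->
  (forall q, unit_partition S q -> forall x k, dot (q x).1 (w k) <= d.+1%:R^-1) ->
  exists y, forall s, s \in S -> forall k, 0 <= aval s (y + w k).
Proof.
move=> dY SY [s0 s0S] Hw; apply: contrapT => no.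
pose I : finType := ('I_(size S) * 'I_d.+1)%type.
pose sI (i : 'I_#|I|) := nth (0, 0) S (enum_val i).1; pose kI (i : 'I_#|I|) := (enum_val i).2.
have sIS i : sI i \in S by rewrite mem_nth.
have [|c [c0 cS cu cb]] := @affine_infeasible R d #|I| (fun i => (sI i).1)
    (fun i => (sI i).2 - dot (sI i).1 (w (kI i))).
  move=> y; apply: contrapT => H; apply: no; exists y => s sS k.
  rewrite leNgt; apply/negP => neg; apply: H.
  have si : (index s S < size S)%N by rewrite index_mem.
  exists (enum_rank ((Ordinal si, k) : I)); rewrite /sI /kI enum_rankK /= nth_index //.
  by move: neg; rewrite /aval dotDr; lra.
(* The constant of the certificate, positive because Y is nondegenerate; its pairing with w is t +
   1. After division by t there are d + 1 terms, each at most 1 / (d + 1), whence t + 1 <= t, a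
   contradiction. *)
pose t := \sum_i c i * (sI i).2.
have tE : t + 1 = \sum_i c i * dot (sI i).1 (w (kI i)).
  by move: cb; under eq_bigr do rewrite mulrBr; rewrite sumrB -/t; lra.
have tY y : \sum_i c i * aval (sI i) y = t.
  under eq_bigr do rewrite /aval mulrBr; rewrite sumrB -/t.
  under [X in _ - X]eq_bigr do rewrite -dotZl.
  by rewrite -dot_suml cu dot0l subr0.
have t_ge0 : 0 <= t by rewrite -(tY (Y ord0)) sumr_ge0 // => i _; rewrite mulr_ge0 ?SY.
have t0 : t != 0.
  apply/eqP => tz; have cz i k : c i * aval (sI i) (Y k) = 0.
    have := tY (Y k); rewrite tz => /psumr_eq0P H; apply: H => // j _.
    by rewrite mulr_ge0 ?SY.
  have cz1 i : c i *: (sI i).1 = 0.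
    have uY : (edges Y)^T \in unitmx by rewrite unitmx_tr unitmxE unitfE.
    rewrite -[LHS](mulmxK uY) (_ : _ *m (edges Y)^T = 0) ?mul0mx //.
    apply/rowP => k; rewrite !mxE.
    transitivity (c i * aval (sI i) (Y ord0) - c i * aval (sI i) (Y (lift ord0 k))).
      rewrite -mulrBr /aval opprB addrC addrA subrK -dotBr -dotZl.
      by apply: eq_bigr => j _; rewrite !mxE.
    by rewrite !cz subrr.
  have : \sum_i c i * dot (sI i).1 (w (kI i)) = 0.
    by apply: big1 => i _; rewrite -dotZl cz1 dot0l.
  by rewrite -tE tz; lra.
have {t0 t_ge0} t0 : 0 < t by rewrite lt_neqAle eq_sym t0.
have [g gE] := pad_support cS.
have gsum (V : nmodType) (F : 'I_#|I| -> V) : (forall i, c i = 0 -> F i = 0) ->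
    \sum_x oapp F 0 (g x) = \sum_i F i.
  move=> F0; rewrite gE big_mkcond; apply: eq_bigr => i _; rewrite inE.
  by case: eqVneq => // /F0.
pose q x := oapp (fun i => (c i / t *: (sI i).1, c i / t * (sI i).2)) (0, 0) (g x).
have qP : unit_partition S q.
  split.
  - move=> x; rewrite /q; case: (g x) => [i|] /=.
      by exists (c i / t), (sI i); split => //; rewrite divr_ge0 // ltW.
    by exists 0, s0; rewrite scale0r mul0r.
  - rewrite (eq_bigr (fun x => oapp (fun i => c i / t *: (sI i).1) 0 (g x))); last first.
      by move=> x _; rewrite /q; case: (g x).
    rewrite gsum => [|i ->]; last by rewrite mul0r scale0r.
    under eq_bigr do rewrite mulrC -scalerA.
    by rewrite -scaler_sumr cu scaler0.
  - rewrite (eq_bigr (fun x => oapp (fun i => c i / t * (sI i).2) 0 (g x))); last first.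
      by move=> x _; rewrite /q; case: (g x).
    rewrite gsum => [|i ->]; last by rewrite !mul0r.
    under eq_bigr do rewrite mulrAC.
    by rewrite -mulr_suml -/t divff // gt_eqF.
have : \sum_x oapp (fun i => c i / t * dot (sI i).1 (w (kI i))) 0 (g x) <= \sum_(x < d.+1) d.+1%:R^-1.
  apply: ler_sum => x _; have := Hw q qP x; rewrite /q; case: (g x) => [i|] /= H.
    by rewrite -dotZl; exact: H.
  by rewrite invr_ge0.
rewrite gsum => [|i ->]; last by rewrite !mul0r.
under eq_bigr do rewrite mulrAC.
rewrite -mulr_suml -tE sumr_const card_ord -[X in _ <= X]mulr_natl divff ?pnatr_eq0 //.
by rewrite ler_pdivrMr // mul1r; lra.
Qed.

End UnitPartition.

(** * The theorem for finite systems of half-spaces *)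

Section FiniteTheorem.
Variables (R : realType) (d : nat).
Hypothesis d_gt0 : (0 < d)%N.

Lemma enum_pred_inj (n : nat) (P : pred 'I_n) : #|P| = d ->
  exists e : 'I_d -> 'I_n, [/\ injective e, (forall k, P (e k)) & forall i, P i -> exists k, e k = i].
Proof.
move=> cP; exists (fun k => enum_val (cast_ord (esym cP) k)); split.
- by move=> k k' /enum_val_inj/cast_ord_inj.
- by move=> k; have := enum_valP (cast_ord (esym cP) k).
- move=> i Pi; exists (cast_ord cP (enum_rank_in (Pi : i \in P) i)).
  by rewrite cast_ordK enum_rankK_in.
Qed.

Definition pot_const : R := 4 * (d + d)%:R ^+ 3.
(** Lower bound for the determinant of the second block in coordinates of the first: the inverse
    matrix has entries at most [pot_const]. *)
Definition det_const : R := (d%:R * pot_const) ^- d.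
(** The d-th root of the bound in [rainbow_simplex] for r = 1; that root is linear in r, which will
    be the largest potential. *)
Definition width_const : R :=
  d%:R * (2 * d%:R * (2 * pot_const) * rainbow_tau d (2 * pot_const) 2 (det_const / 2)).
Definition final_const : R := width_const * (pot_const * d.+1%:R).

Variables (S : 'I_(d + d) -> seq ('rV[R]_d * R)) (Rb : 'I_(d + d) -> R) (B Gam del0 : R).
Hypothesis Rb_gt0 : forall i, 0 < Rb i.
Hypothesis B_gt0 : 0 < B.
Hypothesis facets : forall i k, (delta_mx 0 k, Rb i) \in S i /\ (- delta_mx 0 k, Rb i) \in S i.
Hypothesis simplexes : forall i, exists2 Y : 'I_d.+1 -> 'rV[R]_d,
  \det (edges Y) != 0 & forall s, s \in S i -> forall k, 0 <= aval s (Y k).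
Hypothesis small : forall i (Y : 'I_d.+1 -> 'rV[R]_d),
  (forall s, s \in S i -> forall k, 0 <= aval s (Y k)) -> `|\det (edges Y)| <= Gam.
Hypothesis rainbow : forall s : 'I_(d + d) -> 'rV[R]_d * R, (forall i, s i \in S i) ->
  exists Y : 'I_d.+1 -> 'rV[R]_d, [/\ (forall k j, `|Y k 0 j| <= B),
    (forall i k, 0 <= aval (s i) (Y k)) & del0 <= `|\det (edges Y)|].

(** Two opposite facets of the cube have constant sum [2 * Rb i]. *)
Lemma facet_partition i (k : 'I_d) :
  exists q x, unit_partition (S i) q /\ (q x).1 = (2 * Rb i)^-1 *: (delta_mx 0 k : 'rV[R]_d).
Proof.
have [S1 S2] := facets i k; pose c := (2 * Rb i)^-1.
have c0 : 0 <= c by rewrite invr_ge0 mulr_ge0 // ltW.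
have cR : c * Rb i + c * Rb i = 1 by rewrite /c; field; rewrite gt_eqF.
pose q (x : 'I_d.+1) : 'rV[R]_d * R := if x == ord0 then (c *: delta_mx 0 k, c * Rb i)
   else if x == lift ord0 (Ordinal d_gt0) then (c *: - delta_mx 0 k, c * Rb i) else (0, 0).
have ne : lift ord0 (Ordinal d_gt0) != ord0 :> 'I_d.+1 by [].
exists q, ord0; split; last by rewrite /q eqxx.
have sumq (V : nmodType) (F : 'rV[R]_d * R -> V) : F (0, 0) = 0 ->
    \sum_x F (q x) = F (c *: delta_mx 0 k, c * Rb i) + F (c *: - delta_mx 0 k, c * Rb i).
  move=> F0; rewrite (bigD1 ord0) //= (bigD1 (lift ord0 (Ordinal d_gt0))) //=.
  rewrite [X in _ + (_ + X)]big1 ?addr0 => [|x /andP[/negPf x0 /negPf x1]].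
    by rewrite /q eqxx (negPf ne) eqxx.
  by rewrite /q x0 x1.
split.
- move=> x; rewrite /q; case: (x == ord0); first by exists c, (delta_mx 0 k, Rb i).
  case: (x == _); first by exists c, (- delta_mx 0 k, Rb i).
  by exists 0, (delta_mx 0 k, Rb i); rewrite scale0r mul0r.
- by rewrite (sumq _ (fun s => s.1)) //= scalerN subrr.
- by rewrite (sumq _ (fun s => s.2)) //= cR.
Qed.

(** Every slope is offered to both blocks; which colour serves in which block is decided by the
    determinant. *)
Definition color_rows (i : 'I_(d + d)) (v : 'rV[R]_(d + d)) :=
  exists q x, unit_partition (S i) q /\ (v = row_mx (q x).1 0 \/ v = row_mx 0 (q x).1).

Lemma color_rows_bounded : exists C : R, forall i v, color_rows i v -> forall j, `|v 0 j| <= C.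
Proof.
have [C HC] := fin_all_exists (fun i => let: ex_intro2 Y dY SY := simplexes i in partition_bounded dY SY).
exists (\sum_i `|C i|) => i v [q [x [qP vE]]] j.
apply: le_trans (_ : `|C i| <= _); last by rewrite (bigD1 i) //= lerDl sumr_ge0.
apply: le_trans (ler_norm _).
have C0 : 0 <= C i by exact: le_trans (normr_ge0 _) (HC i q qP x (Ordinal d_gt0)).
by case: vE => ->; rewrite mxE; case: splitP => k _; rewrite ?mxE ?normr0 //; exact: HC.
Qed.

Lemma color_rows_full : exists2 X : 'M[R]_(d + d), (forall i, color_rows i (row i X)) & \det X != 0.
Proof.
have Rb2 i : 2 * Rb i != 0 by rewrite mulf_neq0 // gt_eqF.
exists (diag_mx (\row_i (2 * Rb i)^-1)) => [i|]; last first.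
  by rewrite det_diag; apply/prodf_neq0 => i _; rewrite mxE invr_eq0.
have rE : row i (diag_mx (\row_i (2 * Rb i)^-1)) = (2 * Rb i)^-1 *: delta_mx 0 i.
  apply/rowP => j; rewrite !mxE eqxx mulr_natr eq_sym /=.
  by case: (eqVneq j i).
rewrite rE -(fintype.splitK i); case: (fintype.split i) => k /=.
- have [q [x [qP qE]]] := facet_partition (lshift d k) k.
  exists q, x; split=> //; left; rewrite qE; apply/rowP => j; rewrite !mxE.
  case: splitP => j' e; rewrite !mxE ?eqxx /=.
    by congr (_ * _%:R); rewrite -(inj_eq val_inj) /= e.
  case: eqP => [je|_]; rewrite ?mulr0 //.
  by move: e; rewrite je /= => e; have := ltn_ord k; rewrite e ltnNge leq_addr.
- have [q [x [qP qE]]] := facet_partition (rshift d k) k.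
  exists q, x; split=> //; right; rewrite qE; apply/rowP => j; rewrite !mxE.
  case: splitP => j' e; rewrite !mxE ?eqxx /=.
    case: eqP => [je|_]; rewrite ?mulr0 //.
    by move: e; rewrite je /= => e; have := ltn_ord j'; rewrite -e ltnNge leq_addr.
  by congr (_ * _%:R); rewrite -(inj_eq val_inj) /= e eqn_add2l.
Qed.

(** Let G be the first block scaled by its potentials and P the largest potential. [rainbow_simplex]
    bounds |det G| times the determinant of a rainbow simplex by ([width_const] * P)^d, while
    [fit_simplex] puts into the colour of potential P a simplex of determinant (P / (D * (d + 1)))^d
    / |det G|. Both P and det G cancel. *)
Lemma finite_colorful :
  (4 * d.+1%:R ^+ d)^-1 * del0 <= final_const ^+ d * Gam.
Proof.
have [C XC] := color_rows_bounded.
have [X [XX dX [p p0 pX]]] := near_max_potential XC color_rows_full.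
have uX : X \in unitmx by rewrite unitmxE unitfE.
set D : R := 4 * (d + d)%:R ^+ 3 in pX.
have d1 : 1 <= d%:R :> R by rewrite (ler_nat _ 1).
have D1 : 1 <= D.
  have : 1 <= (d + d)%:R :> R by rewrite natrD; lra.
  by move=> /(exprn_ege1 3); rewrite /D; lra.
have exf i : exists z : (('I_d.+1 -> 'rV[R]_d * R) * 'I_d.+1 * bool)%type,
    unit_partition (S i) z.1.1 /\
    row i X = if z.2 then row_mx (z.1.1 z.1.2).1 0 else row_mx 0 (z.1.1 z.1.2).1.
  have [q [x [qP [E|E]]]] := XX i; first by exists (q, x, true).
  by exists (q, x, false).
have [f fP] := fin_all_exists exf.
pose q i := (f i).1.1; pose x0 i := (f i).1.2; pose ty i := (f i).2.
pose u i := (q i (x0 i)).1.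
have qP i : unit_partition (S i) (q i) by case: (fP i).
have XE i : row i X = if ty i then row_mx (u i) 0 else row_mx 0 (u i) by case: (fP i).
have [cT cB] := det_two_types XE dX.
have [eT [eTI eTP eTs]] := enum_pred_inj cT.
have [eB [eBI eBP eBs]] := enum_pred_inj cB.
pose UT : 'M[R]_d := \matrix_k u (eT k); pose UB : 'M[R]_d := \matrix_k u (eB k).
pose JT : 'M[R]_(d, d + d) := row_mx 1%:M 0; pose JB : 'M[R]_(d, d + d) := row_mx 0 1%:M.
have JTE (w : 'rV[R]_d) : w *m JT = row_mx w 0 by rewrite /JT mul_mx_row mulmx1 mulmx0.
have JBE (w : 'rV[R]_d) : w *m JB = row_mx 0 w by rewrite /JB mul_mx_row mulmx1 mulmx0.
have [k|uT cTE] := block_coords eTI uX (_ : forall k, row (eT k) X = row k UT *m JT).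
  by rewrite rowK JTE XE eTP.
have [k|uB cBE] := block_coords eBI uX (_ : forall k, row (eB k) X = row k UB *m JB).
  by rewrite rowK JBE XE (negPf (eBP k)).
have bT i q' (x : 'I_d.+1) k : unit_partition (S i) q' ->
    `|((q' x).1 *m invmx UT) 0 k| * p i <= D * p (eT k).
  by move=> q'P; rewrite -cTE JTE; apply: pX; exists q', x; split=> //; left.
have bB i q' (x : 'I_d.+1) k : unit_partition (S i) q' ->
    `|((q' x).1 *m invmx UB) 0 k| * p i <= D * p (eB k).
  by move=> q'P; rewrite -cBE JBE; apply: pX; exists q', x; split=> //; right.
pose pT k := p (eT k); pose pB k := p (eB k).
have pT0 k : 0 < pT k := p0 _.
have pB0 k : 0 < pB k := p0 _.
pose G := diag_mx (\row_k pT k) *m UT; pose GB := diag_mx (\row_k pB k) *m UB.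
have unitG (r : 'I_d -> R) (U : 'M[R]_d) : (forall k, 0 < r k) -> U \in unitmx ->
    diag_mx (\row_k r k) *m U \in unitmx.
  move=> r0 uU; rewrite unitmx_mul uU andbT unitmxE det_diag unitfE; apply/prodf_neq0 => i _.
  by rewrite mxE gt_eqF.
have uG : G \in unitmx by exact: unitG.
have uGB : GB \in unitmx by exact: unitG.
have nT i x k : `|(p i *: ((q i x).1 *m invmx G)) 0 k| <= D.
  rewrite mxE scaled_coords // normrM (gtr0_norm (p0 i)) normrM normfV (gtr0_norm (pT0 k)).
  by rewrite mulrA ler_pdivrMr // mulrC; exact: bT.
have nB i x k : `|(p i *: ((q i x).1 *m invmx GB)) 0 k| <= D.
  rewrite mxE scaled_coords // normrM (gtr0_norm (p0 i)) normrM normfV (gtr0_norm (pB0 k)).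
  by rewrite mulrA ler_pdivrMr // mulrC; exact: bB.
pose i0 := eT (Ordinal d_gt0); pose im := [arg max_(i > i0) p i]%O; pose P := p im.
have pP i : p i <= P by rewrite /P /im; case: arg_maxP => // j _ /(_ i); exact.
have P0 : 0 < P := p0 _.
pose fu (e : 'I_d -> 'I_(d + d)) k x := p (e k) *: ((q (e k) x).1 *m invmx G).
pose fb (e : 'I_d -> 'I_(d + d)) k x := p (e k) * (q (e k) x).2.
have bal e : balanced (fu e).
  move=> k; rewrite /fu -scaler_sumr -mulmx_suml.
  by have [_ -> _] := qP (e k); rewrite mul0mx scaler0.
have sum_fb e k : \sum_x fb e k x <= P.
  by rewrite /fb -mulr_sumr; have [_ _ ->] := qP (e k); rewrite mulr1.
pose l0 (e : 'I_d -> 'I_(d + d)) : {ffun 'I_d -> 'I_d.+1} := [ffun k => x0 (e k)].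
have rowd (r : 'I_d -> R) (U : 'M[R]_d) k : row k (diag_mx (\row_k r k) *m U) = r k *: row k U.
  by apply/rowP => j; rewrite mul_diag_mx !mxE.
have rT : rain (fu eT) (l0 eT) = G *m invmx G.
  apply/row_matrixP => k; rewrite row_rain row_mul rowd rowK /fu ffunE -scalemxAl.
  by [].
have rB : rain (fu eB) (l0 eB) = GB *m invmx G.
  apply/row_matrixP => k; rewrite row_rain row_mul rowd rowK /fu ffunE -scalemxAl.
  by [].
have dT : 1 <= `|\det (rain (fu eT) (l0 eT))|.
  by rewrite rT mulmxV // det1 normr1.
have DE : pot_const = D by [].
have thE : 0 < det_const by rewrite /det_const DE invr_gt0 exprn_gt0 // mulr_gt0 //; lra.
(* The inverse of this matrix is [G *m invmx GB], whose entries [nB] bounds by D. *)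
have dB : det_const <= `|\det (rain (fu eB) (l0 eB))|.
  have inv : \det (G *m invmx GB) * \det (GB *m invmx G) = 1.
    by rewrite -det_mulmx -mulmxA (mulmxA _ GB) mulVmx // mul1mx mulmxV // det1.
  have le1 : `|\det (G *m invmx GB)| <= (d%:R * D) ^+ d.
    apply: le_trans (det_le_l1 _) _.
    rewrite -[X in _ <= _ ^+ X]card_ord -prodr_const; apply: ler_prod => i _.
    rewrite sumr_ge0 //= mulr_natl -[X in _ <= _ *+ X]card_ord -sumr_const.
    apply: ler_sum => k _; have := nB (eT i) (x0 (eT i)) k.
    have -> : p (eT i) *: ((q (eT i) (x0 (eT i))).1 *m invmx GB) = row i (G *m invmx GB).
      by rewrite row_mul rowd rowK -scalemxAl.
    by rewrite mxE.
  have n1 : `|\det (G *m invmx GB)| * `|\det (GB *m invmx G)| = 1 by rewrite -normrM inv normr1.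
  have a0 : 0 < `|\det (G *m invmx GB)|.
    rewrite normr_gt0; apply/eqP => z; move: inv; rewrite z mul0r => /esym/eqP.
    by rewrite oner_eq0.
  rewrite rB -[leRHS]mul1r -(mulVf (lt0r_neq0 a0)) -mulrA n1 mulr1.
  by rewrite /det_const DE lef_pV2 // posrE // exprn_gt0 // mulr_gt0 //; lra.
pose Bn := B * (\sum_j \sum_k `|G j k|) + 1.
have Bn0 : 0 < Bn.
  have : 0 <= B * (\sum_j \sum_k `|G j k|).
    by apply: mulr_ge0; [exact: ltW|apply: sumr_ge0 => j _; apply: sumr_ge0].
  by rewrite /Bn; lra.
have [lT [lB H]] := rainbow_simplex d_gt0 D1 P0 thE Bn0 (bal eT) (bal eB)
   (fun j x k => nT (eT j) x k) (fun j x k => nT (eB j) x k) (sum_fb eT) (sum_fb eB) dT dB.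
pose x1 i : 'I_d.+1 := if [pick k | eT k == i] is Some k then lT k
   else if [pick k | eB k == i] is Some k then lB k else ord0.
have x1T k : x1 (eT k) = lT k.
  rewrite /x1; case: pickP => [k' /eqP /eTI ->//|/(_ k)]; by rewrite eqxx.
have x1B k : x1 (eB k) = lB k.
  rewrite /x1; case: pickP => [k' /eqP e|_].
    by have := eBP k; rewrite -e /= eTP.
  by case: pickP => [k' /eqP /eBI ->//|/(_ k)]; rewrite eqxx.
have exs i : exists s : ('rV[R]_d * R)%type, s \in S i /\
    exists2 c, 0 <= c & q i (x1 i) = (c *: s.1, c * s.2).
  have [/(_ (x1 i))[c [s [c0 sS E]]] _ _] := qP i.
  by exists s; split=> //; exists c.
have [s sP] := fin_all_exists exs.
have [Y [YB YS YD]] := rainbow (fun i => (sP i).1).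
have Yq i k : dot (q i (x1 i)).1 (Y k) <= (q i (x1 i)).2.
  by have [_ [c c0 ->]] := sP i; rewrite -subr_ge0 -/(aval (_, _) _) aval_cone mulr_ge0 //.
have h1 k i : `|(Y k *m G^T) 0 i| <= Bn.
  rewrite mxE; apply: le_trans (ler_norm_sum _ _ _) _.
  apply: le_trans (_ : B * \sum_j `|G i j| <= _).
    rewrite mulr_sumr; apply: ler_sum => j _; rewrite normrM [G^T _ _]mxE.
    by apply: ler_wpM2r => //; exact: YB.
  rewrite /Bn; apply: le_trans (_ : B * (\sum_j \sum_k `|G j k|) <= _); last by lra.
  rewrite ler_pM2l // [leRHS](bigD1 i) //= lerDl; apply: sumr_ge0 => i' _; exact: sumr_ge0.
have hle e l : (forall k, x1 (e k) = l k) ->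
    forall k i, dot (fu e i (l i)) (Y k *m G^T) <= fb e i (l i).
  move=> xl k i; rewrite /fu dotZl dot_invmx // /fb ler_pM2l //.
  by rewrite -xl; exact: Yq.
have := H (fun k => Y k *m G^T) h1 (hle eT lT x1T) (hle eB lB x1B).
rewrite edges_mul det_mulmx det_tr normrM -/G; move=> {H} hfin.
have g0 : 0 < `|\det G| by rewrite normr_gt0 -unitfE -unitmxE.
(* The longest edges along the dual basis that [fit_simplex] admits: slopes of colour [im] have
   coordinate k at most D * pT k / P. *)
pose wc k := P / (D * d.+1%:R * pT k).
pose w (k : 'I_d.+1) : 'rV[R]_d := if unlift ord0 k is Some j
  then wc j *: row j (invmx UT)^T else 0.
have w0 : w ord0 = 0 by rewrite /w unlift_none.
have wS k : w (lift ord0 k) = wc k *: row k (invmx UT)^T by rewrite /w liftK.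
have D0 : 0 < D by lra.
have dd0 : 0 < d.+1%:R :> R by rewrite ltr0n.
have dotw (a : 'rV[R]_d) k : dot a (row k (invmx UT)^T) = (a *m invmx UT) 0 k.
  by rewrite mxE; apply: eq_bigr => j _; rewrite !mxE.
have wle q' : unit_partition (S im) q' -> forall x k, dot (q' x).1 (w k) <= d.+1%:R^-1.
  move=> q'P x k; rewrite /w; case: unliftP => [j _|_]; last first.
    by rewrite -[0](scale0r 0) dotZr mul0r invr_ge0.
  rewrite dotZr dotw; apply: le_trans (ler_norm _) _.
  have m0 : 0 < D * d.+1%:R * pT j by apply: mulr_gt0 => //; exact: mulr_gt0.
  have wc0 : 0 < wc j by exact: divr_gt0.
  rewrite normrM (gtr0_norm wc0) mulrC /wc mulrA ler_pdivrMr //.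
  have -> : d.+1%:R^-1 * (D * d.+1%:R * pT j) = D * pT j.
    by rewrite -mulrA mulrCA mulKf // lt0r_neq0.
  exact: (bT im q' x j q'P).
have [Y0 dY0 SY0] := simplexes im.
have [|y Sy] := fit_simplex dY0 SY0 _ wle.
  by have [? _] := facets im (Ordinal d_gt0); exists (delta_mx 0 (Ordinal d_gt0), Rb im).
have := small Sy.
have -> : edges (fun k => y + w k) = diag_mx (\row_k wc k) *m (invmx UT)^T.
  apply/row_matrixP => k; rewrite row_edges rowd w0 wS addr0 addrC addKr.
  by [].
rewrite det_mulmx det_tr det_inv det_diag normrM normfV.
have gE : `|\det G| = (\prod_k pT k) * `|\det UT|.
  rewrite /G det_mulmx det_diag normrM; congr (_ * _); rewrite ger0_norm.
    by apply: eq_bigr => k _; rewrite mxE.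
  by apply: prodr_ge0 => k _; rewrite mxE ltW.
have -> : `|\prod_i (\row_k wc k) 0 i| = (P / (D * d.+1%:R)) ^+ d / \prod_k pT k.
  rewrite ger0_norm; last first.
    apply: prodr_ge0 => k _; rewrite mxE; apply: divr_ge0; first exact: ltW.
    by apply: mulr_ge0; [apply: mulr_ge0 => //; exact: ltW|exact: ltW].
  rewrite -[X in _ ^+ X]card_ord -prodr_const -prodfV -big_split /=.
  by apply: eq_bigr => k _; rewrite mxE /wc [in LHS]invfM mulrA.
rewrite -mulrA -invfM -gE ler_pdivrMr // expr_div_n ler_pdivrMr; last first.
  by apply: exprn_gt0; exact: mulr_gt0.
move=> hP.
have E1 : d%:R * (2 * d%:R * (2 * D) * rainbow_tau d (2 * D) (2 * P) (det_const / 2)) = width_const * P.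
  by rewrite /width_const /rainbow_tau DE; ring.
rewrite E1 exprMn in hfin.
have k0 : 0 < (4 * d.+1%:R ^+ d)^-1 :> R by rewrite invr_gt0 mulr_gt0 // exprn_gt0.
have tau0 : 0 <= width_const.
  have sc0 : 0 <= slack_const d (2 * D).
    by apply: mulr_ge0; [exact: exprn_ge0|apply: mulr_ge0 => //; apply: exprn_ge0; lra].
  have th2 : 0 <= 2 + (det_const / 2)^-1.
    by apply: addr_ge0 => //; rewrite invr_ge0 divr_ge0 // ltW.
  by rewrite /width_const DE /rainbow_tau; repeat (apply: mulr_ge0 => //); lra.
rewrite -(ler_pM2r g0); apply: (@le_trans _ _ (width_const ^+ d * P ^+ d)).
  by apply: le_trans hfin; rewrite -mulrA ler_pM2l // ler_wpM2r // ltW.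
apply: le_trans (ler_wpM2l _ hP) _; first by rewrite exprn_ge0.
by rewrite /final_const DE !exprMn le_eqVlt; apply/orP; left; apply/eqP; ring.
Qed.

End FiniteTheorem.

(** * Pushing half-spaces outwards *)

Section Push.
Variables (R : realType) (d : nat).
Implicit Types (Y : 'I_d.+1 -> 'rV[R]_d) (s : 'rV[R]_d * R).

Definition centroid Y := d.+1%:R^-1 *: \sum_k Y k.

Lemma aval_centroid s Y : aval s (centroid Y) = d.+1%:R^-1 * \sum_k aval s (Y k).
Proof.
rewrite /aval /centroid dotZr dot_sumr sumrB mulrBr sumr_const card_ord.
by rewrite -[s.2 *+ _]mulr_natl mulKf ?pnatr_eq0.
Qed.

Lemma aval_mid s x y : aval s (2^-1 *: (x + y)) = (aval s x + aval s y) / 2.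
Proof. by rewrite /aval dotZr dotDr; field. Qed.

Lemma edges_affine Y (a : R) y : edges (fun k => a *: (Y k + y)) = a *: edges Y.
Proof.
by apply/matrixP => k j; rewrite !mxE; ring.
Qed.

(** Cramer's rule in the edges: on an edge the slope equals a difference of two slacks. A function
    with a definite slope is thus not small at all vertices of a large simplex. *)
Lemma slope_le_slack Y (s : 'rV[R]_d * R) (M : R) j : 1 <= M ->
  (forall k, 0 <= aval s (Y k)) -> (forall k i, `|edges Y k i| <= M) ->
  `|s.1 0 j| * `|\det (edges Y)| <= (d%:R * M) ^+ d * \sum_k aval s (Y k).
Proof.
move=> M1 s0 EM; set t := \sum_k _.
have t0 : 0 <= t by exact: sumr_ge0.
rewrite -normrM -(det_tr (edges Y)) -(det_repl_cramer (edges Y)^T j (fun k => s.1 0 k)).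
set z := \sum_k _.
have zE k : `|z 0 k| <= t.
  have -> : z 0 k = aval s (Y ord0) - aval s (Y (lift ord0 k)).
    rewrite /aval opprB addrC addrA subrK -dotBr summxE; apply: eq_bigr => i _.
    by rewrite !mxE.
  have h1 : aval s (Y ord0) <= t by rewrite /t (bigD1 ord0) //= lerDl sumr_ge0.
  have h2 : aval s (Y (lift ord0 k)) <= t by rewrite /t (bigD1 (lift ord0 k)) //= lerDl sumr_ge0.
  by have := s0 ord0; have := s0 (lift ord0 k); rewrite ler_norml; lra.
apply: le_trans (det_le_l1 _) _.
have -> : (d%:R * M) ^+ d * t = \prod_(i < d) (d%:R * ((if i == j then t else 1) * M)).
  rewrite !big_split /= !prodr_const !card_ord -big_mkcond big_pred1_eq exprMn.
  by rewrite -mulrA (mulrC t).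
apply: ler_prod => i _; rewrite sumr_ge0 //= mulr_natl -[X in _ *+ X]card_ord -sumr_const.
apply: ler_sum => k _; rewrite !mxE; case: eqP => _; last by rewrite mul1r; have := EM k i; rewrite !mxE.
by apply: le_trans (zE k) _; rewrite ler_peMr.
Qed.

Lemma slope_bound (S : seq ('rV[R]_d * R)) : (forall s, s \in S -> s.1 != 0) ->
  exists2 m : R, 0 < m & forall s, s \in S -> exists j, m <= `|s.1 0 j|.
Proof.
elim: S => [|s S IH] Sn; first by exists 1.
have [|m m0 Hm] := IH; first by move=> s' s'S; apply: Sn; rewrite inE s'S orbT.
have [j sj] : exists j, s.1 0 j != 0.
  apply/existsP; apply: contraT => /existsPn z; have := Sn s (mem_head _ _).
  by case/negP; apply/eqP/rowP => j; rewrite mxE; have /negPn/eqP := z j.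
exists (Num.min m `|s.1 0 j|); first by rewrite lt_min m0 normr_gt0.
move=> s'; rewrite inE => /orP[/eqP->|/Hm[j' h]].
  by exists j; rewrite ge_min lexx orbT.
by exists j'; rewrite ge_min h.
Qed.

Hypothesis d_gt0 : (0 < d)%N.

Lemma big_simplex (c : R) : exists Y, c <= `|\det (edges Y)|.
Proof.
pose a := 1 + `|c|; have a1 : 1 <= a by rewrite lerDl.
pose Y (k : 'I_d.+1) : 'rV[R]_d := if unlift ord0 k is Some j then a *: delta_mx 0 j else 0.
exists Y; have -> : edges Y = a%:M.
  apply/row_matrixP => k; rewrite row_edges /Y liftK unlift_none subr0.
  by apply/rowP => j; rewrite !mxE eqxx /= [j == k]eq_sym mulr_natr.
rewrite det_scalar ger0_norm ?exprn_ge0 //; last lra.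
apply: le_trans (ler_eXnr d_gt0 a1); rewrite /a.
by have := ler_norm c; lra.
Qed.

(* [rho] is taken just above the least shift that lets a simplex of size [Gam] in; the slack
   of its centroid, bounded below uniformly, prevents much larger simplices. *)
Lemma push (S : seq ('rV[R]_d * R)) (Rb Gam : R) : 0 < Rb -> 0 < Gam ->
  (forall k, (delta_mx 0 k, Rb) \in S /\ (- delta_mx 0 k, Rb) \in S) ->
  (forall s, s \in S -> s.1 != 0) ->
  (forall Y, (forall s, s \in S -> forall k, -1 <= aval s (Y k)) -> `|\det (edges Y)| < Gam) ->
  exists rho, [/\ 0 < rho,
    exists2 Y, Gam <= `|\det (edges Y)| & forall s, s \in S -> forall k, - rho <= aval s (Y k) &
    forall Y, (forall s, s \in S -> forall k, - rho <= aval s (Y k)) ->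
      `|\det (edges Y)| <= 2 ^+ d * Gam].
Proof.
move=> Rb0 Gam0 fac Sn noY.
pose fits (rho : R) Y := forall s, s \in S -> forall k, - rho <= aval s (Y k).
pose P : set R := fun rho => exists2 Y, Gam <= `|\det (edges Y)| & fits rho Y.
have Pgt1 rho : P rho -> 1 < rho.
  move=> [Y GY fY]; rewrite ltNge; apply/negP => r1.
  have := noY Y; rewrite ltNge GY => /(_ _)/negP; apply=> // s sS k.
  by have := fY s sS k; lra.
have hP : has_inf P.
  split; last by exists 1 => rho /Pgt1 /ltW.
  have [Y GY] := big_simplex Gam.
  exists (\sum_(s <- S) \sum_k `|aval s (Y k)|); exists Y => // s sS k.
  apply: le_trans (_ : - `|aval s (Y k)| <= _); last by rewrite lerNl ler_normr lexx orbT.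
  rewrite lerN2 (big_rem s) //= (bigD1 k) //= -addrA lerDl addr_ge0 ?sumr_ge0 //.
  by move=> s' _; rewrite sumr_ge0.
pose r0 := inf P.
have infP e : 0 < e -> exists2 rho, P rho & rho < r0 + e by move=> e0; exact: inf_adherent.
have r0P rho : P rho -> r0 <= rho by apply: ge_inf; case: hP.
have r01 : 1 <= r0 by apply: lb_le_inf; [case: hP|move=> rho /Pgt1 /ltW].
have [m m0 Sm] := slope_bound Sn.
pose M := 2 * (Rb + r0 + 1).
have M1 : 1 <= M by rewrite /M; lra.
pose C := (d%:R * M) ^+ d.
have C0 : 0 < C by rewrite exprn_gt0 // mulr_gt0 ?ltr0n //; lra.
have dd : 0 < d.+1%:R^-1 :> R by rewrite invr_gt0.
(* Lower bound for the slack at the centroid of every fitting simplex of determinant at least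
   Gam. *)
pose kap := Num.min 1 (d.+1%:R^-1 * (m * Gam / C)).
have kap0 : 0 < kap by rewrite lt_min ltr01 !mulr_gt0 // invr_gt0.
have [rho Prho rhoe] := infP (kap / 2) (divr_gt0 kap0 (ltr0n _ 2)).
have kap1 : kap <= 1 by rewrite ge_min lexx.
have rho1 := Pgt1 _ Prho.
exists rho; split; [lra|exact: Prho|] => Y fY; rewrite leNgt; apply/negP => big.
have GY : Gam <= `|\det (edges Y)|.
  by apply: le_trans (ltW big); rewrite ler_peMl ?(ltW Gam0) // exprn_ege1 // ler1n.
have Yb k j : `|Y k 0 j| <= Rb + rho.
  have [/fY/(_ k) h1 /fY/(_ k) h2] := fac j.
  by move: h1 h2; rewrite /aval dotNl dotC dot_delta /= ler_norml; lra.
have EM k i : `|edges Y k i| <= M.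
  rewrite !mxE; apply: le_trans (ler_normB _ _) _.
  by have := Yb (lift ord0 k) i; have := Yb ord0 i; rewrite /M; lra.
have slack s : s \in S -> kap - rho <= aval s (centroid Y).
  move=> sS; have [j mj] := Sm s sS.
  pose s' : 'rV[R]_d * R := (s.1, s.2 + rho).
  have s'E y : aval s' y = aval s y + rho by rewrite /aval /= addrAC.
  have s'0 k : 0 <= aval s' (Y k) by rewrite s'E; have := fY s sS k; lra.
  have := slope_le_slack j M1 s'0 EM; rewrite -/C => h.
  rewrite lerBlDr -s'E aval_centroid; apply: le_trans (_ : d.+1%:R^-1 * (m * Gam / C) <= _).
    by rewrite ge_min lexx orbT.
  rewrite ler_pM2l // ler_pdivrMr // mulrC mulrC -[leRHS]mulrC; apply: le_trans h.
  by rewrite ler_pM // ltW.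
(* Shrinking by half towards the centroid divides the determinant by 2^d and gains kap / 2 in slack
   at every vertex, which leads below the infimum r0. *)
have : P (rho - kap / 2).
  exists (fun k => 2^-1 *: (Y k + centroid Y)).
    have p2 : 0 < 2 ^+ d :> R by rewrite exprn_gt0.
    by rewrite edges_affine detZ exprVn normrM normfV (gtr0_norm p2) ler_pdivlMl // ltW.
  by move=> s sS k; rewrite aval_mid; have := slack s sS; have := fY s sS k; lra.
by move/r0P; lra.
Qed.

End Push.

Import numFieldNormedType.Exports.
Local Open Scope classical_set_scope.
Local Open Scope ring_scope.

(** * Compactness *)

Section Compactness.
Variables (R : realType) (d : nat).
Hypothesis d_gt0 : (0 < d)%N.

Definition simplex_of (v : 'rV[R]_(d.+1 * d)) (k : 'I_d.+1) : 'rV[R]_d := row k (vec_mx v).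

Lemma simplex_ofE v k j : simplex_of v k 0 j = v 0 (mxvec_index k j).
Proof. by rewrite !mxE. Qed.

Lemma simplex_of_onto (Y : 'I_d.+1 -> 'rV[R]_d) : simplex_of (mxvec (\matrix_k Y k)) = Y.
Proof. by apply/funext => k; rewrite /simplex_of mxvecK rowK. Qed.

Lemma det_simplex_continuous : continuous (fun v => \det (edges (simplex_of v))).
Proof.
apply: continuous_big => [|s _]; first exact: add_continuous.
have H : continuous (fun v => \prod_i edges (simplex_of v) i (s i)).
  apply: continuous_big => [|i _]; first exact: mul_continuous.
  rewrite (_ : (fun v => _) = fun v : 'rV[R]_(d.+1 * d) =>
      v 0 (mxvec_index (lift ord0 i) (s i)) - v 0 (mxvec_index ord0 (s i))); last first.
    by apply/funext => v; rewrite !mxE.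
  by move=> v; apply: continuousB; exact: coord_continuous.
by move=> v; exact: (continuousM (@cst_continuous _ _ _ v) (H v)).
Qed.

Lemma aval_simplex_continuous (s : 'rV[R]_d * R) k : continuous (fun v => aval s (simplex_of v k)).
Proof.
have H : continuous (fun v => dot s.1 (simplex_of v k)).
  apply: continuous_big => [|j _]; first exact: add_continuous.
  rewrite (_ : (fun v => _) = fun v : 'rV[R]_(d.+1 * d) => s.1 0 j * v 0 (mxvec_index k j)); last first.
    by apply/funext => v; rewrite simplex_ofE.
  by move=> v; exact: (continuousM (@cst_continuous _ _ _ v) (@coord_continuous R 1 _ 0 _ v)).
by move=> v; exact: (continuousB (@cst_continuous _ _ _ v) (H v)).
Qed.

Lemma cube_compact (C : R) : compact [set v : 'rV[R]_(d.+1 * d) | forall i, `|v 0 i| <= C].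
Proof.
have h : compact [set v : 'rV[R]_(d.+1 * d) | forall i, `[- C, C]%classic (v 0 i)].
  by apply: (@rV_compact R _ (fun=> `[- C, C]%classic)) => _; exact: segment_compact.
rewrite (_ : mkset _ = [set v : 'rV[R]_(d.+1 * d) | forall i, `[- C, C]%classic (v 0 i)]) //.
by apply/seteqP; split=> v /= H i; have := H i; rewrite /= in_itv /= ler_norml.
Qed.

(** Compactness in the space of vertex tuples. The strict thresholds make the covering sets open;
    [None] labels the simplices of small determinant. *)
Lemma finite_halfspaces (D : set ('rV[R]_d * R)) (C Gam : R) :
  (forall Y : 'I_d.+1 -> 'rV[R]_d, Gam <= `|\det (edges Y)| ->
     exists s k, D s /\ aval s (Y k) < -1) ->
  exists S : seq ('rV[R]_d * R), (forall s, s \in S -> D s) /\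
    forall Y : 'I_d.+1 -> 'rV[R]_d, (forall k j, `|Y k 0 j| <= C) ->
      (forall s, s \in S -> forall k, -1 <= aval s (Y k)) -> `|\det (edges Y)| < Gam.
Proof.
move=> HD; pose I : choiceType := option (('rV[R]_d * R) * 'I_d.+1)%type.
pose f (o : I) : set 'rV[R]_(d.+1 * d) := if o is Some x
  then [set v | aval x.1 (simplex_of v x.2) < -1] else [set v | `|\det (edges (simplex_of v))| < Gam].
pose DI : set I := fun o => if o is Some x then D x.1 else True.
have fo i : DI i -> open (f i).
  move=> _; case: i => [[s k]|] /=.
    apply: (@open_comp _ _ (fun v => aval s (simplex_of v k)) [set x | x < -1]); last exact: open_lt.
    by move=> v _; exact: aval_simplex_continuous.
  apply: (@open_comp _ _ (fun v => \det (edges (simplex_of v))) [set x | `|x| < Gam]).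
    by move=> v _; exact: det_simplex_continuous.
  rewrite (_ : mkset _ = [set x | - Gam < x] `&` [set x | x < Gam]).
    by apply: openI; [exact: open_gt|exact: open_lt].
  by apply/seteqP; split=> x /=; rewrite ltr_norml => /andP.
have [E DE cov] : finite_subset_cover DI f [set v : 'rV[R]_(d.+1 * d) | forall i, `|v 0 i| <= C].
  have := @cube_compact C; rewrite compact_cover; apply=> // v _.
  have [lt|ge] := ltP `|\det (edges (simplex_of v))| Gam; first by exists None.
  by have [s [k [Ds sk]]] := HD _ ge; exists (Some (s, k)).
exists (pmap (fun o => omap fst o) (enum_fset E)); split=> [s|Y YC SY].
  rewrite mem_pmap => /mapP[[x|] // xE [->]].
  by have := DE _ xE; rewrite inE.
have [|o /= oE] := cov (mxvec (\matrix_k Y k)).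
  by move=> i; case/mxvec_indexP: i => k j; rewrite mxvecE mxE.
case: o oE => [[s k]|] /= oE; rewrite simplex_of_onto // => lt.
have sS : s \in pmap (fun o => omap fst o) (enum_fset E).
  by rewrite mem_pmap; apply/mapP; exists (Some (s, k)).
by have := SY s sS k; rewrite leNgt lt.
Qed.

(** Members need be neither closed nor bounded. The conclusion is therefore stated through
    half-spaces containing the part of a member inside the cube of size B, where the rainbow
    simplices lie. *)
Lemma colorful_body (F : 'I_(d + d) -> set (set 'rV[R]_d)) (B del0 Gam : R) :
  0 < B -> 0 < Gam -> (forall i, F i !=set0) ->
  (forall G, (forall i, F i (G i)) -> exists Y : 'I_d.+1 -> 'rV[R]_d,
    [/\ forall k j, `|Y k 0 j| <= B, forall i k, G i (Y k) & del0 <= `|\det (edges Y)|]) ->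
  final_const R d ^+ d * (2 ^+ d * Gam) < (4 * d.+1%:R ^+ d)^-1 * del0 ->
  exists i (Y : 'I_d.+1 -> 'rV[R]_d), Gam <= `|\det (edges Y)| /\
    forall A s, F i A -> (forall y, A y -> (forall j, `|y 0 j| <= B) -> 0 <= aval s y) ->
      forall k, 0 <= aval s (Y k).
Proof.
move=> B0 Gam0 F0 rb small; apply: contrapT => no.
have [G0 G0P] := choice F0.
have inh i A : F i A -> exists2 y, A y & forall j, `|y 0 j| <= B.
  move=> FA; have [|Y [YB YG _]] := rb (fun j => if j == i then A else G0 j).
    by move=> j; case: eqP => [->|].
  by exists (Y ord0) => //; have := YG i ord0; rewrite eqxx.
pose av i (s : 'rV[R]_d * R) := exists2 A, F i A &
  forall y, A y -> (forall j, `|y 0 j| <= B) -> 0 <= aval s y.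
pose D i s := s.1 != 0 /\ av i s.
have HD i (Y : 'I_d.+1 -> 'rV[R]_d) : Gam <= `|\det (edges Y)| ->
    exists s k, D i s /\ aval s (Y k) < -1.
  move=> GY; apply: contrapT => H; apply: no; exists i, Y; split=> // A s FA sA k.
  rewrite leNgt; apply/negP => neg; apply: H.
  (* Positive multiples define the same half-space; this one makes the violation equal to -2, safely
     below -1. *)
  pose c := - 2 / aval s (Y k).
  have c0 : 0 < c by rewrite nmulr_rgt0 ?invr_lt0 //; lra.
  exists (c *: s.1, c * s.2), k; split; last by rewrite aval_cone /c divfK ?lt_eqF //; lra.
  split; last by exists A => // y Ay yB; rewrite aval_cone; apply: mulr_ge0; [exact: ltW|exact: sA].
  rewrite scaler_eq0 gt_eqF //=; apply/eqP => s0.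
  have [y Ay yB] := inh i A FA; have := sA y Ay yB; move: neg.
  by rewrite /aval s0 !dot0l; lra.
(* B + 1 because facets violated by at most 1 still confine Y to the cube of that size. *)
have exS i : exists S : seq ('rV[R]_d * R), (forall s, s \in S -> D i s) /\
    forall Y : 'I_d.+1 -> 'rV[R]_d, (forall k j, `|Y k 0 j| <= B + 1) ->
      (forall s, s \in S -> forall k, -1 <= aval s (Y k)) -> `|\det (edges Y)| < Gam.
  exact: (@finite_halfspaces (D i) (B + 1) Gam (HD i)).
have facD i k : D i (delta_mx 0 k, B) /\ D i (- delta_mx 0 k, B).
  have [A FA] := F0 i.
  have e0 : delta_mx 0 k != 0 :> 'rV[R]_d.
    by apply/eqP => /rowP/(_ k); rewrite !mxE !eqxx => /eqP; rewrite oner_eq0.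
  split; split; rewrite ?oppr_eq0 //; exists A => // y _ /(_ k).
    by rewrite /aval dotC dot_delta ler_norml /=; lra.
  by rewrite /aval dotNl dotC dot_delta ler_norml /=; lra.
have exT i : exists z : seq ('rV[R]_d * R) * R,
    [/\ 0 < z.2, forall s, s \in z.1 -> D i s,
      forall k, (delta_mx 0 k, B) \in z.1 /\ (- delta_mx 0 k, B) \in z.1,
      exists2 Y : 'I_d.+1 -> 'rV[R]_d, Gam <= `|\det (edges Y)| &
        forall s, s \in z.1 -> forall k, - z.2 <= aval s (Y k) &
      forall Y : 'I_d.+1 -> 'rV[R]_d, (forall s, s \in z.1 -> forall k, - z.2 <= aval s (Y k)) ->
        `|\det (edges Y)| <= 2 ^+ d * Gam].
  have [S [SD SY]] := exS i.
  pose S1 := [seq (delta_mx 0 k, B) | k <- enum 'I_d] ++ [seq (- delta_mx 0 k, B) | k <- enum 'I_d] ++ S.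
  have fac1 k : ((delta_mx 0 k : 'rV[R]_d), B) \in S1 /\ (- (delta_mx 0 k : 'rV[R]_d), B) \in S1.
    split; rewrite !mem_cat; apply/orP; first by left; rewrite map_f // mem_enum.
    by right; rewrite map_f // mem_enum.
  have S1D s : s \in S1 -> D i s.
    rewrite !mem_cat => /orP[/mapP[k _ ->]|/orP[/mapP[k _ ->]|/SD//]];
      by have [] := facD i k.
  have [|Y H|rho [rho0 h1 h2]] := push d_gt0 B0 Gam0 fac1.
  - by move=> s /S1D[].
  - apply: SY => [k j|s sS]; last by apply: H; rewrite !mem_cat sS !orbT.
    have [/H/(_ k) h1 /H/(_ k)] := fac1 j; move: h1.
    by rewrite /aval dotNl dotC dot_delta /= ler_norml; lra.
  by exists (S1, rho).
have [z zP] := choice exT.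
pose sh i (s : 'rV[R]_d * R) := (s.1, s.2 + (z i).2).
have shE i s y : aval (sh i s) y = aval s y + (z i).2 by rewrite /aval /= addrAC.
suff : (4 * d.+1%:R ^+ d)^-1 * del0 <= final_const R d ^+ d * (2 ^+ d * Gam) by rewrite leNgt small.
apply: (@finite_colorful _ _ d_gt0 (fun i => map (sh i) (z i).1) (fun i => B + (z i).2) B) => //.
- by move=> i; have [? _ _ _ _] := zP i; exact: addr_gt0.
- move=> i k; have [_ _ fac _ _] := zP i; have [h1 h2] := fac k.
  by split; [apply: (map_f (sh i) h1)|apply: (map_f (sh i) h2)].
- move=> i; have [_ _ _ [Y GY fY] _] := zP i; exists Y.
    by rewrite -normr_gt0; exact: lt_le_trans GY.
  by move=> _ /mapP[s sS ->] k; rewrite shE; have := fY s sS k; lra.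
- move=> i Y H; have [_ _ _ _ -> //] := zP i.
  by move=> s sS k; have := H _ (map_f (sh i) sS) k; rewrite shE; lra.
- move=> s' s'S.
  have ex i : exists p : (('rV[R]_d * R) * set 'rV[R]_d)%type, [/\ s' i = sh i p.1, F i p.2 &
      forall y, p.2 y -> (forall j, `|y 0 j| <= B) -> 0 <= aval p.1 y].
    have [s sS E] := mapP (s'S i); have [_ /(_ s sS)[_ [A FA sA]] _ _ _] := zP i.
    by exists (s, A).
  have [p pP] := choice ex.
  have [|Y [YB YG dY]] := rb (fun i => (p i).2); first by move=> i; have [] := pP i.
  exists Y; split=> // i k; have [-> _ /(_ (Y k) (YG i k) (YB k)) h] := pP i.
  by rewrite shE addr_ge0 //; have [/ltW] := zP i.
Qed.

End Compactness.

(** * Separation *)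

Section Vcons.
Variables (R : realType) (d : nat).
Implicit Types (x : 'rV[R]_d) (y : 'rV[R]_d.+1) (t : R).

Definition vcons t x : 'rV[R]_d.+1 := \row_k oapp (fun j => x 0 j) t (unlift ord0 k).
Definition vtail y : 'rV[R]_d := \row_k y 0 (lift ord0 k).

Lemma vcons0 t x : vcons t x 0 ord0 = t. Proof. by rewrite mxE unlift_none. Qed.
Lemma vconsS t x k : vcons t x 0 (lift ord0 k) = x 0 k. Proof. by rewrite mxE liftK. Qed.
Lemma vcons_eta y : vcons (y 0 ord0) (vtail y) = y.
Proof.
apply/rowP => k; rewrite mxE; case: unliftP => [j ->|->] //=; by rewrite mxE.
Qed.
Lemma vcons_lin a b t t' x x' :
  a *: vcons t x + b *: vcons t' x' = vcons (a * t + b * t') (a *: x + b *: x').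
Proof. by apply/rowP => k; rewrite !mxE; case: unliftP => [j _|_] /=; rewrite ?mxE. Qed.
Lemma dot_vcons t x t' x' : dot (vcons t x) (vcons t' x') = t * t' + dot x x'.
Proof.
rewrite /dot big_ord_recl !vcons0; congr (_ + _); apply: eq_bigr => k _.
by rewrite !vconsS.
Qed.

End Vcons.

Section Separation.
Variable R : realType.

Definition convex_closed d (C : set 'rV[R]_d) := forall x y (a b : R), C x -> C y ->
  0 <= a -> 0 <= b -> a + b = 1 -> C (a *: x + b *: y).

Lemma convex_setE d (A : set 'rV[R]_d) : @convex_set R 'rV[R]_d A -> convex_closed A.
Proof.
move=> cA x y a b Ax Ay a0 b0 ab.
have a1 : a <= 1 by rewrite -ab lerDl.
have := cA x y (Itv01 a0 a1); rewrite !inE => /(_ Ax Ay).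
by have -> : b = 1 - a by rewrite -ab addrC addKr.
Qed.

(** No topology is assumed on C, so the separation is weak. Unless C lies on one side of the
    coordinate hyperplane, a normal u of its slice is extended by one coefficient. *)
Lemma convex_separation d (C : set 'rV[R]_d) : convex_closed C -> ~ C 0 ->
  (forall x, ~ C x) \/ exists2 u, u != 0 & forall x, C x -> 0 <= dot u x.
Proof.
elim: d C => [|d IH] C cC C0; first by left=> x; rewrite thinmx0.
pose C' x := C (vcons 0 x).
have v0 : vcons 0 0 = 0 :> 'rV[R]_d.+1.
  by apply/rowP => k; rewrite !mxE; case: unliftP => [j _|_] /=; rewrite ?mxE.
have cC' : convex_closed C'.
  move=> x y a b Cx Cy a0 b0 ab; have := cC _ _ a b Cx Cy a0 b0 ab.
  by rewrite vcons_lin !mulr0 addr0.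
have C'0 : ~ C' 0 by rewrite /C' v0.
have dot1 t (y : 'rV[R]_d.+1) : dot (vcons t 0) y = t * y 0 ord0.
  by rewrite -[y in LHS]vcons_eta dot_vcons dot0l addr0.
have n1 (t : R) : t != 0 -> vcons t 0 != 0 :> 'rV[R]_d.+1.
  by apply: contra => /eqP/rowP/(_ ord0); rewrite vcons0 mxE => ->.
have [[p Cp p0]|np] := pselect (exists2 y, C y & 0 < y 0 ord0); last first.
  right; exists (vcons (-1) 0) => [|x Cx]; first by rewrite n1 // oppr_eq0 oner_eq0.
  by rewrite dot1 mulN1r oppr_ge0 leNgt; apply/negP => x0; apply: np; exists x.
have [[q Cq q0]|nq] := pselect (exists2 y, C y & y 0 ord0 < 0); last first.
  right; exists (vcons 1 0) => [|x Cx]; first by rewrite n1 // oner_eq0.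
  by rewrite dot1 mul1r leNgt; apply/negP => x0; apply: nq; exists x.
have mix x y : C x -> C y -> 0 < x 0 ord0 -> y 0 ord0 < 0 ->
    C' ((- y 0 ord0 / (x 0 ord0 - y 0 ord0)) *: vtail x + (x 0 ord0 / (x 0 ord0 - y 0 ord0)) *: vtail y).
  move=> Cx Cy; rewrite -{1}(vcons_eta x) in Cx; rewrite -{1}(vcons_eta y) in Cy.
  move: (x 0 ord0) (y 0 ord0) Cx Cy => t r Cx Cy t0 r0.
  have tr : 0 < t - r by lra.
  have := cC _ _ (- r / (t - r)) (t / (t - r)) Cx Cy; rewrite vcons_lin.
  have -> : - r / (t - r) * t + t / (t - r) * r = 0 by (field; rewrite gt_eqF).
  by move=> h; apply: h; [apply: divr_ge0; lra|apply: divr_ge0; lra|field; rewrite gt_eqF].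
have [/(_ _ (mix _ _ Cp Cq p0 q0)) //|[u u0 uC]] := IH C' cC' C'0.
(* Points on the positive side bound the missing coefficient from below, those on the negative side
   from above; the bounds are compatible because a segment between the two sides meets the slice. *)
pose P : set R := fun a => exists y, [/\ C y, 0 < y 0 ord0 & a = - dot u (vtail y) / y 0 ord0].
have PU y : C y -> y 0 ord0 < 0 -> ubound P (dot u (vtail y) / - y 0 ord0).
  move=> Cy y0 _ [x [Cx x0 ->]]; have := uC _ (mix _ _ Cx Cy x0 y0).
  rewrite dotDr !dotZr; move: (dot u _) (dot u _) x0 y0.
  move: (x 0 ord0) (y 0 ord0) => t r b a t0 r0 h.
  have tr : 0 < t - r by lra.
  have rn : 0 < - r by lra.
  rewrite ler_pdivrMr // mulrAC ler_pdivlMr //.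
  have : 0 <= (- r / (t - r) * a + t / (t - r) * b) * (t - r) by rewrite mulr_ge0 // ltW.
  have -> : (- r / (t - r) * a + t / (t - r) * b) * (t - r) = - r * a + t * b by (field; rewrite gt_eqF).
  by lra.
have hP : P !=set0 by exists (- dot u (vtail p) / p 0 ord0), p.
right; exists (vcons (sup P) u).
  apply: contra u0 => /eqP E; apply/eqP/rowP => k.
  by move/rowP/(_ (lift ord0 k)): E; rewrite vconsS !mxE.
move=> y Cy; rewrite -[y]vcons_eta dot_vcons.
have [y0|y0|y0] := ltgtP (y 0 ord0) 0.
- have : sup P <= dot u (vtail y) / - y 0 ord0 by apply: ge_sup => //; exact: PU.
  by rewrite ler_pdivlMr; lra.
- have : - dot u (vtail y) / y 0 ord0 <= sup P.
    by apply: ub_le_sup; [exists (dot u (vtail q) / - q 0 ord0); exact: PU|exists y].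
  by rewrite ler_pdivrMr //; lra.
- by rewrite y0 mulr0 add0r; apply: uC; rewrite /C' -y0 vcons_eta.
Qed.

(** Separate A from the interior point. A function nonnegative at all vertices whose mean with
    positive weights is zero vanishes at each of them, hence on all edges, so its slope would be
    zero. *)
Lemma simplex_separation d (A : set 'rV[R]_d) (Y : 'I_d.+1 -> 'rV[R]_d) (t : 'I_d.+1 -> R) :
  convex_closed A -> \det (edges Y) != 0 -> (forall k, 0 < t k) -> \sum_k t k = 1 ->
  ~ A (\sum_k t k *: Y k) ->
  exists s, (forall x, A x -> 0 <= aval s x) /\ exists k, aval s (Y k) < 0.
Proof.
move=> cA dY t0 t1; set y := \sum_k _ => nAy.
have [||emp|[u u0 uC]] := @convex_separation d (fun x => A (x + y)).
- move=> x x' a b Ax Ax' a0 b0 ab /=; have := cA _ _ a b Ax Ax' a0 b0 ab.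
  by rewrite !scalerDr addrACA -scalerDl ab scale1r.
- by rewrite add0r.
(* An empty A is cut off by the constant -1. *)
- exists (0, -1); split=> [x Ax|]; first by case: (emp (x - y)); rewrite subrK.
  by exists ord0; rewrite /aval dot0l /= subr0 ltrN10.
exists (- u, - dot u y); have E x : aval (- u, - dot u y) x = dot u (x - y).
  by rewrite /aval dotNl opprK dotBr addrC.
split=> [x Ax|]; first by rewrite E; apply: uC; rewrite subrK.
apply: contrapT => H; case/negP: u0.
have pos k : 0 <= dot u (Y k - y) by rewrite -E leNgt; apply/negP => h; apply: H; exists k.
have z : \sum_k t k * dot u (Y k - y) = 0.
  under eq_bigr do rewrite dotBr mulrBr -dotZr.
  by rewrite sumrB -dot_sumr -mulr_suml t1 mul1r subrr.
have z0 k : dot u (Y k - y) = 0.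
  have /psumr_eq0P/(_ k erefl)/eqP := z; rewrite mulf_eq0 gt_eqF //= => h.
  by apply/eqP/h => i _; rewrite mulr_ge0 // ltW.
have uY : (edges Y)^T \in unitmx by rewrite unitmx_tr unitmxE unitfE.
rewrite -[u](mulmxK uY) (_ : u *m (edges Y)^T = 0) ?mul0mx //.
apply/rowP => k; rewrite !mxE; transitivity (dot u (Y (lift ord0 k) - y) - dot u (Y ord0 - y)).
  by rewrite -dotBr opprB addrA subrK; apply: eq_bigr => j _; rewrite !mxE.
by rewrite !z0 subrr.
Qed.

(** The d coordinates of c change the weight of vertex 0 by at most d / (d + 1)^2 in total, less
    than its weight 1 / (d + 1) in the centroid. *)
Lemma core_weights d (Y : 'I_d.+1 -> 'rV[R]_d) (c : 'rV[R]_d) :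
  (forall j, `|c 0 j| <= d.+1%:R ^- 2) ->
  exists t : 'I_d.+1 -> R, [/\ forall k, 0 < t k, \sum_k t k = 1 &
    centroid Y + c *m edges Y = \sum_k t k *: Y k].
Proof.
move=> cb; have d0 : 0 < d.+1%:R :> R by rewrite ltr0n.
have cS : `|\sum_j c 0 j| < d.+1%:R^-1.
  apply: le_lt_trans (ler_norm_sum _ _ _) _.
  apply: le_lt_trans (_ : \sum_(j < d) d.+1%:R ^- 2 < _); first exact: ler_sum.
  rewrite sumr_const card_ord -[ltLHS]mulr_natr expr2 invfM -mulrA gtr_pMr ?invr_gt0 //.
  by rewrite mulrC ltr_pdivrMr // mul1r ltr_nat.
set S := \sum_j c 0 j in cS.
exists (fun k => d.+1%:R^-1 + oapp (fun j => c 0 j) (- S) (unlift ord0 k)); split.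
- move=> k; case: unliftP => [j _|_] /=; last by rewrite subr_gt0; move: cS; rewrite ltr_norml => /andP[].
  have := cb j; rewrite ler_norml => /andP[h _].
  have dpos : (0 < d)%N := leq_ltn_trans (leq0n _) (ltn_ord j).
  rewrite -(opprK (c 0 j)) subr_gt0; apply: le_lt_trans (_ : d.+1%:R ^- 2 < _); first by rewrite lerNl.
  by rewrite ltf_pV2 ?posrE ?exprn_gt0 // expr2 ltr_pMr // ltr1n ltnS.
- rewrite big_split /= sumr_const card_ord -[_ *+ _ in X in X + _]mulr_natr mulVf ?gt_eqF //.
  rewrite big_ord_recl unlift_none /=; under eq_bigr do rewrite liftK /=.
  by rewrite -/S addNr addr0.
- under eq_bigr do rewrite scalerDl.
  rewrite big_split /= -scaler_sumr; congr (_ + _).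
  rewrite big_ord_recl unlift_none /=; under eq_bigr do rewrite liftK /=.
  rewrite scaleNr /S scaler_suml addrC -sumrB mulmx_sum_row; apply: eq_bigr => j _.
  by rewrite row_edges scalerBr.
Qed.

End Separation.

(** * Outer volume: upper bounds *)

Section VolBasics.
Variables (R : realType) (d : nat).
Implicit Types (A B : set 'rV[R]_d) (a b : 'rV[R]_d).

Lemma box_vol_ge0 a b : (forall i, a 0 i <= b 0 i) -> 0 <= box_vol a b.
Proof. by move=> ab; apply: prodr_ge0 => i _; rewrite subr_ge0. Qed.

Lemma vol_le_cover A (a b : nat -> 'rV[R]_d) : box_cover A a b ->
  (vol A <= \sum_(0 <= n <oo) (box_vol (a n) (b n))%:E)%E.
Proof. by move=> ab; apply: ereal_inf_lbound; exists a, b. Qed.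

Lemma vol_ge0 A : (0 <= vol A)%E.
Proof.
apply: le_ereal_inf_tmp => _ [a [b [[ab _] ->]]]; apply: nneseries_ge0 => n _ _.
by rewrite lee_fin box_vol_ge0.
Qed.

Lemma vol_mono A B : A `<=` B -> (vol A <= vol B)%E.
Proof.
move=> AB; apply: le_ereal_inf_tmp => _ [a [b [[ab cov] ->]]].
by apply: vol_le_cover; split=> //; apply: subset_trans cov.
Qed.

Lemma vol_approx A (v e : R) : (vol A <= v%:E)%E -> 0 < e ->
  exists a b : nat -> 'rV[R]_d, box_cover A a b /\ (\sum_(0 <= n <oo) (box_vol (a n) (b n))%:E <= (v + e)%:E)%E.
Proof.
move=> Av e0; have fin : vol A \is a fin_num.
  by rewrite ge0_fin_numE ?vol_ge0 // (le_lt_trans Av) // ltry.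
have [_ [a [b [cov ->]]] lt] := lb_ereal_inf_adherent e0 fin.
exists a, b; split=> //; apply: (le_trans (ltW lt)).
by rewrite EFinD leeD2r.
Qed.

Lemma vol_bigcup (A : nat -> set 'rV[R]_d) (v : nat -> R) :
  (forall n, (vol (A n) <= (v n)%:E)%E) ->
  (vol (\bigcup_n A n) <= \sum_(0 <= n <oo) (v n)%:E)%E.
Proof.
move=> Av; have v0 n : (0 <= (v n)%:E)%E := le_trans (vol_ge0 _) (Av n).
apply/lee_addgt0Pr => e e0.
apply: le_trans (epsilon_trick _ v0 (ltW e0)).
have ex n : exists ab : (nat -> 'rV[R]_d) * (nat -> 'rV[R]_d), box_cover (A n) ab.1 ab.2 /\
   (\sum_(0 <= k <oo) (box_vol (ab.1 k) (ab.2 k))%:E <= (v n + e / (2 ^ n.+1)%:R)%:E)%E.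
  have [|a [b H]] := vol_approx (Av n) (_ : 0 < e / (2 ^ n.+1)%:R); last by exists (a, b).
  by rewrite divr_gt0 // ltr0n expn_gt0.
have [G GP] := choice ex.
have /card_esym/ppcard_eqP[f] := card_nat2.
pose F (x : nat * nat) : \bar R := (box_vol ((G x.1).1 x.2) ((G x.1).2 x.2))%:E.
have F0 x : (0 <= F x)%E by rewrite lee_fin box_vol_ge0 //; have [[]] := GP x.1.
apply: (@le_trans _ _ (\sum_(0 <= n <oo) F (f n))%E).
  apply: (@vol_le_cover _ (fun n => (G (f n).1).1 (f n).2) (fun n => (G (f n).1).2 (f n).2)).
  split=> [n i|x [n _ /(GP n).1.2[k _ xk]]]; first by have [[]] := GP (f n).1.
  by exists (f^-1%FUN (n, k)) => //=; rewrite invK ?inE.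
rewrite nneseries_esumT // -(@reindex_esum _ _ _ setT setT f) //.
have -> : [set: nat * nat] = [set: nat] `*`` (fun=> setT) by apply/seteqP; split.
rewrite -(@esum_esum _ _ _ _ _ (fun i j => F (i, j))) //.
rewrite -nneseries_esumT => [|n]; last by apply: esum_ge0 => k _; exact: (F0 (n, k)).
apply: lee_nneseries => n _; first by move=> _; apply: esum_ge0 => k _; exact: (F0 (n, k)).
by rewrite -nneseries_esumT //; exact: (GP n).2.
Qed.

Lemma vol_bigcup0 (A : nat -> set 'rV[R]_d) : (forall n, (vol (A n) <= 0)%E) ->
  (vol (\bigcup_n A n) <= 0)%E.
Proof. by move=> A0; apply: le_trans (vol_bigcup A0) _; rewrite eseries0. Qed.

End VolBasics.

Section FiniteCover.
Variables (R : realType) (d : nat).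

(** The sequence is completed by degenerate boxes, whose volume is zero because the dimension is
    positive. *)
Lemma vol_finite_cover (A : set 'rV[R]_d.+1) N (a b : nat -> 'rV[R]_d.+1) :
  (forall n i, a n 0 i <= b n 0 i) ->
  (forall x, A x -> exists2 n, (n < N)%N & box (a n) (b n) x) ->
  (vol A <= (\sum_(n < N) box_vol (a n) (b n))%:E)%E.
Proof.
move=> ab cov; pose b' n := if (n < N)%N then b n else a n.
apply: (@le_trans _ _ (\sum_(0 <= n <oo) (box_vol (a n) (b' n))%:E)%E).
  apply: vol_le_cover; split=> [n i|x /cov[n nN bx]]; first by rewrite /b'; case: ifP.
  by exists n => //; rewrite /b' nN.
have z n : (N <= n)%N -> (box_vol (a n) (b' n))%:E = 0%E.
  by move=> nN; rewrite /b' ltnNge nN /= /box_vol big_ord_recl subrr mul0r.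
rewrite (nneseries_split _ N) => [|n _]; last first.
  by rewrite lee_fin box_vol_ge0 // => i; rewrite /b'; case: ifP.
rewrite add0n [X in (_ + X)%E]eseries0 ?adde0 => [|n nN _]; last exact: z.
rewrite big_mkord sumEFin lee_fin; apply: ler_sum => n _.
by rewrite /b' ltn_ord.
Qed.

Lemma vol_le_box (A : set 'rV[R]_d.+1) (a b : 'rV[R]_d.+1) :
  (forall i, a 0 i <= b 0 i) -> A `<=` box a b -> (vol A <= (box_vol a b)%:E)%E.
Proof.
move=> ab cov; have := @vol_finite_cover A 1 (fun=> a) (fun=> b) (fun=> ab).
by rewrite big_ord1; apply=> x /cov; exists 0%N.
Qed.

Lemma vol_empty : (vol (set0 : set 'rV[R]_d.+1) <= 0)%E.
Proof.
have := @vol_finite_cover set0 0 (fun=> 0) (fun=> 0).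
by rewrite big_ord0; apply.
Qed.

End FiniteCover.

(** * Shears and projections *)

Section Project.
Variables (R : realType) (d : nat).

Lemma det_vcons (P : 'M[R]_d.+1) (h : R) (Q : 'M[R]_d) : row ord0 P = vcons h 0 ->
  (forall k, vtail (row (lift ord0 k) P) = row k Q) -> \det P = h * \det Q.
Proof.
move=> P0 PQ; have Pe j : P ord0 j = vcons h 0 0 j by rewrite -P0 mxE.
rewrite (expand_det_row _ ord0) (bigD1 ord0) //= big1 ?addr0 => [|j j0].
  rewrite Pe vcons0 /cofactor addn0 expr0 mul1r; congr (_ * \det _).
  apply/matrixP => i j; rewrite !mxE.
  by have /rowP/(_ j) := PQ i; rewrite !mxE.
by rewrite Pe; case: (unliftP ord0 j) j0 => [j' ->|->] //; rewrite vconsS mxE mul0r.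
Qed.

(** Column operations clear row 0 except for h and project the other rows along (h, w). *)
Lemma det_project (M : 'M[R]_d.+1) (w : 'rV[R]_d) (h : R) : h != 0 -> row ord0 M = vcons h w ->
  \det M = h * \det (\matrix_k (vtail (row (lift ord0 k) M) - (M (lift ord0 k) ord0 / h) *: w)).
Proof.
move=> h0 M0; pose u : 'rV[R]_d.+1 := vcons 0 (h^-1 *: w).
pose Sh : 'M[R]_d.+1 := \matrix_(i, j) ((i == j)%:R - (i == ord0)%:R * u 0 j).
have dS : \det Sh = 1.
  rewrite -det_tr det_trig => [|]; last first.
    apply/is_trig_mxP => i j ij; rewrite 2!mxE; have -> : (j == i) = false.
      by apply/eqP => e; move: ij; rewrite e ltnn.
    have -> : (j == ord0) = false by apply/eqP => e; move: ij; rewrite e.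
    by rewrite mul0r subrr.
  apply: big1 => i _; rewrite 2!mxE eqxx; have [->|] := eqVneq i ord0.
    by rewrite vcons0 mulr0 subr0.
  by rewrite mul0r subr0.
have ME i j : (M *m Sh) i j = M i j - M i ord0 * u 0 j.
  rewrite mxE; under eq_bigr do rewrite [Sh _ _]mxE mulrBr.
  rewrite sumrB (bigD1 j) //= eqxx mulr1 big1 ?addr0 => [|k /negPf->]; last by rewrite mulr0.
  congr (_ - _); rewrite (bigD1 ord0) //= mul1r big1 ?addr0 // => k /negPf->.
  by rewrite mul0r mulr0.
rewrite -[LHS]mulr1 -{1}dS -det_mulmx; apply: det_vcons => [|k].
  have Me j : M ord0 j = vcons h w 0 j by rewrite -M0 mxE.
  apply/rowP => j; rewrite mxE ME !Me vcons0 /u.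
  case: (unliftP ord0 j) => [j' ->|->]; last by rewrite !vcons0 mulr0 subr0.
  by rewrite !vconsS !mxE mulrA divff // mul1r subrr.
apply/rowP => j; rewrite rowK mxE [row _ _ _ _]mxE ME vconsS !mxE.
by rewrite mulrA.
Qed.

End Project.

Section Shear.
Variables (R : realType) (d : nat).

(** An oblique cylinder over X with axis (h, w), cut to parameters of length L. *)
Definition sheared (X : set 'rV[R]_d) (w : 'rV[R]_d) (c h s0 L : R) : set 'rV[R]_d.+1 :=
  [set x | exists y s, [/\ X y, s0 < s <= s0 + L & x = vcons (c + s * h) (y + s *: w)]].

Lemma step_cover (t D : R) N : 0 < t <= N%:R * D ->
  exists2 n, (n < N)%N & n%:R * D < t <= n.+1%:R * D.
Proof.
elim: N => [|N IH] /andP[t0 tN]; first by move: tN; rewrite mul0r; lra.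
have [tl|tl] := leP t (N%:R * D); last by exists N; rewrite ?tl.
by have [|n nN h] := IH; [rewrite t0|exists n => //; exact: ltnW].
Qed.

(** Cut into N layers of thickness D; within a layer the cross-section moves by at most D * |w_i| in
    coordinate i, so a box enlarged by that much on both sides covers it. The enlarged volume is a
    polynomial in D, continuous at 0. *)
Lemma vol_shear_box (a b w : 'rV[R]_d) (c h s0 L : R) : 0 < h -> 0 <= L ->
  (forall i, a 0 i <= b 0 i) -> (vol (sheared (box a b) w c h s0 L) <= (h * L * box_vol a b)%:E)%E.
Proof.
move=> h0 L0 ab; have V0 := box_vol_ge0 ab.
apply/lee_addgt0Pr => e e0; rewrite -EFinD.
have hL : 0 < h * L + 1 by rewrite ltr_pwDr // mulr_ge0 // ltW.
pose p : {poly R} := \prod_i ((b 0 i - a 0 i)%:P + (2 * `|w 0 i|)%:P * 'X).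
have pE x : p.[x] = \prod_i (b 0 i - a 0 i + 2 * `|w 0 i| * x).
  by rewrite horner_prod; apply: eq_bigr => i _; rewrite !hornerE.
have p0 : p.[0] = box_vol a b by rewrite pE; apply: eq_bigr => i _; rewrite mulr0 addr0.
have [x0 x00 Hx] := @poly_close R p (e / (h * L + 1)) (divr_gt0 e0 hL).
pose N := (Num.bound (L / x0)).+1; have [D DE] : exists D, D = L / N%:R by exists (L / N%:R).
have N0 : 0 < N%:R :> R by rewrite ltr0n.
have DN : N%:R * D = L by rewrite DE mulrC divfK // gt_eqF.
have D0 : 0 <= D by rewrite DE divr_ge0 // ltW.
have Dx : D <= x0.
  rewrite DE ler_pdivrMr // mulrC -ler_pdivrMr //; apply: ltW.
  apply: lt_le_trans (archi_boundP _) _; first by rewrite divr_ge0 // ltW.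
  by rewrite ler_nat.
pose an n : 'rV[R]_d.+1 := vcons (c + (s0 + n%:R * D) * h)
   (\row_i (a 0 i + (s0 + n%:R * D) * w 0 i - D * `|w 0 i|)).
pose bn n : 'rV[R]_d.+1 := vcons (c + (s0 + n.+1%:R * D) * h)
   (\row_i (b 0 i + (s0 + n%:R * D) * w 0 i + D * `|w 0 i|)).
have w0 i : 0 <= D * `|w 0 i| by rewrite mulr_ge0.
have abn n i : an n 0 i <= bn n 0 i.
  case: (unliftP ord0 i) => [j ->|->]; last first.
    by rewrite !vcons0 lerD2l ler_pM2r // lerD2l ler_wpM2r // ler_nat.
  by rewrite !vconsS !mxE; have := ab j; have := w0 j; lra.
apply: le_trans (vol_finite_cover abn (N := N) _) _.
  move=> x [y [s [yb /andP[s1 s2] ->]]].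
  have [|n nN /andP[n1 n2]] := @step_cover (s - s0) D N; first by rewrite DN; lra.
  exists n => // i; case: (unliftP ord0 i) => [j ->|->]; last first.
    by rewrite !vcons0 ltrD2l lerD2l ltr_pM2r // ler_pM2r //; lra.
  rewrite !vconsS !mxE; have /andP[y1 y2] := yb j.
  have : `|(s - s0 - n%:R * D) * w 0 j| <= D * `|w 0 j|.
    rewrite normrM ler_wpM2r // ger0_norm; last by lra.
    by move: n2; rewrite -natr1 mulrDl mul1r; lra.
  by rewrite ler_norml; lra.
have vE n : box_vol (an n) (bn n) = D * h * p.[D].
  rewrite /box_vol big_ord_recl !vcons0; congr (_ * _); first by rewrite -natr1; ring.
  by rewrite pE; apply: eq_bigr => i _; rewrite !vconsS !mxE; ring.
under eq_bigr do rewrite vE.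
rewrite sumr_const card_ord -[D * h * _ *+ N]mulr_natl !mulrA DN lee_fin.
have [L00|L1] := eqVneq L 0; first by rewrite L00 mulr0 !mul0r add0r ltW.
have Dp : 0 < D <= x0 by rewrite Dx DE divr_gt0 // lt_neqAle eq_sym L1.
have := Hx D Dp; rewrite p0 ler_norml => /andP[_ h2].
have h3 : p.[D] <= box_vol a b + e / (h * L + 1) by lra.
apply: le_trans (ler_wpM2l _ h3) _; first by rewrite mulr_ge0 // ltW.
rewrite mulrDr (mulrC L) lerD2l mulrCA ger_pMr // ler_pdivrMr //; lra.
Qed.

Lemma vol_shear (X : set 'rV[R]_d) (w : 'rV[R]_d) (c h s0 L V : R) : 0 < h -> 0 <= L ->
  (vol X <= V%:E)%E -> (vol (sheared X w c h s0 L) <= (h * L * V)%:E)%E.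
Proof.
move=> h0 L0 XV; apply/lee_addgt0Pr => e e0; rewrite -EFinD.
have hL0 : 0 <= h * L by rewrite mulr_ge0 // ltW.
have hL : 0 < h * L + 1 by lra.
have [a [b [[ab cov] sum]]] := vol_approx XV (divr_gt0 e0 hL).
apply: (@le_trans _ _ (vol (\bigcup_n sheared (box (a n) (b n)) w c h s0 L))).
  by apply: vol_mono => x [y [s [/cov[n _ bn] hs ->]]]; exists n => //; exists y, s.
apply: le_trans (vol_bigcup (fun n => vol_shear_box w c s0 h0 L0 (ab n))) _.
under eq_eseriesr do rewrite EFinM.
rewrite nneseriesZl => [|n _]; last by rewrite lee_fin box_vol_ge0.
apply: le_trans (lee_wpmul2l _ sum) _; first by rewrite lee_fin.
rewrite -EFinM lee_fin mulrDr lerD2l mulrCA ger_pMr // ler_pdivrMr //; lra.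
Qed.

End Shear.

Section Projection.
Variables (R : realType) (d : nat) (p q : 'rV[R]_d.+1).
Let h := q 0 ord0 - p 0 ord0.
Let w := vtail q - vtail p.
Hypothesis h_gt0 : 0 < h.

Definition shadow (x : 'rV[R]_d.+1) := vtail x - ((x 0 ord0 - p 0 ord0) / h) *: w.

Lemma shadow_sheared (A : set 'rV[R]_d.+1) s0 L x : A x ->
  s0 < (x 0 ord0 - p 0 ord0) / h <= s0 + L -> sheared (shadow @` A) w (p 0 ord0) h s0 L x.
Proof.
move=> Ax hs; exists (shadow x), ((x 0 ord0 - p 0 ord0) / h); split; [exact: imageP|by []|].
by rewrite divfK ?gt_eqF // /shadow subrK addrC subrK vcons_eta.
Qed.

Lemma vol_slab (A : set 'rV[R]_d.+1) s0 L V : 0 <= L -> (vol (shadow @` A) <= V%:E)%E ->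
  (vol [set x | A x /\ (s0 < (x 0%R ord0 - p 0%R ord0) / h <= s0 + L)%R] <= (h * L * V)%:E)%E.
Proof.
move=> L0 HV; apply: le_trans (vol_shear w (p 0 ord0) s0 h_gt0 L0 HV).
by apply: vol_mono => x [Ax hs]; exact: shadow_sheared.
Qed.

(** Lift the vertices to A and add q or p as one more vertex. The difference of the two determinants
    has q - p as a row, so it equals h times the determinant of the shadows. *)
Lemma shadow_simplex (A : set 'rV[R]_d.+1) (D : R) : A p -> A q ->
  (forall Y : 'I_d.+2 -> 'rV[R]_d.+1, (forall k, A (Y k)) -> `|\det (edges Y)| <= D) ->
  forall Y : 'I_d.+1 -> 'rV[R]_d, (forall k, (shadow @` A) (Y k)) ->
    `|\det (edges Y)| <= 2 * D / h.
Proof.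
move=> Ap Aq HD Y HY.
have exy k : exists x, A x /\ shadow x = Y k by have [x Ax <-] := HY k; exists x.
have [y yP] := choice exy.
pose Z z (k : 'I_d.+2) : 'rV[R]_d.+1 := if unlift ord0 k is Some j then
   (if unlift ord0 j is Some i then y (lift ord0 i) else z) else y ord0.
have ZA z : A z -> forall k, A (Z z k).
  move=> Az k; rewrite /Z; case: (unlift ord0 k) => [j|]; last exact: (yP ord0).1.
  by case: (unlift ord0 j) => [i|] //; exact: (yP _).1.
have Z0 z : Z z ord0 = y ord0 by rewrite /Z unlift_none.
have Z1 z : Z z (lift ord0 ord0) = z by rewrite /Z liftK unlift_none.
have Z2 z i : Z z (lift ord0 (lift ord0 i)) = y (lift ord0 i) by rewrite /Z !liftK.
have rZ z : repl (edges (Z q)) ord0 (z - y ord0) = edges (Z z).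
  apply/row_matrixP => k; rewrite row_repl; case: eqP => [->|/eqP k0].
    by rewrite row_edges Z0 Z1.
  rewrite !row_edges !Z0; case: (unliftP ord0 k) k0 => [i ->|->]; last by rewrite eqxx.
  by rewrite !Z2.
pose M := repl (edges (Z q)) ord0 (q - p).
have dM : `|\det M| <= 2 * D.
  have -> : \det M = \det (edges (Z q)) - \det (edges (Z p)).
    have -> : M = repl (edges (Z q)) ord0 ((q - y ord0) + - (p - y ord0)).
      by rewrite /M opprB addrA subrK.
    by rewrite det_replD det_replN !rZ.
  apply: le_trans (ler_normB _ _) _.
  by have := HD _ (ZA q Aq); have := HD _ (ZA p Ap); lra.
have M0 : row ord0 M = vcons h w.
  rewrite row_repl eqxx -[LHS]vcons_eta /h /w !mxE; congr vcons.
  by apply/rowP => k; rewrite !mxE.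
have MS k : row (lift ord0 k) M = y (lift ord0 k) - y ord0.
  by rewrite row_repl row_edges Z0 Z2.
have E := det_project (lt0r_neq0 h_gt0) M0.
rewrite ler_pdivlMr // mulrC -(gtr0_norm h_gt0) -normrM.
suff -> : h * \det (edges Y) = \det M by [].
rewrite E; congr (_ * \det _); apply/row_matrixP => k.
rewrite row_edges -!(yP _).2 rowK MS; have -> : M (lift ord0 k) ord0 = (y (lift ord0 k) - y ord0) 0 ord0.
  by rewrite -MS [RHS]mxE.
by apply/rowP => j; rewrite /shadow !mxE; field; rewrite gt_eqF.
Qed.

End Projection.

(** * Volume bounded by inscribed simplices *)

Section VolumeFromSimplex.
Variable R : realType.

(** A may be unbounded, so it is exhausted by bounded pieces, each inside arbitrarily thin boxes. *)
Lemma vol_flat d (A : set 'rV[R]_d.+1) : (forall x y, A x -> A y -> x 0 ord0 = y 0 ord0) ->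
  (vol A <= 0)%E.
Proof.
move=> flat; have [[p Ap]|no] := pselect (exists p, A p); last first.
  by apply: le_trans (vol_empty R d); apply: vol_mono => x Ax; apply: no; exists x.
pose An n := [set x | A x /\ forall j, `|vtail x 0 j| < n%:R].
apply: (@le_trans _ _ (vol (\bigcup_n An n))).
  apply: vol_mono => x Ax; exists (Num.bound (\sum_j `|vtail x 0 j|)) => //; split=> // j.
  apply: le_lt_trans (archi_boundP (sumr_ge0 _ _)) => //.
  by rewrite [leRHS](bigD1 j) //= lerDl sumr_ge0.
apply: vol_bigcup0 => n; apply/lee_addgt0Pr => e e0; rewrite add0e.
pose V := \prod_(j < d) (n%:R + n%:R : R) + 1.
have V0 : 0 < V by rewrite ltr_pwDr // prodr_ge0 // => j _; rewrite addr_ge0.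
have eV : 0 < e / V by rewrite divr_gt0.
pose a : 'rV[R]_d.+1 := vcons (p 0 ord0 - e / V) (const_mx (- n%:R)).
pose b : 'rV[R]_d.+1 := vcons (p 0 ord0) (const_mx n%:R).
apply: le_trans (_ : ((box_vol a b)%:E <= _)%E).
  apply: vol_le_box => [i|x [Ax xn] i]; case: (unliftP ord0 i) => [j ->|->].
  - by rewrite !vconsS !mxE; have : 0 <= n%:R :> R by []; lra.
  - by rewrite !vcons0; lra.
  - by rewrite !vconsS; have := xn j; rewrite !mxE ltr_norml => /andP[-> /ltW].
  - by rewrite !vcons0 (flat x p) // lexx andbT; lra.
rewrite lee_fin /box_vol big_ord_recl !vcons0 opprB addrC subrK.
under eq_bigr do rewrite !vconsS !mxE opprK.
by rewrite mulrAC ler_pdivrMr // ler_pM2l // /V lerDl.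
Qed.

(* Project along [q - p] for points [p], [q] of [A] almost as far apart in the first
   coordinate as possible. *)
Lemma vol_le_simplex d (A : set 'rV[R]_d.+1) (D : R) : 0 <= D ->
  (forall Y : 'I_d.+2 -> 'rV[R]_d.+1, (forall k, A (Y k)) -> `|\det (edges Y)| <= D) ->
  (vol A <= (16 ^+ d.+1 * D)%:E)%E.
Proof.
elim: d A D => [|d IH] A D D0 HD.
  have [[p Ap]|no] := pselect (exists p, A p); last first.
    apply: le_trans (_ : (0%:E <= _)%E); last by rewrite lee_fin mulr_ge0 // exprn_ge0.
    by apply: le_trans (vol_empty R 0); apply: vol_mono => x Ax; apply: no; exists x.
  apply/lee_addgt0Pr => e e0; rewrite -EFinD.
  pose a : 'rV[R]_1 := const_mx (p 0 ord0 - D - e); pose b : 'rV[R]_1 := const_mx (p 0 ord0 + D).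
  apply: le_trans (_ : ((box_vol a b)%:E <= _)%E); last first.
    by rewrite lee_fin /box_vol big_ord1 !mxE expr1; lra.
  apply: vol_le_box => [i|x Ax i]; first by rewrite !mxE; lra.
  rewrite !mxE (ord1 i).
  pose Y (k : 'I_2) := if k == ord0 then p else x.
  have := HD Y; have -> : \det (edges Y) = x 0 ord0 - p 0 ord0.
    by rewrite det_mx11 !mxE.
  move=> /(_ _)/wrap[k|]; first by rewrite /Y; case: eqP.
  by rewrite ler_norml; lra.
have : 0 <= 16 ^+ d.+1 :> R by rewrite exprn_ge0.
rewrite [16 ^+ d.+2]exprS; move: (16 ^+ d.+1) IH => K IH K0.
have KD : 0 <= 16 * K * D by rewrite !mulr_ge0.
have slab p q s0 L : A p -> A q -> 0 < q 0 ord0 - p 0 ord0 -> 0 <= L ->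
   (vol [set x | A x /\ (s0 < (x 0%R ord0 - p 0%R ord0) / (q 0%R ord0 - p 0%R ord0) <= s0 + L)%R]
     <= (L * (K * (2 * D)))%:E)%E.
  move=> Ap Aq h0 L0.
  have D2 : 0 <= 2 * D / (q 0 ord0 - p 0 ord0) by rewrite divr_ge0 ?mulr_ge0 // ltW.
  have := vol_slab h0 s0 L0 (IH _ _ D2 (shadow_simplex h0 Ap Aq HD)).
  suff -> : (q 0 ord0 - p 0 ord0) * L * (K * (2 * D / (q 0 ord0 - p 0 ord0))) =
    L * (K * (2 * D)) by [].
  by field; rewrite gt_eqF.
pose W : set R := fun t => exists p q, [/\ A p, A q & t = q 0 ord0 - p 0 ord0].
have [[t Wt t0]|flat] := pselect (exists2 t, W t & 0 < t); last first.
  apply: le_trans (vol_flat _) _; last by rewrite lee_fin.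
  move=> x y Ax Ay; have [lt|lt|//] := ltgtP (x 0 ord0) (y 0 ord0); exfalso; apply: flat.
    by exists (y 0 ord0 - x 0 ord0); [exists x, y|rewrite subr_gt0].
  by exists (x 0 ord0 - y 0 ord0); [exists y, x|rewrite subr_gt0].
have [[b Wb]|unb] := pselect (exists b, ubound W b).
  have hW : has_sup W by split; [exists t|exists b].
  have st : 0 < sup W by apply: lt_le_trans t0 (ub_le_sup _ Wt); exists b.
  have [_ [p [q [Ap Aq ->]]] h2] := sup_adherent (divr_gt0 st (ltr0n _ 2)) hW.
  have h0 : sup W / 2 < q 0 ord0 - p 0 ord0 by lra.
  have h1 : 0 < q 0 ord0 - p 0 ord0 by lra.
  (* As q - p has more than half the largest width, the parameters of A lie strictly between -2 and
     2. The slab has length 6, and 6 * 2 is below 16. *)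
  apply: le_trans (le_trans (slab p q (-3) 6 Ap Aq h1 _) _) => //.
    apply: vol_mono => x Ax; split=> //.
    have w1 : x 0 ord0 - p 0 ord0 <= sup W by apply: ub_le_sup; [exists b|exists p, x].
    have w2 : p 0 ord0 - x 0 ord0 <= sup W by apply: ub_le_sup; [exists b|exists x, p].
    rewrite ltr_pdivlMr // ler_pdivrMr //; lra.
  by rewrite lee_fin; nra.
(* Unbounded width: the part with first coordinate between -n and n takes an arbitrarily small
   fraction of some q - p, so it has volume zero. *)
apply: (@le_trans _ _ 0%E); last by rewrite lee_fin.
apply: (@le_trans _ _ (vol (\bigcup_n [set x | A x /\ (- n%:R < x 0%R ord0 <= n%:R)%R]))).
  apply: vol_mono => x Ax; exists (Num.bound `|x 0 ord0|) => //; split=> //.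
  by have := archi_boundP (normr_ge0 (x 0 ord0)); rewrite ltr_norml => /andP[-> /ltW].
apply: vol_bigcup0 => n; apply/lee_addgt0Pr => e e0; rewrite add0e.
pose C := n%:R * 2 * (K * (2 * D)).
have C0 : 0 <= C by rewrite /C !mulr_ge0.
have [p [q [Ap Aq h0 hC]]] : exists p q, [/\ A p, A q, 0 < q 0 ord0 - p 0 ord0 &
    C / e <= q 0 ord0 - p 0 ord0].
  apply: contrapT => H; apply: unb; exists (C / e) => _ [p [q [Ap Aq ->]]].
  rewrite leNgt; apply/negP => h; apply: H; exists p, q; split=> //; last exact: ltW.
  by apply: le_lt_trans h; rewrite divr_ge0 // ltW.
pose h := q 0 ord0 - p 0 ord0.
have L0 : 0 <= n%:R * 2 / h by rewrite divr_ge0 ?mulr_ge0 // ltW.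
apply: le_trans (le_trans (slab p q ((- n%:R - p 0 ord0) / h) _ Ap Aq h0 L0) _).
  apply: vol_mono => x [Ax /andP[x1 x2]]; split=> //.
  rewrite ltr_pM2r ?invr_gt0 // -mulrDl ler_pM2r ?invr_gt0 //; lra.
by rewrite lee_fin mulrAC ler_pdivrMr // [e * _]mulrC -ler_pdivrMr.
Qed.

End VolumeFromSimplex.

(** * Outer volume: lower bounds *)

Section Slice.
Variable R : realType.

(** The hypothesis is integrated over t, exchanging the sum and the integral. *)
Lemma interval_cover (c a b : nat -> R) (m l u : R) : l <= u ->
  (forall n, 0 <= c n) -> (forall n, a n <= b n) -> 0 <= m ->
  (forall t, l < t <= u -> (m%:E <= \sum_(0 <= n <oo) (c n * (a n < t <= b n)%R%:R)%:E)%E) ->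
  ((m * (u - l))%:E <= \sum_(0 <= n <oo) (c n * (b n - a n))%:E)%E.
Proof.
move=> lu c0 ab m0 H.
have int (k x y : R) : 0 <= k -> x <= y ->
    (\int[lebesgue_measure]_t (k * \1_(`]x, y]%classic) t)%:E = (k * (y - x))%:E)%E.
  move=> k0 xy.
  rewrite [LHS](@integralZl_indic _ _ _ lebesgue_measure setT measurableT (fun=> `]x, y]%classic) k) //; last first.
    by move=> k1; exfalso; lra.
  rewrite integral_indic // setIT EFinM; congr (_ * _)%E.
  apply: etrans (lebesgue_measure_itv `]x, y]) _; rewrite /= lte_fin.
  by case: ltP => // yx; congr EFin; lra.
have mi (k x y : R) : measurable_fun [set: R] (fun t : R => k * \1_(`]x, y]%classic) t).
  apply: measurable_funM; first exact: measurable_cst.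
  by apply: measurable_indic; exact: measurable_itv.
pose f n (t : R) := (c n * \1_(`]a n, b n]%classic) t)%:E.
have f0 n t : (0 <= f n t)%E by rewrite lee_fin mulr_ge0.
have iE (x y t : R) : \1_(`]x, y]%classic) t = (x < t <= y)%R%:R :> R.
  by rewrite indicE; congr (nat_of_bool _)%:R; apply/idP/idP; rewrite inE /= in_itv.
rewrite -int //.
apply: (@le_trans _ _ (\int[lebesgue_measure]_t (\sum_(0 <= n <oo) f n t))%E); last first.
  rewrite integral_nneseries //; last by move=> n; apply/measurable_EFinP; exact: mi.
  by under eq_eseriesr do rewrite int //.
apply: ge0_le_integral => //.
- by move=> t _; rewrite lee_fin mulr_ge0.
- by apply/measurable_EFinP; exact: mi.
- by apply: ge0_emeasurable_sum => // n _; apply/measurable_EFinP; exact: mi.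
- move=> t _; rewrite iE /f; under eq_eseriesr do rewrite iE.
  case E : (l < t <= u); first by rewrite mulr1; exact: H.
  rewrite mulr0; apply: nneseries_ge0 => n _ _.
  by rewrite lee_fin mulr_ge0.
Qed.

(** The half of Fubini that holds for outer measure and arbitrary A: a cover of A by boxes induces a
    cover of each slice. *)
Lemma vol_slice d (A : set 'rV[R]_d.+2) (m l u : R) : l <= u -> 0 <= m ->
  (forall t, l < t <= u -> (m%:E <= vol [set x | A (vcons t x)])%E) ->
  ((m * (u - l))%:E <= vol A)%E.
Proof.
move=> lu m0 H; apply: le_ereal_inf_tmp => _ [a [b [[ab cov] ->]]].
have c0 n : 0 <= box_vol (vtail (a n)) (vtail (b n)).
  by apply: box_vol_ge0 => i; rewrite !mxE.
have vE n : box_vol (vtail (a n)) (vtail (b n)) * (b n 0 ord0 - a n 0 ord0) = box_vol (a n) (b n).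
  by rewrite /box_vol [RHS]big_ord_recl mulrC; congr (_ * _); apply: eq_bigr => i _; rewrite !mxE.
rewrite -(eq_eseriesr (fun n _ => congr1 EFin (vE n))).
apply: interval_cover => // t /H /le_trans; apply.
pose b' n := if a n 0 ord0 < t <= b n 0 ord0 then vtail (b n) else vtail (a n).
apply: (@le_trans _ _ (\sum_(0 <= n <oo) (box_vol (vtail (a n)) (b' n))%:E)%E).
  apply: vol_le_cover; split=> [n i|x /cov[n _ bx]].
    by rewrite /b'; case: ifP => _; rewrite !mxE.
  exists n => // i; rewrite /b'; have := bx ord0; rewrite vcons0 => ->.
  by have := bx (lift ord0 i); rewrite vconsS !mxE.
apply: lee_nneseries => n _.
  by move=> _; rewrite lee_fin box_vol_ge0 // => i; rewrite /b'; case: ifP => _; rewrite !mxE.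
rewrite lee_fin /b'; case: ifP => _; first by rewrite mulr1.
by rewrite mulr0 /box_vol big_ord_recl subrr mul0r.
Qed.

Lemma vol_interval (A : set 'rV[R]_1) (l u : R) : l <= u ->
  (forall x : 'rV[R]_1, l < x 0 0 <= u -> A x) -> ((u - l)%:E <= vol A)%E.
Proof.
move=> lu H; apply: le_ereal_inf_tmp => _ [a [b [[ab cov] ->]]].
have vE n : 1 * (b n 0 ord0 - a n 0 ord0) = box_vol (a n) (b n).
  by rewrite mul1r /box_vol big_ord1.
rewrite -(eq_eseriesr (fun n _ => congr1 EFin (vE n))) -[u - l]mul1r.
apply: interval_cover => // t lt.
have [|n _ bx] := cov (const_mx t); first by apply: H; rewrite mxE.
have b0 k : (0 <= (1 * (a k 0 ord0 < t <= b k 0 ord0)%R%:R)%:E :> \bar R)%E by rewrite lee_fin mul1r.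
rewrite (nneseries_split _ n.+1) => [|k _]; last exact: b0.
rewrite add0n big_nat_recr //=; have := bx 0; rewrite mxE => ->; rewrite mulr1.
rewrite [X in (X + _)%E]addeC -addeA leeDl // adde_ge0 //; first by apply: sume_ge0.
exact: nneseries_ge0.
Qed.

End Slice.

Section Parallelepiped.
Variable R : realType.

Definition para d (z : 'rV[R]_d) (E : 'M[R]_d) : set 'rV[R]_d :=
  [set x | exists2 c : 'rV[R]_d, (forall k, `|c 0 k| <= 1) & x = z + c *m E].

(** A crude substitute for the true factor 2^n; an exponent of order n^2 is affordable. *)
Definition para_const (n : nat) : R := n%:R ^- (n * n).

Lemma para_const_step n : para_const n.+2 <= 2 / n.+2%:R * (para_const n.+1 * n.+2%:R ^- n.+1).
Proof.
have n2 : 1 <= n.+2%:R :> R by rewrite ler1n.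
have n0 : 0 < n.+2%:R :> R by lra.
have n1 : 0 < n.+1%:R :> R by rewrite ltr0n.
have le : n.+1%:R ^+ (n.+1 * n.+1) <= n.+2%:R ^+ (n.+1 * n.+1) :> R.
  by rewrite lerXn2r ?nnegrE ?ler_nat // ltW.
have P : 0 < n.+2%:R * (n.+1%:R ^+ (n.+1 * n.+1) * n.+2%:R ^+ n.+1) :> R.
  by rewrite !mulr_gt0 // exprn_gt0.
rewrite /para_const -mulrA -!invfM.
apply: (@le_trans _ _ (n.+2%:R * (n.+1%:R ^+ (n.+1 * n.+1) * n.+2%:R ^+ n.+1))^-1); last first.
  by rewrite ler_peMl ?ler1n // invr_ge0 ltW.
rewrite lef_pV2 ?posrE ?exprn_gt0 //.
apply: le_trans (_ : n.+2%:R * (n.+2%:R ^+ (n.+1 * n.+1) * n.+2%:R ^+ n.+1) <= _).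
  by rewrite ler_pM2l // ler_pM2r // exprn_gt0.
by rewrite -exprD -exprS; apply: ler_weXn2l => //; lia.
Qed.

Lemma vconsD d t t' (x x' : 'rV[R]_d) : vcons t x + vcons t' x' = vcons (t + t') (x + x').
Proof. by have := vcons_lin 1 1 t t' x x'; rewrite !scale1r !mul1r. Qed.

Lemma vconsZ d a t (x : 'rV[R]_d) : a *: vcons t x = vcons (a * t) (a *: x).
Proof. by have := vcons_lin a 0 t 0 x 0; rewrite !scale0r mul0r !addr0. Qed.

Lemma vcons_sum d n (a t : 'I_n -> R) (x : 'I_n -> 'rV[R]_d) :
  \sum_k a k *: vcons (t k) (x k) = vcons (\sum_k a k * t k) (\sum_k a k *: x k).
Proof.
apply/rowP => j; rewrite summxE; case: (unliftP ord0 j) => [i ->|->].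
  by rewrite vconsS summxE; apply: eq_bigr => k _; rewrite mxE vconsS mxE.
by rewrite vcons0; apply: eq_bigr => k _; rewrite mxE vcons0.
Qed.

Lemma para_xrow d (z : 'rV[R]_d) (E : 'M[R]_d) i j : para z (xrow i j E) `<=` para z E.
Proof.
move=> _ [c c1 ->]; exists (col_perm (tperm i j) c) => [k|]; first by rewrite mxE.
by rewrite /xrow row_permE col_permE tpermV mulmxA.
Qed.

Lemma det_xrow d (E : 'M[R]_d) i j : `|\det (xrow i j E)| = `|\det E|.
Proof. by rewrite /xrow row_permE det_mulmx det_perm normrM normrX normrN1 expr1n mul1r. Qed.

(* With a pivot row of maximal first entry, the slices of the parallelepiped contain
   translates of a fixed parallelepiped in one dimension less. *)
Lemma vol_para d (z : 'rV[R]_d.+1) (E : 'M[R]_d.+1) :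
  ((para_const d.+1 * `|\det E|)%:E <= vol (para z E))%E.
Proof.
elim: d z E => [|d IH] z E.
  rewrite /para_const invr1 mul1r det_mx11; set h := E 0 0.
  apply: (@le_trans _ _ ((z 0 0 + `|h|) - (z 0 0 - `|h|))%:E).
    by rewrite lee_fin; have := normr_ge0 h; lra.
  apply: vol_interval => [|x]; first by have := normr_ge0 h; lra.
  have [->|h0] := eqVneq h 0; first by rewrite normr0; lra.
  move=> /andP[x1 x2]; exists (const_mx ((x 0 0 - z 0 0) / h)) => [k|].
    rewrite mxE normrM normfV ler_pdivrMr ?normr_gt0 // mul1r ler_norml; lra.
  by apply/rowP => k; rewrite !mxE big_ord1 mxE !(ord1 k) divfK // addrC subrK.
have [/existsP[p0 p0P]|/existsPn z0] := boolP [exists i, E i ord0 != 0]; last first.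
  rewrite (_ : \det E = 0) ?normr0 ?mulr0 ?vol_ge0 //.
  rewrite (expand_det_col _ ord0) big1 // => i _.
  by have /negPn/eqP -> := z0 i; rewrite mul0r.
pose p := [arg max_(i > p0) `|E i ord0|]%O.
have pmax i : `|E i ord0| <= `|E p ord0|.
  by rewrite /p; case: arg_maxP => // j _ /(_ i); exact.
have {p0P} hp : E p ord0 != 0.
  by rewrite -normr_gt0; apply: lt_le_trans (pmax p0); rewrite normr_gt0.
rewrite -(det_xrow E ord0 p); apply: le_trans (vol_mono (@para_xrow _ z E ord0 p)).
have : forall i, `|xrow ord0 p E i ord0| <= `|xrow ord0 p E ord0 ord0|.
  by move=> i; rewrite !mxE tpermL; exact: pmax.
have : xrow ord0 p E ord0 ord0 != 0 by rewrite !mxE tpermL.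
move: (xrow ord0 p E) => {p p0 pmax hp}E h0 hmax.
set h := E ord0 ord0 in h0 hmax; pose w := vtail (row ord0 E).
have rE : row ord0 E = vcons h w by rewrite -[LHS]vcons_eta mxE.
have dE := det_project h0 rE; set E' := (\matrix_k _) in dE.
have n0 : 0 < d.+2%:R :> R by rewrite ltr0n.
have nh : 0 < `|h| by rewrite normr_gt0.
pose m := para_const d.+1 * `|\det (d.+2%:R^-1 *: E')|.
have pc0 : 0 <= para_const d.+1 by rewrite invr_ge0 exprn_ge0.
have m0 : 0 <= m by rewrite mulr_ge0.
apply: (@le_trans _ _ (m * ((z 0 ord0 + `|h| / d.+2%:R) - (z 0 ord0 - `|h| / d.+2%:R)))%:E).
  rewrite lee_fin /m detZ normrM normrX normfV normr_nat dE normrM.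
  have -> : z 0 ord0 + `|h| / d.+2%:R - (z 0 ord0 - `|h| / d.+2%:R) = 2 / d.+2%:R * `|h| by ring.
  have -> : para_const d.+1 * (d.+2%:R^-1 ^+ d.+1 * `|\det E'|) * (2 / d.+2%:R * `|h|) =
     2 / d.+2%:R * (para_const d.+1 * d.+2%:R ^- d.+1) * (`|h| * `|\det E'|).
    by rewrite exprVn; ring.
  by rewrite ler_wpM2r ?mulr_ge0 // para_const_step.
have hn : 0 <= `|h| / d.+2%:R by rewrite divr_ge0.
apply: vol_slice => // [|t /andP[t1 t2]].
  by apply: (@le_trans _ _ (z 0 ord0)); rewrite ?gerBl ?lerDl.
pose s := (t - z 0 ord0) / h.
have s1 : `|s| <= d.+2%:R^-1.
  by rewrite normrM normfV ler_pdivrMr // mulrC ler_norml; move: t1 t2; move: (`|h| / _) => q; lra.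
apply: le_trans (IH (vtail z + s *: w) (d.+2%:R^-1 *: E')) _.
apply: vol_mono => _ [c c1 ->].
pose lam k := E (lift ord0 k) ord0 / h.
have lam1 k : `|lam k| <= 1 by rewrite normrM normfV ler_pdivrMr // mul1r.
pose g k := d.+2%:R^-1 * c 0 k.
have g1 k : `|g k| <= d.+2%:R^-1.
  by rewrite normrM normfV normr_nat ger_pMr ?invr_gt0.
have [sg sgE] : exists sg, sg = \sum_k g k * lam k by exists (\sum_k g k * lam k).
(* The pivot coefficient corrects the first coordinate. It combines s with d + 1 terms, each of size
   at most 1 / (d + 2), so it stays within 1; this dictates the shrinking factor. *)
exists (vcons (s - sg) (\row_k g k)) => [k|].
  case: (unliftP ord0 k) => [j ->|->]; last first.
    rewrite vcons0 sgE; apply: le_trans (ler_normB _ _) _.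
    apply: le_trans (_ : d.+2%:R^-1 + \sum_(k < d.+1) d.+2%:R^-1 <= _).
      rewrite lerD //; apply: le_trans (ler_norm_sum _ _ _) _; apply: ler_sum => j _.
      by rewrite normrM -[leRHS]mulr1 ler_pM.
    by rewrite sumr_const card_ord -mulrS -[leLHS]mulr_natr mulVf // gt_eqF.
  rewrite vconsS mxE; apply: le_trans (g1 j) _.
  by rewrite invf_le1 // ler1n.
have rk k : row (lift ord0 k) E = vcons (lam k * h) (row k E' + lam k *: w).
  rewrite -[LHS]vcons_eta mxE divfK //; congr vcons.
  by rewrite rowK /lam subrK.
rewrite [X in _ = _ + X]mulmx_sum_row [X in _ = _ + X]big_ord_recl vcons0 rE.
under [X in _ = _ + (_ + X)]eq_bigr do rewrite vconsS mxE rk.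
rewrite vcons_sum vconsZ -{2}(vcons_eta z) !vconsD; congr vcons.
  under eq_bigr do rewrite mulrA.
  by rewrite -mulr_suml -sgE -mulrDl subrK /s divfK // addrC subrK.
under [in RHS]eq_bigr do rewrite scalerDr scalerA.
rewrite big_split /= -scaler_suml -sgE -addrA; congr (_ + _).
rewrite scalerBl [X in _ = _ + X]addrC addrA subrK; congr (_ + _).
rewrite mulmx_sum_row; apply: eq_bigr => k _.
by rewrite linearZ /= scalerA mulrC.
Qed.

End Parallelepiped.

(** * Assembly *)

Section Assembly.
Variable R : realType.

Lemma common_bound (k : nat) (T : choiceType) (F : 'I_k -> set T) (P : ('I_k -> T) -> R -> Prop) :
  (forall i, finite_set (F i)) -> (forall G (a b : R), a <= b -> P G a -> P G b) ->
  (forall G, (forall i, F i (G i)) -> exists B, P G B) ->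
  exists2 B, 0 < B & forall G, (forall i, F i (G i)) -> P G B.
Proof.
move=> finF Pmon PB.
have [[i F0]|F0] := pselect (exists i, F i = set0).
  by exists 1 => // G /(_ i); rewrite F0.
have exF i : exists x, F i x.
  by apply: contrapT => H; apply: F0; exists i; apply/seteqP; split=> // x Fx; case: H; exists x.
have [x0 x0F] := choice exF.
have exs i : exists s : seq T, F i = [set` s] by apply/finite_seqP.
have [s sF] := choice exs.
pose N := (\max_i size (s i)).+1.
(* An index past the end yields the default [x0 i], which is again a member. *)
pose g (f : {ffun 'I_k -> 'I_N}) i := nth (x0 i) (s i) (f i).
have gF f i : F i (g f i).
  have [lt|ge] := ltnP (f i) (size (s i)); first by rewrite {1}sF /=; exact: mem_nth.
  by rewrite /g nth_default.
have [B BP] := fin_all_exists (fun f => PB (g f) (gF f)).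
exists (1 + \sum_f `|B f|); first by rewrite ltr_pwDl // sumr_ge0.
move=> G GF; have lt i : (index (G i) (s i) < N)%N.
  rewrite ltnS; apply: leq_trans (index_size _ _) _.
  exact: (@leq_bigmax _ (fun i => size (s i))).
pose f : {ffun 'I_k -> 'I_N} := [ffun i => Ordinal (lt i)].
have -> : G = g f.
  apply/funext => i; rewrite /g ffunE /= nth_index //.
  by have := GF i; rewrite {1}sF.
apply: Pmon (BP f); apply: le_trans (ler_norm _) _.
by rewrite (bigD1 f) //= addrCA lerDl addr_ge0 // sumr_ge0.
Qed.

Lemma big_volume_simplex d (A : set 'rV[R]_d.+1) : (1%:E <= vol A)%E ->
  exists2 Y : 'I_d.+2 -> 'rV[R]_d.+1, (forall k, A (Y k)) & (2 * 16 ^+ d.+1)^-1 <= `|\det (edges Y)|.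
Proof.
move=> A1; apply: contrapT => H.
have P0 : 0 < 16 ^+ d.+1 :> R by rewrite exprn_gt0.
have D0 : 0 <= (2 * 16 ^+ d.+1)^-1 :> R by rewrite invr_ge0 mulr_ge0 // ltW.
have small Y : (forall k, A (Y k)) -> `|\det (edges Y)| <= (2 * 16 ^+ d.+1)^-1.
  by move=> YA; rewrite leNgt; apply/negP => /ltW h; apply: H; exists Y.
have := vol_le_simplex D0 small.
have -> : 16 ^+ d.+1 * (2 * 16 ^+ d.+1)^-1 = 2^-1 :> R by field; rewrite gt_eqF.
move=> h; have := le_trans A1 h; rewrite lee_fin.
by lra.
Qed.

(** Only points with positive weights are assumed in A, because a member need not contain the
    boundary of the simplex; a parallelepiped around the centroid consists of such points. *)
Lemma simplex_core_volume d (A : set 'rV[R]_d.+1) (Y : 'I_d.+2 -> 'rV[R]_d.+1) :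
  (forall t : 'I_d.+2 -> R, (forall k, 0 < t k) -> \sum_k t k = 1 -> A (\sum_k t k *: Y k)) ->
  ((para_const R d.+1 * (d.+2%:R ^- 2) ^+ d.+1 * `|\det (edges Y)|)%:E <= vol A)%E.
Proof.
move=> HA; have e0 : 0 <= d.+2%:R ^- 2 :> R by rewrite invr_ge0 exprn_ge0.
have -> : para_const R d.+1 * (d.+2%:R ^- 2) ^+ d.+1 * `|\det (edges Y)| =
    para_const R d.+1 * `|\det ((d.+2%:R ^- 2) *: edges Y)|.
  by rewrite detZ normrM (ger0_norm (exprn_ge0 _ e0)) mulrA.
apply: le_trans (vol_para (centroid Y) _) _; apply: vol_mono => _ [c c1 ->].
rewrite -scalemxAr scalemxAl.
have [|t [t0 t1 ->]] := @core_weights R d.+1 Y (d.+2%:R ^- 2 *: c); last exact: HA.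
by move=> j; rewrite mxE normrM (ger0_norm e0) ler_piMr.
Qed.

(** The 8, against the 4 of [finite_colorful], makes the inequality required by [colorful_body]
    strict. *)
Definition gamma_const d : R :=
  para_const R d.+1 * (d.+2%:R ^- 2) ^+ d.+1 *
  ((8 * d.+2%:R ^+ d.+1)^-1 * (2 * 16 ^+ d.+1)^-1 / (final_const R d.+1 ^+ d.+1 * 2 ^+ d.+1)).

Lemma slack_const_gt0 d (E : R) : 0 < E -> 0 < slack_const d.+1 E.
Proof.
by move=> E0; rewrite /slack_const mulr_gt0 ?exprn_gt0 ?mulr_gt0 ?exprn_gt0 // ltr0n.
Qed.

Lemma final_const_gt0 d : 0 < final_const R d.+1.
Proof.
have p0 : 0 < pot_const R d.+1 by rewrite /pot_const mulr_gt0 // exprn_gt0 // ltr0n.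
have c0 : 0 < det_const R d.+1 by rewrite /det_const invr_gt0 exprn_gt0 // mulr_gt0 // ltr0n.
have s0 := @slack_const_gt0 d (2 * pot_const R d.+1).
have c1 : 0 < 2 + (det_const R d.+1 / 2)^-1.
  by rewrite addr_gt0 // invr_gt0 divr_gt0.
rewrite /final_const /width_const /rainbow_tau; move: p0 c0 s0 c1.
move: (pot_const R d.+1) (2 + _) (slack_const d.+1 _) => p q s p0 _ s0 q0.
have {}s0 : 0 < s by apply: s0; rewrite mulr_gt0.
by repeat (apply: mulr_gt0 => //).
Qed.

Lemma colorful_gamma d : colorful_volume_helly d.+1 (d.+1 + d.+1) (gamma_const d).
Proof.
move=> F cF HF; set n := d.+1 in F cF HF *.
pose del0 : R := (2 * 16 ^+ d.+1)^-1.
have del0_gt0 : 0 < del0 by rewrite invr_gt0 mulr_gt0 // exprn_gt0.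
have [|||B B0 HB] := @common_bound (n + n) _ F (fun G B => exists Y : 'I_d.+2 -> 'rV[R]_d.+1,
    [/\ forall k j, `|Y k 0 j| <= B, forall i k, G i (Y k) & del0 <= `|\det (edges Y)|]).
- by move=> i; case: (cF i).
- by move=> G a b ab [Y [h1 h2 h3]]; exists Y; split=> // k j; exact: le_trans (h1 k j) ab.
- move=> G GF; have [Y YG dY] := big_volume_simplex (HF G GF).
  exists (\sum_k \sum_j `|Y k 0 j|), Y; split=> // [k j|i k]; last exact: YG.
  rewrite (bigD1 k) //= (bigD1 j) //= -addrA lerDl addr_ge0 ?sumr_ge0 // => k' _.
  exact: sumr_ge0.
have fc0 := final_const_gt0 d.
have fd0 : 0 < final_const R d.+1 ^+ d.+1 * 2 ^+ d.+1 by rewrite mulr_gt0 ?exprn_gt0.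
have d0 : 0 < d.+2%:R ^+ d.+1 :> R by rewrite exprn_gt0.
pose Gam : R := (8 * d.+2%:R ^+ d.+1)^-1 * del0 / (final_const R d.+1 ^+ d.+1 * 2 ^+ d.+1).
have Gam0 : 0 < Gam by rewrite /Gam divr_gt0 // mulr_gt0 // invr_gt0 mulr_gt0.
have small : final_const R d.+1 ^+ d.+1 * (2 ^+ d.+1 * Gam) < (4 * d.+2%:R ^+ d.+1)^-1 * del0.
  rewrite mulrA /Gam mulrC divfK ?gt_eqF // ltr_pM2r // ltf_pV2 ?posrE ?mulr_gt0 //.
  by rewrite ltr_pM2r // ltr_nat.
have F0 i : F i !=set0 by case: (cF i).
have [i [Y [GY HY]]] := @colorful_body R d.+1 (ltn0Sn d) F B del0 Gam B0 Gam0 F0 HB small.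
exists i; apply: le_trans (simplex_core_volume (Y := Y) _).
  rewrite lee_fin /gamma_const ler_wpM2l //; apply: mulr_ge0.
    by rewrite invr_ge0 exprn_ge0.
  by rewrite exprn_ge0 // invr_ge0 exprn_ge0.
move=> t t0 t1 A FA; have [_ _ /(_ A FA)/convex_setE cA] := cF i.
pose C := [set y | A y /\ forall j, `|y 0%R j| <= B].
suff : C (\sum_k t k *: Y k) by case.
apply: contrapT => nC.
have cC : convex_closed C.
  move=> x y a b [Ax xB] [Ay yB] a0 b0 ab; split; first exact: cA.
  move=> j; rewrite !mxE; apply: le_trans (ler_normD _ _) _.
  rewrite !normrM (ger0_norm a0) (ger0_norm b0) -[leRHS]mul1r -ab mulrDl.
  by rewrite lerD // ler_wpM2l.
have dY : \det (edges Y) != 0 by rewrite -normr_gt0; exact: lt_le_trans GY.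
have [s [sC [k sk]]] := simplex_separation cC dY t0 t1 nC.
have := HY A s FA (fun y Ay yB => sC y (conj Ay yB)) k.
by rewrite leNgt sk.
Qed.

End Assembly.

(** * The line *)

Section OneDim.
Variable R : realType.

Lemma convex_rV1 (C : set 'rV[R]_1) (x y z : 'rV[R]_1) : convex_closed C -> C x -> C z ->
  x 0 0 <= y 0 0 <= z 0 0 -> C y.
Proof.
move=> cC Cx Cz /andP[xy yz]; have [xz|xz] := ltP (x 0 0) (z 0 0); last first.
  suff -> : y = x by [].
  by apply/rowP => j; rewrite (ord1 j); lra.
have p : 0 < z 0 0 - x 0 0 by lra.
have := cC x z ((z 0 0 - y 0 0) / (z 0 0 - x 0 0)) ((y 0 0 - x 0 0) / (z 0 0 - x 0 0)) Cx Cz.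
have -> : (z 0 0 - y 0 0) / (z 0 0 - x 0 0) *: x + (y 0 0 - x 0 0) / (z 0 0 - x 0 0) *: z = y.
  by apply/rowP => j; rewrite !mxE (ord1 j); field; rewrite gt_eqF.
by apply; [apply: divr_ge0; lra|apply: divr_ge0; lra|field; rewrite gt_eqF].
Qed.

Lemma vol_le_diam (A : set 'rV[R]_1) (D : R) : 0 <= D ->
  (forall x y : 'rV[R]_1, A x -> A y -> y 0 0 - x 0 0 <= D) -> (vol A <= D%:E)%E.
Proof.
move=> D0 HD; have [[p Ap]|no] := pselect (exists p, A p); last first.
  apply: le_trans (_ : (0%:E <= _)%E); last by rewrite lee_fin.
  by apply: le_trans (vol_empty R 0); apply: vol_mono => x Ax; apply: no; exists x.
pose P : set R := fun t => exists2 x, A x & t = x 0 0.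
have P0 : P !=set0 by exists (p 0 0), p.
have hP : has_inf P.
  by split=> //; exists (p 0 0 - D) => _ [x Ax ->]; have := HD x p Ax Ap; lra.
apply/lee_addgt0Pr => e e0; rewrite -EFinD.
pose a : 'rV[R]_1 := const_mx (inf P - e); pose b : 'rV[R]_1 := const_mx (inf P + D).
apply: le_trans (_ : ((box_vol a b)%:E <= _)%E); last first.
  by rewrite lee_fin /box_vol big_ord1 !mxE; lra.
apply: vol_le_box => [i|x Ax i]; first by rewrite !mxE; lra.
rewrite !mxE (ord1 i).
have h1 : inf P <= x 0 0 by apply: ge_inf; [case: hP|exists x].
have h2 : x 0 0 - D <= inf P.
  by apply: lb_le_inf => // _ [y Ay ->]; have := HD y x Ay Ax; lra.
by apply/andP; split; lra.
Qed.

Lemma maxmin (I J : finType) (i0 : I) (j0 : J) (x : I -> J -> R) :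
  exists a, (exists i, forall j, a <= x i j) /\ forall i, exists j, x i j <= a.
Proof.
pose m i := [arg min_(j < j0) x i j]%O.
have mP i j : x i (m i) <= x i j by rewrite /m; case: arg_minP => // k _ /(_ j); exact.
pose i1 := [arg max_(i > i0) x i (m i)]%O.
have iP i : x i (m i) <= x i1 (m i1).
  by rewrite /i1; case: arg_maxP => // k _ /(_ i); exact.
by exists (x i1 (m i1)); split; [exists i1 => j|move=> i; exists (m i)].
Qed.

Lemma minmax (I J : finType) (i0 : I) (j0 : J) (x : I -> J -> R) :
  exists a, (exists i, forall j, x i j <= a) /\ forall i, exists j, a <= x i j.
Proof.
have [a [[i ia] aP]] := maxmin i0 j0 (fun i j => - x i j).
exists (- a); split; first by exists i => j; have := ia j; lra.
by move=> k; have [j h] := aP k; exists j; lra.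
Qed.

Lemma finite_family_ord (F : set (set 'rV[R]_1)) : finite_convex_family F ->
  exists n (A : 'I_n -> set 'rV[R]_1), [/\ (0 < n)%N, forall i, convex_closed (A i) &
    forall B, F B <-> exists i, B = A i].
Proof.
move=> [/finite_seqP[s sE] [A0 FA0] cF]; exists (size s), (fun i => nth A0 s i); split.
- by move: FA0; rewrite sE /=; case: (s).
- move=> i; have Fi : F (nth A0 s i) by rewrite sE /=; exact: mem_nth.
  exact: convex_setE (cF _ Fi).
- move=> B; rewrite sE /=; split=> [Bs|[i ->]]; last exact: mem_nth.
  have lt : (index B s < size s)%N by rewrite index_mem.
  by exists (Ordinal lt); rewrite /= nth_index.
Qed.

(** Take a = max_i min_j of x and b = min_i max_j of y. If a <= b, convexity puts the whole segment
    from a to b into every A i, hence into K. *)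
Lemma common_segment (I J : finType) (A : I -> set 'rV[R]_1) (K : set 'rV[R]_1)
    (x y : I -> J -> 'rV[R]_1) (D : R) (i0 : I) (j0 : J) :
  (forall i, convex_closed (A i)) -> (forall z, (forall i, A i z) -> K z) ->
  0 <= D -> (forall z z' : 'rV[R]_1, K z -> K z' -> z' 0 0 - z 0 0 <= D) ->
  (forall i j, A i (x i j)) -> (forall i j, A i (y i j)) ->
  exists a b, [/\ exists i, forall j, a <= x i j 0 0, exists i, forall j, y i j 0 0 <= b & b - a <= D].
Proof.
move=> cA AK D0 KD Ax Ay.
have [a [ai aP]] := maxmin i0 j0 (fun i j => x i j 0 0).
have [b [bi bP]] := minmax i0 j0 (fun i j => y i j 0 0).
exists a, b; split=> //; have [ab|ab] := leP a b; last by lra.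
have inK t : a <= t <= b -> K (const_mx t).
  move=> /andP[t1 t2]; apply: AK => i; have [j h] := aP i; have [j' h'] := bP i.
  apply: (convex_rV1 (cA i) (Ax i j) (Ay i j')); rewrite mxE.
  by rewrite (le_trans h t1) (le_trans t2 h').
have Ka : K (const_mx a) by apply: inK; rewrite lexx.
have Kb : K (const_mx b) by apply: inK; rewrite lexx andbT.
by have := KD _ _ Ka Kb; rewrite !mxE.
Qed.

Lemma colorful_line : colorful_volume_helly 1 2 (1 : R).
Proof.
move=> F cF HF; apply: contrapT => no.
pose K i := \bigcap_(A in F i) A.
have [m [A [m0 cA AF]]] := finite_family_ord (cF ord0).
have [n [B [n0 cB BF]]] := finite_family_ord (cF (lift ord0 ord0)).
have Klt i : exists2 v : R, 0 <= v < 1 & forall x y : 'rV[R]_1, K i x -> K i y -> y 0 0 - x 0 0 <= v.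
  have lt : (vol (K i) < 1%:E)%E by rewrite ltNge; apply/negP => h; apply: no; exists i.
  have fin : vol (K i) \is a fin_num.
    by rewrite ge0_fin_numE ?vol_ge0 // (lt_trans lt) // ltry.
  exists (fine (vol (K i))).
    by rewrite fine_ge0 ?vol_ge0 //= -lte_fin fineK.
  move=> x y Kx Ky; have [xy|xy] := leP (x 0 0) (y 0 0); last first.
    by apply: le_trans (_ : 0 <= _); [lra|rewrite fine_ge0 ?vol_ge0].
  rewrite -lee_fin fineK //; apply: vol_interval => // z /andP[z1 z2] C FC.
  have [_ _ /(_ C FC)/convex_setE cC] := cF i.
  by apply: (convex_rV1 cC (Kx C FC) (Ky C FC)); rewrite z2 ltW.
have [v1 v1P K1] := Klt ord0; have [v2 v2P K2] := Klt (lift ord0 ord0).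
pose D := Num.max v1 v2.
have [D0 D1 vD1 vD2] : [/\ 0 <= D, D < 1, v1 <= D & v2 <= D].
  by rewrite /D le_max gt_max !le_max !lexx orbT; case/andP: v1P => -> ->; case/andP: v2P => _ ->.
have exxy (ij : 'I_m * 'I_n) : exists z : 'rV[R]_1 * 'rV[R]_1,
    [/\ A ij.1 z.1, A ij.1 z.2, B ij.2 z.1, B ij.2 z.2 & D < z.2 0 0 - z.1 0 0].
  pose G (k : 'I_2) := if k == ord0 then A ij.1 else B ij.2.
  have GF k : F k (G k).
    rewrite /G; case: (unliftP ord0 k) => [j ->|->] /=.
      by rewrite (ord1 j); apply/BF; exists ij.2.
    by apply/AF; exists ij.1.
  apply: contrapT => H; have : (vol (\bigcap_k G k) <= D%:E)%E.
    apply: vol_le_diam => // x y Gx Gy; rewrite leNgt; apply/negP => lt; apply: H.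
    by exists (x, y); split=> //=;
      [apply: (Gx ord0)|apply: (Gy ord0)|apply: (Gx (lift ord0 ord0))|apply: (Gy (lift ord0 ord0))].
  by move/(le_trans (HF G GF)); rewrite lee_fin; lra.
have [z zP] := choice exxy.
have i0 := Ordinal m0; have j0 := Ordinal n0.
have [|||||a1 [b1 [[i1 a1P] [i1' b1P] h1]]] :=
  @common_segment _ _ A (K ord0) (fun i j => (z (i, j)).1) (fun i j => (z (i, j)).2) D i0 j0 cA.
- by move=> y Ay C /AF[i ->].
- exact: D0.
- by move=> x y Kx Ky; apply: le_trans (K1 x y Kx Ky) vD1.
- by move=> i j; have [] := zP (i, j).
- by move=> i j; have [] := zP (i, j).
have [|||||a2 [b2 [[j2 a2P] [j2' b2P] h2]]] :=
  @common_segment _ _ B (K (lift ord0 ord0)) (fun j i => (z (i, j)).1) (fun j i => (z (i, j)).2) D j0 i0 cB.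
- by move=> y By C /BF[i ->].
- exact: D0.
- by move=> x y Kx Ky; apply: le_trans (K2 x y Kx Ky) vD2.
- by move=> i j; have [] := zP (j, i).
- by move=> i j; have [] := zP (j, i).
(* These two pairs give b1 - a2 > D and b2 - a1 > D, while b1 - a1 and b2 - a2 are at most D: the
   sums contradict each other. *)
have [_ _ _ _ g1] := zP (i1', j2); have [_ _ _ _ g2] := zP (i1, j2').
by have := b1P j2; have := a2P i1'; have := a1P j2'; have := b2P i1; lra.
Qed.

End OneDim.

(** * Optimality *)

Section Optimality.
Variable R : realType.

Definition facet d (e : R) (p : 'I_d * bool) : set 'rV[R]_d :=
  [set x | (-1) ^+ p.2 * x 0 p.1 <= e].

Lemma convex_facet d e p : @convex_set R 'rV[R]_d (facet e p).
Proof.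
move=> x y t; rewrite !inE /facet /= => hx hy.
rewrite mxE [(_ *: x) _ _]mxE [(_ *: y) _ _]mxE mulrDr !(mulrCA ((-1) ^+ p.2)).
have t0 : 0 <= t%:num by [].
have t1 : 0 <= 1 - t%:num by rewrite subr_ge0.
rewrite [leRHS](_ : e = t%:num * e + (1 - t%:num) * e); last by ring.
by apply: lerD; apply: ler_wpM2l.
Qed.

(** Without facet p the cube is open in one direction. A box of half-length T there, centred so that
    it ends at the origin level on the side of the opposite facet, still fits; T makes the bound of
    [vol_para] equal to 1. *)
Lemma missing_facet_volume d (e : R) (p : 'I_d.+1 * bool) : 0 < e ->
  (1%:E <= vol (\bigcap_(q in [set q | q <> p]) facet e q))%E.
Proof.
case: p => j b e0; pose q := \prod_(i < d.+1 | i != j) e.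
have q0 : 0 < q by apply: prodr_gt0.
have c0 : 0 < para_const R d.+1 by rewrite invr_gt0 exprn_gt0.
pose T := (para_const R d.+1 * q)^-1.
have T0 : 0 < T by rewrite invr_gt0 mulr_gt0.
pose r : 'rV[R]_d.+1 := \row_i (if i == j then T else e).
pose z : 'rV[R]_d.+1 := - ((-1) ^+ (~~ b) * T) *: delta_mx 0 j.
have dE : `|\det (diag_mx r)| = T * q.
  rewrite det_diag (bigD1 j) //= mxE eqxx (eq_bigr (fun=> e)) => [|i /negPf ij].
    by rewrite ger0_norm // mulr_ge0 // ltW.
  by rewrite mxE ij.
apply: (@le_trans _ _ ((para_const R d.+1 * `|\det (diag_mx r)|)%:E)).
  by rewrite dE mulrCA /T mulVf // gt_eqF // mulr_gt0.
apply: le_trans (vol_para z (diag_mx r)) _; apply: vol_mono => _ [c c1 ->] [i b'] /= ne.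
have xE : (z + c *m diag_mx r) 0 i = z 0 i + c 0 i * r 0 i.
  by rewrite mxE mul_mx_diag [X in _ + X]mxE.
rewrite /facet /= xE !mxE eqxx /=.
have := c1 i; rewrite ler_norml => /andP[n1 n2].
have [ij|ij] := eqVneq i j; last first.
  by rewrite mulr0 add0r; case: b' {ne}; rewrite ?expr1 ?expr0 ?mul1r ?mulN1r; nra.
have -> : b' = ~~ b.
  apply/eqP; apply: contraT => h; case: ne; rewrite ij; congr (_, _).
  by move: h; case: (b'); case: (b).
rewrite mulr1 mulrDr mulrN mulrA -expr2 sqrr_sign mul1r.
by case: (~~ b); rewrite ?expr1 ?expr0 ?mul1r ?mulN1r; nra.
Qed.

Lemma colorful_optimal d k (gamma : R) : 0 < gamma -> (0 < k < 2 * d.+1)%N ->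
  ~ colorful_volume_helly d.+1 k gamma.
Proof.
move=> g0 /andP[k0 kd] H.
(* A half-open box covering the cube has side 3 * e, at most 1 and below gamma. *)
pose e := Num.min 1 gamma / 6.
have m0 : 0 < Num.min 1 gamma by rewrite lt_min ltr01.
have e0 : 0 < e by rewrite divr_gt0.
have e1 : 3 * e <= 1.
  have : Num.min 1 gamma <= 1 by rewrite ge_min lexx.
  by rewrite /e; lra.
have eg : 3 * e < gamma.
  have : Num.min 1 gamma <= gamma by rewrite ge_min lexx orbT.
  by rewrite /e; lra.
pose F (i : 'I_k) : set (set 'rV[R]_d.+1) := range (@facet d.+1 e).
have [||i] := H F.
- move=> i; split; first exact: finite_image.
    by exists (facet e (ord0, true)), (ord0, true).
  by move=> _ [p _ <-]; exact: convex_facet.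
- move=> G GF; have exg i : exists p, facet e p = G i by have [p _ <-] := GF i; exists p.
  have [g gP] := choice exg.
  have [p pg] : exists p, forall i, g i != p.
    apply: contrapT => no; have sur p : exists i, g i = p.
      by apply: contrapT => H'; apply: no; exists p => i; apply/eqP => E; apply: H'; exists i.
    have [h hK] := choice sur.
    have := leq_card h (can_inj hK); rewrite card_prod card_bool !card_ord mulnC.
    by rewrite leqNgt kd.
  apply: le_trans (missing_facet_volume p e0) _; apply: vol_mono => x Hx i _.
  by rewrite -gP; apply: Hx; apply/eqP.
apply/negP; rewrite -ltNge.
pose a : 'rV[R]_d.+1 := const_mx (- (2 * e)); pose b : 'rV[R]_d.+1 := const_mx e.
apply: (@le_lt_trans _ _ ((box_vol a b)%:E)).
  apply: vol_le_box => [j|x Hx j]; first by rewrite !mxE; lra.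
  have h1 := Hx (facet e (j, true)); have h2 := Hx (facet e (j, false)).
  move: h1 h2; rewrite /facet /= expr1 expr0 mulN1r mul1r => h1 h2.
  have {}h1 : - x 0 j <= e by apply: h1; exists (j, true).
  have {}h2 : x 0 j <= e by apply: h2; exists (j, false).
  by rewrite !mxE; apply/andP; split; lra.
rewrite lte_fin /box_vol; under eq_bigr do rewrite !mxE opprK.
rewrite prodr_const card_ord; apply: le_lt_trans eg.
have -> : e + 2 * e = 3 * e by ring.
have e3 : 0 <= 3 * e by lra.
by rewrite exprS ler_piMr // exprn_ile1.
Qed.

End Optimality.

(** * Constants *)

Section Constants.
Variables (R : realType) (e : nat).
Let D : R := e.+2%:R.
Implicit Types (x y : R) (a b : nat).

(** D is the dimension, at least 2, so numerical factors are also absorbed into its powers and only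
    exponents are tracked. *)
Definition pow_bounded x a := 0 <= x <= D ^+ a.

Let D2 : 2 <= D. Proof. by rewrite ler_nat. Qed.
Let D1 : 1 <= D. Proof. by have := D2; lra. Qed.

Lemma pow_boundedW x a b : (a <= b)%N -> pow_bounded x a -> pow_bounded x b.
Proof.
move=> ab /andP[x0 xa]; rewrite /pow_bounded x0; apply: le_trans xa _.
exact: ler_weXn2l.
Qed.

Lemma pow_boundedM x y a b : pow_bounded x a -> pow_bounded y b -> pow_bounded (x * y) (a + b).
Proof.
move=> /andP[x0 xa] /andP[y0 yb]; rewrite /pow_bounded mulr_ge0 //= exprD.
exact: ler_pM.
Qed.

Lemma pow_boundedX x a n : pow_bounded x a -> pow_bounded (x ^+ n) (a * n).
Proof.
move=> /andP[x0 xa]; rewrite /pow_bounded exprn_ge0 //= exprM.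
by rewrite lerXn2r // nnegrE // exprn_ge0 //; have := D1; lra.
Qed.

Lemma pow_bounded_nat n : pow_bounded (2 ^ n)%:R n.
Proof.
rewrite /pow_bounded ler0n natrX lerXn2r ?nnegrE //; have := D1; lra.
Qed.

Lemma pow_boundedD1 x a : pow_bounded x a -> pow_bounded (2 + x) (a + 2).
Proof.
move=> /andP[x0 xa]; apply/andP; split; first lra.
have d2 := D2; have d1 := D1.
have : 1 <= D ^+ a by rewrite exprn_ege1.
rewrite exprD expr2; nra.
Qed.

Lemma pow_boundedD : pow_bounded D 1.
Proof. by rewrite /pow_bounded expr1 lexx andbT; have := D1; lra. Qed.

Lemma pow_bounded2 : pow_bounded 2 1. Proof. exact: (pow_bounded_nat 1). Qed.

Lemma pow_boundedS : pow_bounded e.+3%:R 2.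
Proof.
rewrite /pow_bounded ler0n expr2 /D -natrM ler_nat; lia.
Qed.

Local Notation n := e.+2.

Lemma pow_bounded_pot : pow_bounded (pot_const R n) 8.
Proof.
rewrite /pot_const; apply: (@pow_boundedM _ _ 2 6); first exact: (pow_bounded_nat 2).
apply: (@pow_boundedX _ 2 3); rewrite addnn -mul2n natrM.
exact: (pow_boundedM pow_bounded2 pow_boundedD).
Qed.

Lemma pow_bounded_det : pow_bounded (2 + (det_const R n / 2)^-1) (9 * n + 3).
Proof.
have -> : (det_const R n / 2)^-1 = (D * pot_const R n) ^+ n * 2.
  by rewrite /det_const invfM !invrK.
rewrite -[3%N]/(1 + 2)%N addnA; apply: pow_boundedD1; apply: pow_boundedM pow_bounded2.
by apply: (@pow_boundedX _ 9); exact: (pow_boundedM pow_boundedD pow_bounded_pot).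
Qed.

Lemma pow_bounded_grid : pow_bounded (gridsize n)%:R (2 * n + 3).
Proof.
rewrite /gridsize; have H : pow_bounded ((2 ^ 2)%:R * (e.+3%:R ^+ n * D)) (2 + (2 * n + 1)).
  by apply: pow_boundedM (pow_bounded_nat 2) (pow_boundedM (pow_boundedX _ pow_boundedS) pow_boundedD).
have E : (2 + (2 * n + 1) = 2 * n + 3)%N by lia.
rewrite -E; case/andP: H => _ H; rewrite /pow_bounded ler0n; apply: le_trans H.
rewrite -natrX -!natrM ler_nat; move: (e.+3 ^ n)%N (expn_gt0 e.+3 n) => X X0; nia.
Qed.

Lemma pow_bounded_slack : pow_bounded (slack_const n (2 * pot_const R n)) (15 * n + 3).
Proof.
have E : (15 * n + 3 = 4 * n + ((2 * n + 3) + 9 * n))%N by lia.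
rewrite E /slack_const; apply: pow_boundedM.
  apply: (@pow_boundedX _ 4); rewrite !natrM.
  exact: (pow_boundedM (pow_boundedM pow_boundedS pow_boundedD) pow_boundedD).
apply: pow_boundedM pow_bounded_grid _.
by apply: (@pow_boundedX _ 9); exact: (pow_boundedM pow_bounded2 pow_bounded_pot).
Qed.

Lemma pow_bounded_final : pow_bounded (final_const R n) (40 * n).
Proof.
(* The inequality 24 n + 31 <= 40 n holds since n >= 2. *)
apply: (@pow_boundedW _ (24 * n + 31)); first lia.
have E : (24 * n + 31 =
  (1 + (1 + 1 + (1 + 8) + (1 + (9 * n + 3) + 1 + 1 + (15 * n + 3)))) + (8 + 2) + 0)%N by lia.
rewrite E addn0 /final_const /width_const /rainbow_tau.
apply: pow_boundedM (pow_boundedM pow_bounded_pot pow_boundedS).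
apply: pow_boundedM pow_boundedD _; apply: pow_boundedM (pow_boundedM (pow_boundedM pow_bounded2 pow_boundedD) (pow_boundedM pow_bounded2 pow_bounded_pot)) _.
apply: pow_boundedM pow_bounded_slack; apply: pow_boundedM pow_bounded2.
apply: pow_boundedM pow_boundedD; exact: pow_boundedM pow_bounded2 pow_bounded_det.
Qed.

(** The exponents add up to 41 n^2 + 11 n + 4, at most 48 n^2 for n >= 2; hence c = 48. *)
Lemma gamma_const_ge : D ^- (48 * n * n) <= gamma_const R e.+1.
Proof.
have fc0 := final_const_gt0 R e.+1.
pose inv := D ^+ (n * n) * (e.+3%:R ^+ 2) ^+ n *
  ((8 * e.+3%:R ^+ n) * (2 * 16 ^+ n) * (final_const R n ^+ n * 2 ^+ n)).
have E : gamma_const R e.+1 = inv^-1.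
  have aux (x y z t u : R) : x^-1 * y^-1 * (z^-1 * t^-1 / u) = (x * y * (z * t * u))^-1.
    by rewrite !invfM.
  by rewrite /gamma_const exprVn; exact: aux.
have D0 : 0 < D by have := D2; lra.
have S0 : 0 < e.+3%:R :> R by rewrite ltr0n.
have inv0 : 0 < inv.
  have h1 : 0 < D ^+ (n * n) * (e.+3%:R ^+ 2) ^+ n by rewrite mulr_gt0 // exprn_gt0 // exprn_gt0.
  have h2 : 0 < 8 * e.+3%:R ^+ n :> R by rewrite mulr_gt0 // exprn_gt0.
  have h3 : 0 < 2 * 16 ^+ n :> R by rewrite mulr_gt0 // exprn_gt0.
  have h4 : 0 < final_const R n ^+ n * 2 ^+ n by rewrite mulr_gt0 // exprn_gt0.
  exact: mulr_gt0 h1 (mulr_gt0 (mulr_gt0 h2 h3) h4).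
rewrite E lef_pV2 ?posrE ?exprn_gt0 //.
have : pow_bounded inv (1 * (n * n) + 2 * 2 * n + ((3 + 2 * n) + (1 + 4 * n) + (40 * n * n + 1 * n))).
  apply: pow_boundedM; first apply: pow_boundedM.
  - exact: (pow_boundedX _ pow_boundedD).
  - by do 2 apply: pow_boundedX; exact: pow_boundedS.
  apply: pow_boundedM; first apply: pow_boundedM.
  - by apply: pow_boundedM (pow_bounded_nat 3) (pow_boundedX _ pow_boundedS).
  - by apply: pow_boundedM pow_bounded2 (pow_boundedX _ (pow_bounded_nat 4)).
  by apply: pow_boundedM (pow_boundedX _ pow_bounded_final) (pow_boundedX _ pow_bounded2).
move=> /(@pow_boundedW _ _ (48 * n * n)) H.
by have /andP[] : pow_bounded inv (48 * n * n) by apply: H; nia.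
Qed.

End Constants.

Lemma gamma_const_gt0 (R : realType) d : 0 < gamma_const R d.
Proof.
have fc0 := final_const_gt0 R d.
have h1 : 0 < final_const R d.+1 ^+ d.+1 * 2 ^+ d.+1 by rewrite mulr_gt0 // exprn_gt0.
have h2 : 0 < 8 * d.+2%:R ^+ d.+1 :> R by rewrite mulr_gt0 // exprn_gt0.
have h3 : 0 < 2 * 16 ^+ d.+1 :> R by rewrite mulr_gt0 // exprn_gt0.
have h4 : 0 < para_const R d.+1 * (d.+2%:R ^- 2) ^+ d.+1.
  by rewrite mulr_gt0 ?exprn_gt0 // invr_gt0 exprn_gt0.
by apply: mulr_gt0 h4 _; rewrite divr_gt0 // mulr_gt0 // invr_gt0.
Qed.

Lemma colorful_volume_helly_le (R : realType) d k (g g' : R) : g' <= g ->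
  colorful_volume_helly d k g -> colorful_volume_helly d k g'.
Proof.
move=> gg H F cF HF; have [i h] := H F cF HF; exists i.
by apply: le_trans h; rewrite lee_fin.
Qed.

Theorem theorem1p1 (R : realType) :
  (forall d : nat, (1 <= d)%N ->
     exists gamma : R, 0 < gamma /\ colorful_volume_helly d (2 * d) gamma) /\
  colorful_volume_helly 1 2 (1 : R) /\
  (exists c : R, 0 < c /\
     forall d : nat, (2 <= d)%N ->
       colorful_volume_helly d (2 * d) (d%:R `^ (- (c * d%:R ^+ 2)))) /\
  (forall d k : nat, (1 <= d)%N -> (1 <= k < 2 * d)%N ->
     ~ exists gamma : R, 0 < gamma /\ colorful_volume_helly d k gamma).
Proof.
split; last (split; last split).
- case=> // d _; exists (gamma_const R d); split; first exact: gamma_const_gt0.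
  by rewrite mul2n -addnn; exact: colorful_gamma.
- exact: colorful_line.
- exists 48; split=> // -[|[|e]] // _; rewrite mul2n -addnn.
  apply: colorful_volume_helly_le (@colorful_gamma R e.+1).
  have -> : 48 * e.+2%:R ^+ 2 = (48 * e.+2 * e.+2)%:R :> R by rewrite !natrM expr2 mulrA.
  by rewrite powRN powR_mulrn //; exact: gamma_const_ge.
- case=> // d k _ kd [g [g0 H]]; exact: (colorful_optimal g0 kd H).
Qed.
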